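(* Let $d\ge 2$, let $\Sigma\subseteq N_{\mathbb{R}}$ be a simplicial $d$-fan, $\omega:\Sigma(d)\rightarrow\mathbb{R}_{>0}$ a weight function, and $*\in\mathrm{Inn}(N_{\mathbb{R}})$ an inner product such that $\mathrm{Cub}(\Sigma,* )\neq\emptyset$. Then the polynomial $\mathrm{Vol}_{\Sigma,\omega,*}$ is $\mathrm{Cub}(\Sigma,* )$-Lorentzian if the following two conditions are satisfied: (i) $\Sigma^\tau\setminus\{0\}$ is connected for any cone $\tau\in\Sigma(k)$ with $k\leq d-3$; (ii) the Hessian matrix of the quadratic polynomial $\mathrm{Vol}_{\Sigma^\tau,\omega^\tau,*^\tau}(z)$ has exactly one positive eigenvalue for any $\tau\in\Sigma(d-2)$.
   Context: **Lorentzian polynomials.** Let $C\subseteq\mathbb{R}_{>0}^n$ be a nonempty open convex cone and $f\in\mathbb{R}[x_1,\dots,x_n]$ homogeneous of degree $d$. For $v\in\mathbb{R}^n$ let $\partial_v=\sum_i v_i\,\partial/\partial x_i$. Then $f$ is $C$-Lorentzian if for all $v_1,\dots,v_d\in C$: (P) $\partial_{v_1}\cdots\partial_{v_d}f>0$, and (H) the Hessian matrix of $\partial_{v_3}\cdots\partial_{v_d}f$ has exactly one positive eigenvalue. **Fans.** $N_{\mathbb{R}}$ is a finite-dimensional real vector space. All fans are (finite) polyhedral fans that are pure (all maximal cones have the same dimension) and marked (a generator $0\neq u_\rho\in\rho$ is chosen for each ray $\rho$). A $d$-fan is such a fan of dimension $d$. $\Sigma(k)$ is the set of $k$-dimensional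 cones of $\Sigma$, $\sigma(k)$ the set of $k$-dimensional faces of a cone $\sigma$, $\preceq$ the face relation, $\sigma^\circ$ the relative interior, $N_{\sigma,\mathbb{R}}$ the linear span of $\sigma$. $\Sigma$ is simplicial if $\dim N_{\sigma,\mathbb{R}}=|\sigma(1)|$ for all $\sigma\in\Sigma$. $\mathrm{Inn}(N_{\mathbb{R}})$ is the set of inner products on $N_{\mathbb{R}}$. **Cubical values.** For $z\in\mathbb{R}^{\Sigma(1)}$ and $\sigma\in\Sigma$, $w_{\sigma,*}(z)\in N_{\sigma,\mathbb{R}}$ is the unique vector with $w_{\sigma,*}(z)*u_\rho=z_\rho$ for all $\rho\in\sigma(1)$. $\mathrm{Cub}(\Sigma,* )$ is the set of $z$ with $w_{\sigma,*}(z)\in\sigma^\circ$ for all $\sigma\in\Sigma$; it is an open convex cone contained in $\mathbb{R}_{>0}^{\Sigma(1)}$. **Volumes.** Let $P_{\sigma,*}(z)=\{v\in\sigma\mid v*u_\rho\le z_\rho\text{ for all }\rho\in\sigma(1)\}$. Let $M_\sigma\subseteq N_{\sigma,\mathbb{R}}$ be the lattice spanned by the basis dual to $\{u_\rho\mid\rho\in\sigma(1)\}$ with respect to $*$, and let $\mathrm{Vol}_\sigma$ be the volume function on polytopes in $N_{\sigma,\mathbb{R}}$ normalized so that a fundamental simplex of $M_\sigma$ (the convex hull of $0$ and a lattice basis) has volume $1$. For $z\in \mathrm{Cub}(\Sigma,* )$, $$\mathrm{Vol}_{\Sigma,\omega,*}(z)=\sum_{\sigma\in\Sigma(d)}\omega(\sigma)\mathrm{Vol}_\sigma(P_{\sigma,*}(z)).$$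 When $\mathrm{Cub}(\Sigma,* )\neq\emptyset$, this function agrees on the open cone $\mathrm{Cub}(\Sigma,* )$ with a homogeneous polynomial of degree $d$ in $\mathbb{R}[z_\rho\mid\rho\in\Sigma(1)]$, and $\mathrm{Vol}_{\Sigma,\omega,*}$ is identified with this polynomial. **Stars.** For $\tau\in\Sigma$, let $N^\tau_{\mathbb{R}}=N_{\tau,\mathbb{R}}^\perp\subseteq N_{\mathbb{R}}$ (orthogonal complement for $*$), and let $\mathrm{pr}^\tau:N_{\mathbb{R}}\to N^\tau_{\mathbb{R}}$ be the orthogonal projection. The star $\Sigma^\tau$ is the fan in $N^\tau_{\mathbb{R}}$ with cones $\pi^\tau:=\mathrm{pr}^\tau(\pi)$, where $\pi$ ranges over the faces of cones $\sigma\in\Sigma$ with $\tau\preceq\sigma$. The map $\sigma\mapsto\sigma^\tau$ is a bijection from $\{\sigma\in\Sigma\mid\tau\preceq\sigma\}$ to $\Sigma^\tau$, and $\Sigma^\tau$ is a simplicial fan of pure dimension $d^\tau=d-\dim\tau$. Each ray $\eta\in\Sigma^\tau(1)$ is the projection of a unique ray $\hat\eta$ among the rays of these cones, and is marked by $u_\eta=\mathrm{pr}^\tau(u_{\hat\eta})$. $*^\tau$ is the restriction of $*$ to $N^\tau_{\mathbb{R}}$, and $\omega^\tau(\sigma^\tau)=\omega(\sigma)$ for $\sigma\in\Sigma(d)$ with $\tau\preceq\sigma$. If $\mathrm{Cub}(\Sigma,* )\ne\emptyset$ then $\mathrm{Cub}(\Sigma^\tau,*^\tau)\ne\emptyset$,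 so $\mathrm{Vol}_{\Sigma^\tau,\omega^\tau,*^\tau}$ is a polynomial of degree $d^\tau$ in the variables $z_\eta$, $\eta\in\Sigma^\tau(1)$. $\Sigma^\tau\setminus\{0\}$ denotes the union of all cones of $\Sigma^\tau$ with the origin removed, as a topological space. *)

(* Defs.v *)
From HB Require Import structures.
From mathcomp Require Import all_boot all_order all_algebra.
From mathcomp Require Import all_classical all_reals all_analysis.
(* The notations of mpoly and of mathcomp-analysis have incompatible levels. *)
From mathcomp Require Import -(notations) mpoly.

Set Implicit Arguments.
Unset Strict Implicit.
Unset Printing Implicit Defensive.

Import Order.TTheory GRing.Theory Num.Theory.
Import numFieldNormedType.Exports.

Local Open Scope classical_set_scope.
Local Open Scope ring_scope.

Section Lorentzian.
Variables (R : realType) (m : nat).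
Implicit Types (f q : mpoly m R) (v : 'rV[R]_m) (C : set 'rV[R]_m).

Definition dirderiv v f : mpoly m R := \sum_(i < m) v ord0 i *: mderiv i f.

Definition dirderivs (s : seq 'rV[R]_m) f : mpoly m R := foldr dirderiv f s.

(* The Hessian at the origin.  It is only used for quadratic forms, whose
   Hessian does not depend on the point. *)
Definition hessian q : 'M[R]_m :=
  \matrix_(i, j) meval (fun=> 0) (mderiv i (mderiv j q)).

(* Eigenvalues are counted with multiplicity: one positive eigenvalue, and
   it is a simple root of the characteristic polynomial. *)
Definition one_pos_eigenvalue (A : 'M[R]_m) : Prop :=
  exists a : R, [/\ 0 < a, mup a (char_poly A) = 1%N
    & forall b : R, 0 < b -> eigenvalue A b -> b = a].

Definition open_positive_cone C : Prop :=
  [/\ open C, C !=set0,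
      forall x y, C x -> C y -> C (x + y),
      forall (a : R) x, 0 < a -> C x -> C (a *: x)
    & forall x, C x -> forall i, 0 < x ord0 i].

(* [drop 2 [:: v_1; ...; v_d]] is [[:: v_3; ...; v_d]]. *)
Definition lorentzian C (d : nat) f : Prop :=
  [/\ open_positive_cone C, f \is ishomog1 d mdeg
    & forall s : seq 'rV[R]_m, size s = d -> (forall v, v \in s -> C v) ->
        (exists2 c : R, 0 < c & dirderivs s f = mpolyC m c) /\
        one_pos_eigenvalue (hessian (dirderivs (drop 2 s) f))].

End Lorentzian.

(* Rays are numbered by ['I_nrays], ray [i] being marked by [gen i], and a
   (strongly convex) cone is given by the set of its rays.  This is only the
   data; see [is_fan]. *)
Record fan_data (R : realType) (n : nat) := FanData {
  nrays : nat;
  gen : 'I_nrays -> 'rV[R]_n;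
  cones : {set {set 'I_nrays}} }.

Section Fans.
Variables (R : realType) (n : nat).

Definition is_face (F C : set 'rV[R]_n) : Prop :=
  exists l : {scalar 'rV[R]_n},
    (forall v, C v -> 0 <= l v) /\ F = C `&` [set v | l v = 0].

Variable Sigma : fan_data R n.
Implicit Types (sigma tau pi : {set 'I_(nrays Sigma)}).

Definition cone sigma : set 'rV[R]_n :=
  [set v | exists2 a : 'I_(nrays Sigma) -> R,
     (forall i, 0 <= a i) & v = \sum_(i in sigma) a i *: gen i].

Definition cone_span sigma : {vspace 'rV[R]_n} :=
  <<[seq gen i | i <- enum sigma]>>%VS.

Definition face tau sigma : bool := `[< is_face (cone tau) (cone sigma) >].

(* [Sigma(k)] *)
Definition kcones (k : nat) : {set {set 'I_(nrays Sigma)}} :=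
  [set sigma in cones Sigma | \dim (cone_span sigma) == k].

(* The first four conditions say that the data encodes a marked collection of
   cones: the generators are nonzero, each is on a ray of the collection, a
   cone is represented only once, and [sigma] is indeed [sigma(1)].  The last
   two are the axioms of a fan. *)
Definition is_fan : Prop :=
  [/\ forall i, gen (f := Sigma) i != 0,
      forall i, [set i]%SET \in cones Sigma,
      {in cones Sigma &, injective cone},
      {in cones Sigma, forall sigma i, (i \in sigma) = face [set i]%SET sigma}
    & {in cones Sigma, forall sigma (F : set 'rV[R]_n),
         is_face F (cone sigma) -> exists2 tau, tau \in cones Sigma & F = cone tau}
      /\ {in cones Sigma &, forall sigma tau,
         is_face (cone sigma `&` cone tau) (cone sigma) /\
         is_face (cone sigma `&` cone tau) (cone tau)}].

Definition is_pure (d : nat) : Prop :=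
  cones Sigma != finset.set0 /\
  {in cones Sigma, forall sigma,
     {in cones Sigma, forall tau, face sigma tau -> tau = sigma} ->
     \dim (cone_span sigma) = d}.

Definition is_simplicial : Prop :=
  {in cones Sigma, forall sigma, \dim (cone_span sigma) = #|sigma|}.

Definition relint sigma : set 'rV[R]_n :=
  [set v | cone sigma v /\
    \forall y \near within [set` cone_span sigma] (nbhs v), cone sigma y].

Definition fan_support : set 'rV[R]_n :=
  \bigcup_(sigma in [set` cones Sigma]) cone sigma.

End Fans.

(* Lebesgue measure on [R^k], as an iterated integral. *)
Fixpoint lebesgue_tuple (R : realType) (k : nat) :
    set (k.-tuple R) -> \bar R :=
  match k with
  | 0 => fun A => \d_[tuple] A
  | k'.+1 => fun A =>
      \int[@lebesgue_measure R]_x lebesgue_tuple [set t | A (cons_tuple x t)]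
  end%E.

Section Volume.
Variables (R : realType) (n : nat) (Sigma : fan_data R n).
Variable ip : {dot 'rV[R]_n for idfun}.
Implicit Types (sigma : {set 'I_(nrays Sigma)}) (z : 'rV[R]_(nrays Sigma)).

(* [w_{sigma,*}(z)] *)
Definition cub_vertex sigma z : 'rV[R]_n :=
  xget 0 [set v | v \in cone_span sigma /\
                  {in sigma, forall i, ip v (gen i) = z ord0 i}].

Definition cub : set 'rV[R]_(nrays Sigma) :=
  [set z | {in cones Sigma, forall sigma, relint sigma (cub_vertex sigma z)}].

Definition cub_polytope sigma z : set 'rV[R]_n :=
  [set v | cone sigma v /\ {in sigma, forall i, ip v (gen i) <= z ord0 i}].

(* The basis of the lattice [M_sigma], dual to the generators of [sigma]. *)
Definition dual_gen sigma (i : 'I_(nrays Sigma)) : 'rV[R]_n :=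
  cub_vertex sigma (delta_mx ord0 i).

(* Lebesgue measure in the coordinates given by the lattice basis, rescaled
   by [#|sigma|`!] because the standard simplex has measure [1 / #|sigma|`!]. *)
Definition vol_cone sigma (A : set 'rV[R]_n) : R :=
  (#|sigma|)`!%:R * fine (lebesgue_tuple
    [set x : #|sigma|.-tuple R |
       A (\sum_(k < #|sigma|) tnth x k *: dual_gen sigma (enum_val k))]).

Variables (omega : {set 'I_(nrays Sigma)} -> R) (d : nat).

Definition vol z : R :=
  \sum_(sigma in kcones Sigma d) omega sigma * vol_cone sigma (cub_polytope sigma z).

(* The polynomial that agrees with [vol] on [cub] (it is unique as soon as
   [cub] is nonempty, being open). *)
Definition volpoly : mpoly (nrays Sigma) R :=
  xget 0 [set p | p \is ishomog1 d mdeg /\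
                  forall z, cub z -> meval (z ord0) p = vol z].

End Volume.

Arguments cub {R n} Sigma ip _.

Section Star.
Variables (R : realType) (n : nat) (Sigma : fan_data R n).
Variable ip : {dot 'rV[R]_n for idfun}.
Implicit Types (sigma tau pi : {set 'I_(nrays Sigma)}).

(* Projection onto [N_tau^perp] along [N_tau]. *)
Definition star_proj tau : 'End('rV[R]_n) :=
  daddv_pi (orthov ip (cone_span tau)) (cone_span tau).

(* The rays of [Sigma] that project to the rays of the star. *)
Definition star_rays tau : {set 'I_(nrays Sigma)} :=
  [set i | (i \notin tau) &&
     [exists sigma in cones Sigma, face tau sigma && (i \in sigma)]]%SET.

Definition star_cone tau pi : {set 'I_#|star_rays tau|} :=
  [set j | enum_val j \in pi]%SET.

(* The star is a fan in [N_tau^perp], kept here inside the ambient space (so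
   that its inner product is still [ip]).  Its rays are numbered through
   [enum_val : 'I_#|star_rays tau| -> 'I_(nrays Sigma)], and the rays of
   [star_proj tau (cone pi)] are the projections of those of [pi] not in
   [tau]. *)
Definition star tau : fan_data R n :=
  @FanData R n #|star_rays tau|
    (fun j => star_proj tau (gen (enum_val j)))
    [set star_cone tau pi | pi in cones Sigma &
       [exists sigma in cones Sigma, face tau sigma && face pi sigma]]%SET.

(* The maximal cone [sigma] containing [tau] is recovered from its projection
   as the union of [tau] and of the rays of the projection. *)
Definition star_weight tau (omega : {set 'I_(nrays Sigma)} -> R)
    (s : {set 'I_(nrays (star tau))}) : R :=
  omega (tau :|: [set enum_val j | j in s])%SET.

End Star.

Arguments star_weight {R n Sigma} ip tau omega s.

(* Main.v *)
Require Import Defs.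
From HB Require Import structures.
From mathcomp Require Import all_boot all_order all_algebra.
From mathcomp Require Import all_classical all_reals all_analysis.
From mathcomp Require Import -(notations) mpoly.
From mathcomp Require Import complex measurable_realfun zify ring lra.

(** Write [L_tau,i(z)] for the support number of the facet normal to [u_i] in
    the star of [tau]; it is linear in [z], and it is positive on [Cub] when
    [tau + i] is a cone.  Cutting a cubical polytope into pyramids over its
    facets suggests the polynomials [W_tau = sum_i L_tau,i * W_(tau+i)], with
    [W_tau = omega(tau)] on the maximal cones; they satisfy
    [D_v W_tau = (d - |tau|) * sum_i L_tau,i(v) * W_(tau+i)].  The volume agrees
    with [W_0] on [Cub]: both have the same partial derivatives (the slices of a
    polytope along a facet direction are polytopes of the star) and the same
    homogeneity.

    All mixed derivatives are thus positive combinations of those of the stars,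
    which gives (P).  For (H), induct on the codimension of [tau]: if [Q] is the
    Hessian form of a mixed derivative of [W_tau] and [e] is one of the cubical
    directions, then [Q = sum_i e_i Q_i] and [Q(u_i, x) = Q_i(e, x)] with [Q_i]
    coming from the star of [tau + i].  Bochner's method turns the reverse
    Cauchy-Schwarz inequality for the [Q_i] into [A <= A^2] for the operator [A]
    representing [Q], normalized so that [A e = e]; since [Q] has nonnegative
    off-diagonal entries and the link of [tau] is connected, Perron-Frobenius
    gives [A <= 1] with [ker (1 - A)] spanned by [e].  Hence [Q <= 0] on the
    orthogonal of [e]. *)

Set Implicit Arguments.
Unset Strict Implicit.
Unset Printing Implicit Defensive.

Import Order.TTheory GRing.Theory Num.Theory.
Import numFieldNormedType.Exports.

Local Open Scope classical_set_scope.
Local Open Scope ring_scope.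

(** * Signature of a real symmetric matrix *)

(** The polynomials [W_tau] are indexed by all sets of rays, with weight zero off the maximal cones:
    a meaningless [L_tau,i] of a dependent set only ever multiplies zero. The induction on [tau]
    thus takes place inside one polynomial ring, and stars occur as fans only where hypotheses (i)
    and (ii) are applied.

    Equality of partial derivatives leaves a constant of integration, which cannot be read off at
    the point where a slice degenerates, because that point is outside [Cub]. Homogeneity replaces
    it: a homothety of ratio slightly above 1 stays inside the open set [Cub] and multiplies the
    constant, which must therefore vanish.

    In the spectral picture, [A <= A^2] puts the eigenvalues of [A] outside the open interval from 0
    to 1, and [A <= 1] excludes those above 1. What remains is nonpositive except for the simple
    eigenvalue 1 of [e]. The step needs quadratic forms [Q_i] in the next stars, hence codimension
    at least 3; in codimension 2 hypothesis (ii) starts the induction. *)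

Lemma char_poly_conj (F : fieldType) n (P D : 'M[F]_n) :
  P \in unitmx -> char_poly (invmx P *m D *m P) = char_poly D.
Proof.
move=> uP; pose Q := map_mx (@polyC F) P; pose Qi := map_mx (@polyC F) (invmx P).
have QiQ : Qi *m Q = 1%:M by rewrite -map_mxM mulVmx // map_mx1.
have -> : char_poly (invmx P *m D *m P) = \det (Qi *m char_poly_mx D *m Q).
  rewrite /char_poly; congr (\det _).
  rewrite /char_poly_mx mulmxBr mulmxBl scalar_mxC -(mulmxA _ Qi) QiQ mulmx1.
  by rewrite !map_mxM.
rewrite !det_mulmx mulrAC -det_mulmx QiQ det1 mul1r //.
Qed.

Definition qform (F : fieldType) n (A : 'M[F]_n) (x y : 'rV[F]_n) : F :=
  (x *m A *m y^T) 0 0.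

(* The basis is complex because the spectral theorem of the library is; only
   the reality of the eigenvalues matters. *)
Lemma symmetric_unitary_diag (R : realType) n (A : 'M[R]_n) : A^T = A ->
  exists (U : 'M[R[i]]_n) (d : 'rV[R]_n),
    [/\ U *m (map_mx Num.conj U)^T = 1%:M,
        map_mx (real_complex R) A =
          (map_mx Num.conj U)^T *m diag_mx (map_mx (real_complex R) d) *m U
      & char_poly A = \prod_i ('X - (d 0 i)%:P)].
Proof.
move=> symA; pose AC := map_mx (real_complex R) A.
have hA : AC \is hermsymmx.
  apply: realsym_hermsym; last first.
    by apply/mxOverP => i j; rewrite mxE; apply/complex_realP; exists (A i j).
  by apply/is_hermitianmxP; rewrite expr0 scale1r map_mx_id // map_trmx symA.
have /hermitian_normalmx/orthomx_spectralP EA := hA.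
have /mxOverP rD := hermitian_spectral_diag_real hA.
have uU := spectral_unitarymx AC; have unU := spectral_unit AC.
set U := spectralmx AC in EA uU unU *; set D := spectral_diag AC in EA rD *.
pose d := \row_i complex.Re (D 0 i).
have dE : map_mx (real_complex R) d = D.
  by apply/rowP => i; rewrite !mxE; have := rD 0 i; rewrite complexRe => /Creal_ReP.
exists U, d; split.
- by have /unitarymxP := uU; rewrite map_trmx.
- by rewrite dE -/AC [LHS]EA invmx_unitary // map_trmx.
have cE (B : 'M[R[i]]_n) : map_mx (real_complex R) A = B ->
    map_poly (real_complex R) (char_poly A) = char_poly B.
  by move=> <-; rewrite map_char_poly.
apply: (@map_poly_inj _ _ (real_complex R)); rewrite (cE _ EA).
rewrite char_poly_conj // char_poly_trig ?diag_mx_is_trig // rmorph_prod.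
apply: eq_bigr => i _.
rewrite rmorphB /= map_polyX map_polyC /=.
rewrite mxE eqxx -dE mxE.
done.
Qed.

Section SymmetricSignature.
Local Notation "x %:C" := (real_complex _ x) : ring_scope.
Variables (R : realType) (n : nat) (A : 'M[R]_n) (U : 'M[R[i]]_n) (d : 'rV[R]_n).
Let C := R[i].
Local Notation toC := (map_mx (real_complex R)).
Let Us := (map_mx Num.conj U)^T.
Hypothesis symA : A^T = A.
Hypothesis UU : U *m Us = 1%:M.
Hypothesis AE : toC A = Us *m diag_mx (toC d) *m U.

(** The hermitian extension of [qform A], needed because the rows of [U] are complex. *)
Let hf (y z : 'rV[C]_n) : C := (y *m toC A *m (map_mx Num.conj z)^T) 0 0.

Let hf_diag y z :
  hf y z = \sum_k real_complex R (d 0 k) * (y *m Us) 0 k * Num.conj ((z *m Us) 0 k).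
Proof.
rewrite /hf AE !mulmxA.
have -> : y *m Us *m diag_mx (toC d) *m U *m (map_mx Num.conj z)^T =
  y *m Us *m diag_mx (toC d) *m (map_mx Num.conj (z *m Us))^T.
  rewrite map_mxM trmx_mul !mulmxA; congr (_ *m _ *m _).
  by rewrite /Us -map_trmx trmxK -map_mx_comp map_mx_id // => u /=; rewrite conjCK.
rewrite mul_mx_diag mxE; apply: eq_bigr => k _.
by rewrite !mxE [X in X * _]mulrC.
Qed.

Let hfDl y y' z : hf (y + y') z = hf y z + hf y' z.
Proof. by rewrite /hf !mulmxDl mxE. Qed.
Let hfZl a y z : hf (a *: y) z = a * hf y z.
Proof. by rewrite /hf -!scalemxAl mxE. Qed.
Let hfDr y z z' : hf y (z + z') = hf y z + hf y z'.
Proof. by rewrite /hf map_mxD linearD /= mulmxDr mxE. Qed.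
Let hfZr a y z : hf y (a *: z) = Num.conj a * hf y z.
Proof. by rewrite /hf map_mxZ linearZ /= -scalemxAr mxE. Qed.

Let hf_real x y : hf (toC x) (toC y) = real_complex R (qform A x y).
Proof.
rewrite /hf /qform.
have -> : map_mx Num.conj (toC y) = toC y.
  by rewrite /toC -map_mx_comp; apply: eq_map_mx => u /=; exact: conjc_real.
by rewrite /toC map_trmx -!map_mxM mxE.
Qed.

Let qformC x y : qform A x y = qform A y x.
Proof.
have -> : qform A y x = (x *m A *m y^T)^T 0 0.
  by rewrite /qform !trmx_mul trmxK symA mulmxA.
by rewrite mxE.
Qed.

Let coordK (w : 'rV[C]_n) : w *m U *m Us = w.
Proof. by rewrite -mulmxA UU mulmx1. Qed.

(** Otherwise the form would be positive definite on the plane spanned by [v] and [x]. That plane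
    contains a nonzero vector without component along the only possibly positive direction [i],
    where the form is nonpositive. *)
Lemma diag_le0 (i : 'I_n) v x : (forall k, k != i -> d 0 k <= 0) ->
  0 < qform A v v -> qform A x v = 0 -> qform A x x <= 0.
Proof.
move=> d_le0 v_gt0 xv0; rewrite leNgt; apply/negP => x_gt0.
pose al := (toC v *m Us) 0 i; pose be := (toC x *m Us) 0 i.
pose w := al *: toC x - be *: toC v.
have hw : hf w w = `|al| ^+ 2 * real_complex R (qform A x x)
                 + `|be| ^+ 2 * real_complex R (qform A v v).
  rewrite /w -scaleNr !hfDl !hfDr !hfZl !hfZr !hf_real (qformC v x) xv0.
  by rewrite rmorph0 !mulr0 addr0 add0r !mulrA rmorphN mulrNN -!normCK.
have wi : (w *m Us) 0 i = 0.
  rewrite mulmxBl -!scalemxAl mxE [X in X + _]mxE [X in _ + X]mxE [X in _ - X]mxE.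
  by rewrite -/al -/be mulrC subrr.
have: hf w w <= 0.
  rewrite hf_diag (bigD1 i) //= wi mulr0 mul0r add0r.
  rewrite -oppr_ge0 -sumrN; apply: sumr_ge0 => k ki.
  rewrite -mulrA -normCK -mulNr -rmorphN mulr_ge0 ?exprn_ge0 //.
  by rewrite ler0c oppr_ge0 d_le0.
rewrite hw => le0.
have al0 : al = 0.
  apply/eqP; rewrite -normr_eq0 -sqrf_eq0; apply/negPn/negP => al_neq0.
  suff /lt_geF : 0 < `|al| ^+ 2 * real_complex R (qform A x x)
      + `|be| ^+ 2 * real_complex R (qform A v v) by rewrite le0.
  apply: ltr_pwDl; last by apply: mulr_ge0; rewrite ?exprn_ge0 // ler0c ltW.
  by apply: mulr_gt0; rewrite ?ltcR // lt_def al_neq0 exprn_ge0.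
(* With [al = 0] the vector [w] may vanish, but now [v] itself has no component along [i]. *)
have: hf (toC v) (toC v) <= 0.
  rewrite hf_diag (bigD1 i) //= -/al al0 mulr0 mul0r add0r.
  rewrite -oppr_ge0 -sumrN; apply: sumr_ge0 => k ki.
  rewrite -mulrA -normCK -mulNr -rmorphN mulr_ge0 ?exprn_ge0 //.
  by rewrite ler0c oppr_ge0 d_le0.
by rewrite hf_real lecR leNgt v_gt0.
Qed.

(** Two positive diagonal entries would give a plane on which the form is positive definite, and
    this plane meets the orthogonal of [e]. *)
Lemma diag_unique e : 0 < qform A e e ->
  (forall x, qform A x e = 0 -> qform A x x <= 0) ->
  exists2 i, 0 < d 0 i & forall k, k != i -> d 0 k <= 0.
Proof.
move=> e_gt0 e_perp.
(* The hypothesis only concerns real vectors. If [w] is orthogonal to the real vector [e], so are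
   its real and imaginary parts, and the cross terms of [hf w w] cancel. *)
have hfc_le0 w : hf w (toC e) = 0 -> hf w w <= 0.
  have -> : w = toC (map_mx (@complex.Re R) w) + 'i *: toC (map_mx (@complex.Im R) w).
    by apply/rowP => k; rewrite !mxE complexRe complexIm -Crect.
  set a := map_mx _ w; set b := map_mx _ w.
  rewrite !hfDl !hfDr !hfZl !hfZr !hf_real conjCi (qformC b a) => abe.
  have [ae be] : qform A a e = 0 /\ qform A b e = 0.
    move: abe => /eqP; rewrite [_ == _]eq_complex /= !mul0r !mul1r.
    by rewrite !(addr0, add0r, subr0, oppr0, mulr0, mul0r) => /andP[/eqP-> /eqP->].
  have -> : 'i * (- 'i * (qform A b b)%:C) = (qform A b b)%:C :> R[i].
    by rewrite mulrA mulrN -expr2 sqrCi opprK mul1r.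
  rewrite mulNr addrA addrNK.
  by rewrite -rmorphD lecR -(addr0 0); apply: lerD; exact: e_perp.
have e_ge0 : exists i, 0 < d 0 i.
  apply: contrapT => /forallNP d_le0.
  have: hf (toC e) (toC e) <= 0.
    rewrite hf_diag -oppr_ge0 -sumrN; apply: sumr_ge0 => k _.
    rewrite -mulrA -normCK -mulNr -rmorphN mulr_ge0 ?exprn_ge0 //.
    by rewrite ler0c oppr_ge0 leNgt; apply/negP; exact: d_le0.
  by rewrite hf_real lecR leNgt e_gt0.
have [i d_gt0] := e_ge0; exists i => // j ji; rewrite leNgt; apply/negP => dj_gt0.
pose eh := toC e *m Us.
suff [al [be [ab0 ab_gt0]]] : exists al be : R[i],
    (d 0 i)%:C * al * Num.conj (eh 0 i) + (d 0 j)%:C * be * Num.conj (eh 0 j) = 0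
    /\ 0 < (d 0 i)%:C * (al * Num.conj al) + (d 0 j)%:C * (be * Num.conj be).
  pose wh : 'rV[R[i]]_n := \row_k (if k == i then al else if k == j then be else 0).
  have whE z : hf (wh *m U) z = (d 0 i)%:C * al * Num.conj ((z *m Us) 0 i)
      + (d 0 j)%:C * be * Num.conj ((z *m Us) 0 j).
    rewrite hf_diag coordK (bigD1 i) //= (bigD1 j) //= big1 ?addr0.
      by rewrite !mxE !eqxx (negPf ji).
    by move=> k /andP[/negPf ki /negPf kj]; rewrite [wh _ _]mxE ki kj mulr0 mul0r.
  have: hf (wh *m U) (wh *m U) <= 0 by apply: hfc_le0; rewrite whE.
  rewrite whE coordK !mxE !eqxx (negPf ji) -!mulrA.
  by rewrite (lt_geF ab_gt0).
have [ei0|ei0] := eqVneq (eh 0 i) 0.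
  exists 1, 0; rewrite ei0 !(rmorph0, rmorph1, mulr0, mul0r, addr0, mulr1); split=> //.
  by rewrite ltcR.
(* The two terms of the orthogonality relation cancel, and the second coefficient is nonzero because
   [eh 0 i] is. *)
exists (- ((d 0 j)%:C * Num.conj (eh 0 j))), ((d 0 i)%:C * Num.conj (eh 0 i)); split.
  by ring.
apply: ltr_wpDl.
  by rewrite mulr_ge0 ?ler0c ?mul_conjC_ge0 // ltW.
by rewrite mulr_gt0 ?ltcR ?mul_conjC_gt0 // mulf_neq0 ?conjC_eq0 // lt0r_neq0 ?ltcR.
Qed.

End SymmetricSignature.

Lemma root_prod_XsubC_in (F : fieldType) n (P : pred 'I_n) (d : 'rV[F]_n) x :
  reflect (exists2 k, P k & x = d 0 k) (root (\prod_(k | P k) ('X - (d 0 k)%:P)) x).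
Proof.
rewrite rootE horner_prod; apply: (iffP (prodf_eq0 _ _)) => [[k Pk]|[k Pk ->]].
  by rewrite hornerXsubC subr_eq0 => /eqP ->; exists k.
by exists k => //; rewrite hornerXsubC subrr.
Qed.

(** A second positive diagonal entry would have to equal [a], making [a] a double root. *)
Lemma one_pos_eigenvalue_le0 (R : realType) n (A : 'M[R]_n) v x : A^T = A ->
  one_pos_eigenvalue A -> 0 < qform A v v -> qform A x v = 0 -> qform A x x <= 0.
Proof.
move=> symA [a [a_gt0 mup1 uniqa]].
have [U [d [UU AE cE]]] := symmetric_unitary_diag symA.
have pn0 (P : pred 'I_n) : \prod_(k | P k) ('X - (d 0 k)%:P) != 0.
  by apply/prodf_neq0 => k _; rewrite polyXsubC_eq0.
have [i /eqP di] : exists i, d 0 i == a.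
  apply/existsP; apply: contraT => /existsPn nd.
  suff : mup a (char_poly A) = 0%N by rewrite mup1.
  apply: mupNroot; rewrite cE; apply/root_prod_XsubC_in => -[k _ E].
  by have := nd k; rewrite E eqxx.
apply: (diag_le0 symA AE (i := i)) => k ki; rewrite leNgt; apply/negP => dk.
have dka : d 0 k = a.
  apply: uniqa => //; rewrite eigenvalue_root_char cE.
  by apply/root_prod_XsubC_in; exists k.
have : (2 <= mup a (char_poly A))%N; last by rewrite mup1.
rewrite cE mup_geq ?pn0 // (bigD1 i) //= (bigD1 k) //= di dka mulrA -expr2.
exact: dvdp_mulr.
Qed.

Lemma le0_one_pos_eigenvalue (R : realType) n (A : 'M[R]_n) e : A^T = A ->
  0 < qform A e e -> (forall x, qform A x e = 0 -> qform A x x <= 0) ->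
  one_pos_eigenvalue A.
Proof.
move=> symA e_gt0 e_perp.
have [U [d [UU AE cE]]] := symmetric_unitary_diag symA.
have [i di dk] := diag_unique symA UU AE e_gt0 e_perp.
exists (d 0 i); split=> //.
  rewrite cE (bigD1 i) //= mupMl; last first.
    by apply/root_prod_XsubC_in => -[k ki E]; move: (dk k ki); rewrite -E leNgt di.
  by rewrite -['X - _]expr1 mup_XsubCX eqxx.
move=> b b_gt0; rewrite eigenvalue_root_char cE => /root_prod_XsubC_in[k _ bE].
have [ki|ki] := eqVneq k i; first by rewrite bE ki.
by move: (dk k ki); rewrite -bE leNgt b_gt0.
Qed.

(** * Bochner's inequality and Perron-Frobenius *)

Section BochnerPerron.
Variables (R : realFieldType) (p : nat) (q : 'I_p -> 'I_p -> R) (r e b : 'I_p -> R).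
Hypothesis qC : forall i j, q i j = q j i.
Hypothesis q_ge0 : forall i j, i != j -> 0 <= q i j.
Hypothesis e_gt0 : forall i, 0 < e i.
Hypothesis b_gt0 : forall i, 0 < b i.
Hypothesis q_conn : forall S : {set 'I_p}, S != finset.set0 -> S != finset.setT ->
  exists i j, [/\ i \in S, j \notin S & 0 < q i j].

Let beta (y : 'I_p -> R) i : R := \sum_(j | j != i) q i j * y j - r i * y i.

Hypothesis beta_e : forall i, beta e i = b i.
Hypothesis bochner : forall y,
  \sum_i y i * beta y i <= \sum_i e i * (beta y i) ^+ 2 / b i.

Let w i := b i / e i.

Let betaC x y : \sum_i x i * beta y i = \sum_i y i * beta x i.
Proof.
rewrite /beta; under eq_bigr do rewrite mulrBr mulr_sumr.
under [RHS]eq_bigr do rewrite mulrBr mulr_sumr.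
rewrite !sumrB; congr (_ - _); last by apply: eq_bigr => i _; ring.
rewrite (exchange_big_dep xpredT) //=; apply: eq_bigr => i _.
rewrite (eq_bigl (fun j => j != i)); last by move=> j; rewrite eq_sym.
by apply: eq_bigr => j _; rewrite qC; ring.
Qed.

(** The substitution of the ground state [e]: since [b] is [beta e], the diagonal coefficients [r]
    cancel, and symmetrizing in [i] and [j] leaves the Dirichlet form of the ratios [y i / e i]. *)
Let perron y :
  2 * \sum_i y i * (w i * y i - beta y i) =
  \sum_i \sum_(j | j != i) q i j * (e i * e j) * (y i / e i - y j / e j) ^+ 2.
Proof.
have en0 i : e i != 0 by rewrite gt_eqF.
pose T i j := q i j * (e j / e i * y i ^+ 2 - y i * y j).
have -> : \sum_i y i * (w i * y i - beta y i) = \sum_i \sum_(j | j != i) T i j.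
  apply: eq_bigr => i _; rewrite /w -beta_e /beta /T.
  transitivity (\sum_(j | j != i) (q i j * e j * (y i ^+ 2 / e i) - q i j * y j * y i)).
    by rewrite sumrB -!mulr_suml; field.
  by apply: eq_bigr => j _; field.
have TC : \sum_i \sum_(j | j != i) T i j = \sum_i \sum_(j | j != i) T j i.
  rewrite (exchange_big_dep xpredT) //=; apply: eq_bigr => i _.
  by apply: eq_bigl => j; rewrite eq_sym.
rewrite mulr_natl mulr2n {2}TC -big_split; apply: eq_bigr => i _.
rewrite -big_split; apply: eq_bigr => j _; rewrite /T (qC j i) /=; field.
by rewrite !en0.
Qed.

Let perron_ge0 y : 0 <= \sum_i y i * (w i * y i - beta y i).
Proof.
rewrite -(pmulr_rge0 _ (ltr0n R 2)) perron; apply: sumr_ge0 => i _.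
apply: sumr_ge0 => j ji; rewrite mulr_ge0 ?sqr_ge0 // mulr_ge0 ?q_ge0 1?eq_sym //.
by rewrite mulr_ge0 ?ltW.
Qed.

(** Every term of [perron] vanishes, so the ratio [y i / e i] is the same at both ends of any pair
    with positive [q]; connectedness makes it constant. *)
Let perron_eq0 y : \sum_i y i * (w i * y i - beta y i) = 0 ->
  exists c, forall i, y i = c * e i.
Proof.
move=> y0; have := perron y; rewrite y0 mulr0 => /esym P0.
have term_ge0 i j : j != i -> 0 <= q i j * (e i * e j) * (y i / e i - y j / e j) ^+ 2.
  move=> ji; rewrite mulr_ge0 ?sqr_ge0 // mulr_ge0 ?q_ge0 1?eq_sym //.
  by rewrite mulr_ge0 ?ltW.
have eq_ratio i j : j != i -> 0 < q i j -> y i / e i = y j / e j.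
  move=> ji qij; have T0 : q i j * (e i * e j) * (y i / e i - y j / e j) ^+ 2 = 0.
    move: P0 => /(psumr_eq0P (fun i _ => sumr_ge0 _ (fun j => term_ge0 i j))).
    move=> /(_ i isT) /(psumr_eq0P (fun j => term_ge0 i j)); exact.
  move/eqP: T0; rewrite mulf_eq0 sqrf_eq0 subr_eq0 gt_eqF ?mulr_gt0 //=.
  by move/eqP.
case: (pickP (@predT 'I_p)) => [i0 _|np]; last by exists 0 => i; have := np i.
exists (y i0 / e i0) => i.
pose S := [set i | y i / e i == y i0 / e i0]%SET.
have S0 : S != finset.set0 by apply/finset.set0Pn; exists i0; rewrite inE.
have [ST|/(q_conn S0)[j [k [jS kS qjk]]]] := eqVneq S finset.setT.
  by move: (finset.in_setT i); rewrite -ST inE => /eqP <-; rewrite divfK // gt_eqF.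
have kj : k != j by apply: contraNneq kS => ->.
by case/negP: kS; move: jS; rewrite !inE (eq_ratio j k).
Qed.

(* In coordinates weighted by [w], let [A] represent [beta], so that [A e = e].
   [bochner] says [A <= A^2], and [perron] that [T = 1 - A] is nonnegative with
   kernel spanned by [e].  So [x] orthogonal to [e] is [T y] for some [y], and
   [<x,Tx> - <x,x> = <x-y,T(x-y)> + (<Ty,Ty> - <y,Ty>) >= 0]. *)
Lemma bochner_perron x : \sum_i x i * b i = 0 -> \sum_i x i * beta x i <= 0.
Proof.
move=> xb0.
pose S : 'M[R]_p := \matrix_(j, i) (if j == i then w i + r i else - q j i).
have SE (y : 'rV[R]_p) i : (y *m S) 0 i = w i * y 0 i - beta (y 0) i.
  rewrite mxE (bigD1 i) //= /beta mxE eqxx.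
  rewrite (eq_bigr (fun j => - (q i j * y 0 j))); last first.
    by move=> j /negPf ji; rewrite mxE ji qC; ring.
  by rewrite sumrN; ring.
have symS : S^T = S.
  by apply/matrixP => i j; rewrite !mxE eq_sym; case: eqVneq => [->|_] //; rewrite qC.
pose wx : 'rV[R]_p := \row_i (w i * x i).
(* As [S] is symmetric, the columns of its cokernel lie in its kernel, so [perron_eq0] makes them
   multiples of [e]. The hypothesis on [x] says that [wx] is orthogonal to [e]. *)
have /submxP[y wxE] : (wx <= S)%MS.
  rewrite submxE; apply/eqP/rowP => k; rewrite mxE [RHS]mxE.
  have /perron_eq0[c ce] : \sum_i cokermx S i k * (w i * cokermx S i k
      - beta (fun i => cokermx S i k) i) = 0.
    apply: big1 => i _; set y : 'rV[R]_p := (col k (cokermx S))^T.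
    have yE j : y 0 j = cokermx S j k by rewrite !mxE.
    have := SE y i; rewrite /y -[X in _ *m X]symS -trmx_mul colE mulmxA mulmx_coker.
    rewrite mul0mx trmx0 mxE -colE -/y yE /beta.
    under [in X in X -> _]eq_bigr do rewrite yE.
    by rewrite yE => <-; rewrite mulr0.
  under eq_bigr do rewrite ce mxE.
  transitivity (c * \sum_i x i * b i); last by rewrite xb0 mulr0.
  rewrite mulr_sumr; apply: eq_bigr => i _.
  by rewrite /w; field; rewrite gt_eqF.
have byE i : beta (y 0) i = w i * (y 0 i - x i).
  by have := SE y i; rewrite -wxE mxE mulrBr => ->; ring.
have le1 : \sum_i x i * (w i * (y 0 i - x i)) <= 0.
  have := bochner (y 0); under eq_bigr do rewrite byE.
  under [X in _ <= X]eq_bigr do rewrite byE.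
  rewrite -subr_le0 -sumrB; congr (_ <= _); apply: eq_bigr => i _.
  by rewrite /w; field; rewrite !gt_eqF.
have := perron_ge0 (fun i => x i - y 0 i).
have bB i : beta (fun i => x i - y 0 i) i = beta x i - beta (y 0) i.
  rewrite /beta; under eq_bigr do rewrite mulrBr; rewrite sumrB; ring.
under eq_bigr do rewrite bB byE.
rewrite (eq_bigr (fun i => y 0 i * beta x i - x i * beta x i)); last by move=> i _; ring.
rewrite sumrB (betaC (y 0) x); under eq_bigr do rewrite byE.
by lra.
Qed.
End BochnerPerron.

(** * Iterated Lebesgue integrals *)

Section Affine.
Variable R : realType.
Local Notation mu := (@lebesgue_measure R).
Local Open Scope ereal_scope.

Lemma measurable_affine (a b : R) :
  measurable_fun setT (fun x : measurableTypeR R => a * x + b : measurableTypeR R)%R.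
Proof. by apply: measurable_realfun.measurable_funD => //; exact: mulrl_measurable. Qed.

Lemma lebesgue_measure_affine (a b : R) (A : set (measurableTypeR R)) :
  (0 < a)%R -> measurable A ->
  mu A = a%:E * mu ((fun x => a * x + b)%R @^-1` A).
Proof.
move=> a0 mA.
pose phi := fun x : measurableTypeR R => (a * x + b)%R : measurableTypeR R.
pose nu := mscale (NngNum (ltW a0))
  (measure_function_pushforward__canonical__measure_function_Measure mu
    (measurable_affine a b)).
rewrite -[RHS]/(nu A); apply: lebesgue_measure_unique => //= _ [[c d]] _ <-.
rewrite /nu /mscale /pushforward /=.
rewrite [X in _ = _ * mu X](_ : _ = [set` `]((c - b) / a)%R, ((d - b) / a)%R]]); last first.
  apply/seteqP; split=> x /=; rewrite /phi !in_itv /= ltr_pdivrMr // ler_pdivlMr //.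
    by rewrite ltrBlDr lerBrDr mulrC.
  by rewrite ltrBlDr lerBrDr mulrC.
rewrite !lebesgue_measure_itv /= !lte_fin ltr_pM2r ?invr_gt0 // ltrD2r.
case: ifP => _; last by rewrite mule0.
by rewrite -!EFinD -EFinM; congr EFin; field; rewrite gt_eqF.
Qed.

Lemma ge0_integral_affine (a b : R) (f : R -> \bar R) :
  (0 < a)%R -> measurable_fun [set: R] f -> (forall x, 0 <= f x) ->
  \int[mu]_x f x = a%:E * \int[mu]_x f (a * x + b)%R.
Proof.
move=> a0 mf f0.
pose push := measure_function_pushforward__canonical__measure_function_Measure mu
  (measurable_affine a b).
transitivity (\int[mscale (NngNum (ltW a0)) push]_x f x).
  by apply: eq_measure_integral => A mA _; exact: lebesgue_measure_affine.
rewrite ge0_integral_mscale //= ge0_integral_pushforward //.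
exact: measurable_affine.
Qed.
End Affine.

Section IteratedIntegral.
Variables (R : realType) (m : nat).
Local Notation mu := (@lebesgue_measure R).
Local Notation RM := (measurableTypeR R).
Implicit Types (f g : 'rV[R]_m) (s : seq 'I_m) (F G : 'rV[R]_m -> \bar R).

Definition upd f (i : 'I_m) (x : R) : 'rV[R]_m :=
  \row_j (if j == i then x else f 0 j).

Lemma updE f i x j : upd f i x 0 j = if j == i then x else f 0 j.
Proof. by rewrite mxE. Qed.

Lemma updC f i j x y : i != j -> upd (upd f i x) j y = upd (upd f j y) i x.
Proof.
move=> ij; apply/rowP => k; rewrite !updE.
by case: eqVneq => // ->; rewrite eq_sym (negPf ij).
Qed.

Lemma upd_id f i : upd f i (f ord0 i) = f.
Proof. by apply/rowP => j; rewrite updE; case: eqVneq => [->|]. Qed.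

Lemma upd_upd f i x y : upd (upd f i x) i y = upd f i y.
Proof. by apply/rowP => j; rewrite !updE; case: eqVneq. Qed.

Local Open Scope ereal_scope.

Fixpoint iterint s F f : \bar R :=
  if s is i :: s' then \int[mu]_x iterint s' F (upd f i x) else F f.

Lemma iterint_cons i s F f : iterint (i :: s) F f = \int[mu]_x iterint s F (upd f i x).
Proof. by []. Qed.

(* Measurability of [F] is only ever needed along measurable curves, which
   avoids choosing a sigma-algebra on ['rV[R]_m]. *)
Definition rowmeas F := forall (d : measure_display) (T : measurableType d)
  (h : T -> 'rV[R]_m), (forall j, measurable_fun [set: T] (fun t => h t ord0 j : R)) ->
  measurable_fun [set: T] (F \o h).

Lemma iterint_ge0 s F f : (forall g, 0 <= F g) -> 0 <= iterint s F f.
Proof. by move=> F0; elim: s f => [|i s IH] f //=; apply: integral_ge0 => x _. Qed.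

Lemma measurable_upd d (T : measurableType d) (h : T -> 'rV[R]_m) i (v : T -> R) :
  (forall j, measurable_fun [set: T] (fun t => h t ord0 j : R)) ->
  measurable_fun [set: T] v ->
  forall j, measurable_fun [set: T] (fun t => upd (h t) i (v t) ord0 j : R).
Proof.
move=> mh mv j; have [->|ji] := eqVneq j i.
  by apply: (eq_measurable_fun v) => // t _; rewrite updE eqxx.
by apply: (eq_measurable_fun (fun t => h t ord0 j)) => // t _; rewrite updE (negPf ji).
Qed.

(** This is why [rowmeas] ranges over all parameter spaces: the induction hypothesis is applied over
    [T * R], where the integration variable has become a parameter, and Tonelli integrates it
    out. *)
Lemma iterint_rowmeas s F : (forall g, 0 <= F g) -> rowmeas F -> rowmeas (iterint s F).
Proof.
move=> F0 mF; elim: s => [//|i s IH] d T h mh /=.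
pose G (z : T * R) := iterint s F (upd (h z.1) i z.2).
have mG : measurable_fun [set: (T * R)%type] G.
  apply: (IH _ _ (fun z : T * R => upd (h z.1) i z.2)).
  apply: measurable_upd => [j|]; last exact: measurable_snd.
  by apply: (measurableT_comp (mh j)); exact: measurable_fst.
have G0 z : 0 <= G z by exact: iterint_ge0.
exact: (@measurable_fun_fubini_tonelli_F _ _ T _ R mu G mG G0).
Qed.

Lemma iterint_swap s F f i j : (forall g, 0 <= F g) -> rowmeas F -> i != j ->
  iterint (i :: j :: s) F f = iterint (j :: i :: s) F f.
Proof.
move=> F0 mF ij.
pose G (z : RM * RM) := iterint s F (upd (upd f i z.1) j z.2).
have G0 z : 0 <= G z by exact: iterint_ge0.
have mG : measurable_fun [set: (RM * RM)%type] G.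
  apply: (iterint_rowmeas s F0 mF (h := fun z : R * R => upd (upd f i z.1) j z.2)).
  apply: measurable_upd => [k|]; last exact: measurable_snd.
  by apply: measurable_upd => [l|]; [exact: measurable_cst|exact: measurable_fst].
have E : \int[mu]_x \int[mu]_y G (x, y) = \int[mu]_y \int[mu]_x G (x, y).
  exact: (@fubini_tonelli _ _ RM RM R mu mu G mG G0).
rewrite [LHS]iterint_cons [RHS]iterint_cons.
under eq_integral do rewrite iterint_cons.
under [RHS]eq_integral do rewrite iterint_cons.
rewrite -[LHS]/(\int[mu]_x \int[mu]_y G (x, y)) E.
apply: eq_integral => y _; apply: eq_integral => x _.
by rewrite /G updC.
Qed.

Lemma iterint_move s t F f i : (forall g, 0 <= F g) -> rowmeas F -> i \notin s ->
  iterint (s ++ i :: t) F f = iterint (i :: s ++ t) F f.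
Proof.
move=> F0 mF; elim: s f => [//|j s IH] f.
rewrite inE negb_or => /andP[ij iS].
rewrite cat_cons -[RHS]/(iterint (i :: j :: (s ++ t)) F f) iterint_swap //.
rewrite [LHS]iterint_cons [RHS]iterint_cons.
by apply: eq_integral => x _; rewrite IH.
Qed.

Lemma eq_iterint s F G f :
  (forall g, (forall j, j \notin s -> g ord0 j = f ord0 j) -> F g = G g) ->
  iterint s F f = iterint s G f.
Proof.
elim: s f => [|i s IH] f FG; first by apply: FG.
rewrite !iterint_cons; apply: eq_integral => x _; apply: IH => g gE; apply: FG => j.
by rewrite inE negb_or => /andP[ji js]; rewrite gE // updE (negPf ji).
Qed.

Lemma iterint0 s f : iterint s (fun=> 0) f = 0.
Proof.
by elim: s f => // i s IH f; rewrite iterint_cons integral0_eq.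
Qed.

Lemma iterint_bounded s F f (B : R) : (0 <= B)%R -> (forall g, 0 <= F g <= 1) ->
  rowmeas F -> uniq s ->
  (forall g j, j \in s -> (forall k, k \notin s -> g ord0 k = f ord0 k) ->
    (`|g ord0 j| > B)%R -> F g = 0) ->
  iterint s F f <= ((2 * B) ^+ size s)%:E.
Proof.
move=> B0 F01 mF; have F0 g : 0 <= F g by case/andP: (F01 g).
elim: s f => [|i s IH] f /=; first by move=> _ _; case/andP: (F01 f).
move=> /andP[iS us] Fs.
have le x : iterint s F (upd f i x) <= ((2 * B) ^+ size s * \1_(`[(- B)%R, B]) x)%:E.
  rewrite indicE; case: (boolP (x \in _)) => [_|xB].
    rewrite mulr1; apply: IH => // g j js gE; apply: Fs; first by rewrite inE js orbT.
    move=> k; rewrite inE negb_or => /andP[ki ks].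
    by rewrite gE // updE (negPf ki).
  rewrite mulr0 (eq_iterint (G := fun=> 0)) ?iterint0 //.
  move=> g gE; apply: (Fs g i); rewrite ?mem_head //.
    move=> k; rewrite inE negb_or => /andP[ki ks].
    by rewrite gE // updE (negPf ki).
  rewrite gE // updE eqxx ltNge ler_norml.
  by apply: contra xB; rewrite inE /= in_itv /=.
apply: (@le_trans _ _ (\int[mu]_x ((2 * B) ^+ size s * \1_(`[(- B)%R, B]) x)%:E)).
  apply: ge0_le_integral => //.
  - by move=> x _; exact: iterint_ge0.
  - apply: (iterint_rowmeas s F0 mF (h := fun x : R => upd f i x)).
    by apply: measurable_upd => [j|]; [exact: measurable_cst|exact: measurable_id].
  - by apply/measurable_EFinP; apply: measurable_funM => //; exact: measurable_indic.
under eq_integral do rewrite EFinM.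
rewrite ge0_integralZl_EFin ?exprn_ge0 ?mulr_ge0 //; last first.
  by apply/measurable_EFinP; exact: measurable_indic.
rewrite integral_indic // setIT.
rewrite -[X in _ * X]/(lebesgue_measure ([set` `[(- B)%R, B]] : set R)).
rewrite lebesgue_measure_itv /= lte_fin.
case: ifP => [BB|_]; last by rewrite mule0 lee_fin exprn_ge0 // mulr_ge0.
by rewrite -EFinB -EFinM lee_fin exprSr opprK mulr2n mulrDl mul1r.
Qed.

Lemma iterint_affine s F f (a : R) (b : 'rV[R]_m) : (0 < a)%R ->
  (forall g, 0 <= F g) -> rowmeas F ->
  iterint s F (a *: f + b)%R = (a ^+ size s)%:E * iterint s (fun g => F (a *: g + b)%R) f.
Proof.
move=> a0 F0 mF; elim: s f => [|i s IH] f /=; first by rewrite mul1e.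
have mI (c : 'rV[R]_m) : measurable_fun [set: R] (fun x => iterint s F (upd c i x)).
  apply: (iterint_rowmeas s F0 mF (h := fun x : R => upd c i x)).
  by apply: measurable_upd => [j|]; [exact: measurable_cst|exact: measurable_id].
rewrite (ge0_integral_affine (b ord0 i) a0 (mI _)); last by move=> x; exact: iterint_ge0.
have updE' x : upd (a *: f + b)%R i (a * x + b ord0 i)%R = (a *: upd f i x + b)%R.
  by apply/rowP => j; rewrite !mxE; case: eqVneq => [->|].
under eq_integral do rewrite updE' IH.
rewrite ge0_integralZl_EFin ?exprn_ge0 ?ltW //.
- by rewrite muleA -EFinM -exprS.
- by move=> x _; exact: iterint_ge0.
- pose F' g := F (a *: g + b)%R.
  have mF' : rowmeas F'.
    move=> d T h mh; apply: (mF d T (fun t => a *: h t + b)%R) => j.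
    apply: (eq_measurable_fun (fun t => (a * h t ord0 j + b ord0 j)%R)).
      by move=> t _; rewrite !mxE.
    by apply: measurable_funD => //; apply: measurable_funM.
  have F'0 g : 0 <= F' g by exact: F0.
  apply: (iterint_rowmeas s F'0 mF' (h := fun x : R => upd f i x)).
  by apply: measurable_upd => [j|]; [exact: measurable_cst|exact: measurable_id].
Qed.

(** The passage from the anonymous variables of [lebesgue_tuple] to variables named by rays, which
    can be permuted and frozen one by one. The row [f] is arbitrary since every coordinate that is
    read gets overwritten. *)
Lemma lebesgue_tuple_iterint k (s : k.-tuple 'I_m) (A : set (k.-tuple R)) f :
  uniq s ->
  lebesgue_tuple A =
  iterint s (fun g => \d_(map_tuple (fun j => g ord0 j) s) A) f.
Proof.
elim: k s A f => [|k IH] s A f.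
  by move=> _; rewrite (tuple0 s) /= (tuple0 (map_tuple _ _)).
case/tupleP: s => i s /= /andP[iS us]; apply: eq_integral => x _.
rewrite (IH s _ (upd f i x)) //; apply: eq_iterint => g gE.
have -> : map_tuple (fun j => g ord0 j) [tuple of i :: s] =
    cons_tuple x (map_tuple (fun j => g ord0 j) s).
  by apply/val_inj => /=; rewrite gE // updE eqxx.
rewrite !diracE; congr (_%:R%:E); congr (nat_of_bool _).
Qed.

End IteratedIntegral.

(** * Vertices and support numbers *)

Section InnerProduct.
Variables (R : realType) (n : nat) (ip : {dot 'rV[R]_n for idfun}).
Implicit Types x y : 'rV[R]_n.

Lemma ipC x y : ip x y = ip y x.
Proof. by rewrite hermC expr0 mul1r. Qed.
Lemma ipDl x x' y : ip (x + x') y = ip x y + ip x' y.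
Proof. exact: linearDl. Qed.
Lemma ipZl a x y : ip (a *: x) y = a * ip x y.
Proof. exact: linearZl_LR. Qed.
Lemma ip0l y : ip 0 y = 0.
Proof. exact: linear0l. Qed.
Lemma ipBl x x' y : ip (x - x') y = ip x y - ip x' y.
Proof. exact: linearBl. Qed.
Lemma ip_suml I (r : seq I) P (F : I -> 'rV[R]_n) y :
  ip (\sum_(i <- r | P i) F i) y = \sum_(i <- r | P i) ip (F i) y.
Proof. by apply: (big_morph (fun x => ip x y)) => [x x'|]; [exact: ipDl|exact: ip0l]. Qed.
Lemma ipZr a x y : ip y (a *: x) = a * ip y x.
Proof. by rewrite ![ip y _]ipC ipZl. Qed.
Lemma ipBr x x' y : ip y (x - x') = ip y x - ip y x'.
Proof. by rewrite ![ip y _]ipC ipBl. Qed.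
Lemma ip_sumr I (r : seq I) P (F : I -> 'rV[R]_n) y :
  ip y (\sum_(i <- r | P i) F i) = \sum_(i <- r | P i) ip y (F i).
Proof. by rewrite ipC ip_suml; apply: eq_bigr => i _; rewrite ipC. Qed.
Lemma ip_gt0 x : x != 0 -> 0 < ip x x.
Proof. by move=> ?; exact: neq0_dnorm_gt0. Qed.
Lemma ip_ge0 x : 0 <= ip x x.
Proof. by have [->|/ip_gt0/ltW //] := eqVneq x 0; rewrite ip0l. Qed.
Lemma ip_eq0 x : ip x x = 0 -> x = 0.
Proof. by apply: contra_eq => /ip_gt0; rewrite lt0r => /andP[]. Qed.
End InnerProduct.

Section Generators.
Variables (R : realType) (n : nat) (Sigma : fan_data R n).
Implicit Types (sigma tau rho pi : {set 'I_(nrays Sigma)}) (a : 'I_(nrays Sigma) -> R).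

Definition indep sigma := forall a, \sum_(i in sigma) a i *: gen i = 0 ->
  forall i, i \in sigma -> a i = 0.

Lemma indepP sigma : \dim (cone_span sigma) = #|sigma| <-> indep sigma.
Proof.
have sz : size [seq gen i | i <- enum sigma] = #|sigma| by rewrite size_map -cardE.
pose X := map_tuple (@gen _ _ Sigma) (enum_tuple sigma).
have nthX (j : 'I_#|sigma|) : X`_j = gen (enum_val j).
  by rewrite -tnth_nth tnth_map (tnth_nth (enum_val j)) -enum_val_nth.
have freeX : (\dim (cone_span sigma) == #|sigma|) = free X by rewrite /free /= sz.
split.
  move=> /eqP; rewrite freeX => /freeP fX a a0 i iS.
  rewrite -(enum_rankK_in iS iS); apply: (fX (fun j => a (enum_val j))).
  rewrite -[RHS]a0 [RHS]big_enum_val; apply: eq_bigr => j _.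
  by rewrite nthX.
move=> indS; apply/eqP; rewrite freeX; apply/freeP => k k0 j.
pose a i := \sum_(l | enum_val l == i) k l.
have aE l : a (enum_val l) = k l.
  rewrite /a (eq_bigl (pred1 l)) ?big_pred1_eq // => l' /=.
  by rewrite (inj_eq enum_val_inj).
rewrite -aE; apply: indS; last exact: enum_valP.
rewrite -[RHS]k0 [LHS]big_enum_val; apply: eq_bigr => l _.
by rewrite aE nthX.
Qed.

Lemma indepS sigma tau : tau \subset sigma -> indep sigma -> indep tau.
Proof.
move=> ts iS a a0 i it; pose a' j := if j \in tau then a j else 0.
have := iS a' _ i (fintype.subsetP ts i it); rewrite /a' it; apply.
rewrite -[RHS]a0 (big_setID tau) /= (finset.setIidPr ts) [X in _ + X]big1 ?addr0.
  by apply: eq_bigr => j ->.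
by move=> j; rewrite inE => /andP[/negPf -> _]; rewrite scale0r.
Qed.

Lemma span_sum sigma a : \sum_(i in sigma) a i *: gen i \in cone_span sigma.
Proof.
apply: rpred_sum => i iS; apply: rpredZ; apply: memv_span.
by apply/mapP; exists i; rewrite ?mem_enum.
Qed.

Lemma spanP sigma v : v \in cone_span sigma ->
  exists a, v = \sum_(i in sigma) a i *: gen i.
Proof.
pose X := map_tuple (@gen _ _ Sigma) (enum_tuple sigma).
move=> vS; have := coord_span (X := X) vS.
have nthX (j : 'I_#|sigma|) : X`_j = gen (enum_val j).
  by rewrite -tnth_nth tnth_map (tnth_nth (enum_val j)) -enum_val_nth.
move=> vE; pose a i := \sum_(l | enum_val l == i) coord X l v.
exists a; rewrite [LHS]vE [RHS]big_enum_val; apply: eq_bigr => l _.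
rewrite nthX /a (eq_bigl (pred1 l)) ?big_pred1_eq // => l' /=.
by rewrite (inj_eq enum_val_inj).
Qed.

Lemma gen_span sigma i : i \in sigma -> gen i \in cone_span sigma.
Proof. by move=> iS; apply: memv_span; apply/mapP; exists i; rewrite ?mem_enum. Qed.

Lemma span_subset sigma tau v : tau \subset sigma -> v \in cone_span tau ->
  v \in cone_span sigma.
Proof.
move=> ts /spanP[a ->]; apply: rpred_sum => i it; apply: rpredZ.
by apply: gen_span; exact: fintype.subsetP it.
Qed.

Lemma indep_gen sigma i : indep sigma -> i \in sigma -> gen i \notin cone_span (sigma :\ i).
Proof.
move=> iS isig; apply/negP => /spanP[a gE].
pose a' j := if j == i then -1 else a j.
have := iS a' _ i isig; rewrite /a' eqxx => /(_ _)/eqP.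
rewrite oppr_eq0 oner_eq0 => H; suff /H : \sum_(j in sigma) a' j *: gen j = 0 by [].
rewrite (big_setD1 i) //= /a' eqxx scaleN1r [X in _ + X](eq_bigr (fun j => a j *: gen j)).
  by rewrite -gE addNr.
by move=> j; rewrite !inE => /andP[/negPf ->].
Qed.

Variable ip : {dot 'rV[R]_n for idfun}.
Implicit Types (z : 'rV[R]_(nrays Sigma)) (v : 'rV[R]_n).

Lemma span_ip_eq0 sigma v : v \in cone_span sigma ->
  (forall i, i \in sigma -> ip v (gen i) = 0) -> v = 0.
Proof.
move=> /spanP[a vE] v0; apply: (ip_eq0 (ip := ip)).
rewrite {2}vE ip_sumr big1 // => i iS.
by rewrite ipZr v0 // mulr0.
Qed.

Lemma vertex_exists sigma : indep sigma -> forall a, exists2 v, v \in cone_span sigma &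
  forall i, i \in sigma -> ip v (gen i) = a i.
Proof.
have [k] := ubnP #|sigma|; elim: k sigma => // k IH sigma sk iS a.
have [->|[i isig]] := set_0Vmem sigma.
  by exists 0; [exact: rpred0|move=> i; rewrite inE].
have tk : (#|sigma :\ i| < k)%N by move: sk; rewrite (cardsD1 i) isig.
have it : indep (sigma :\ i) by apply: indepS iS; exact: finset.subD1set.
have [w wS wE] := IH _ tk it a.
have [p pS pE] := IH _ tk it (fun j => ip (gen i) (gen j)).
pose u := gen i - p.
have u0 j : j \in sigma :\ i -> ip u (gen j) = 0.
  by move=> jt; rewrite ipBl pE // subrr.
have uu : ip u (gen i) = ip u u.
  rewrite {3}/u ipBr; have [b ->] := spanP pS.
  rewrite [X in _ - X](_ : _ = 0) ?subr0 // ip_sumr big1 // => j jt.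
  by rewrite ipZr u0 ?mulr0.
have u_gt0 : 0 < ip u u.
  apply: ip_gt0; rewrite subr_eq0; apply: contraNneq (indep_gen iS isig) => ->.
  exact: pS.
exists (w + (a i - ip w (gen i)) / ip u u *: u).
  have sub v : v \in cone_span (sigma :\ i) -> v \in cone_span sigma.
    by move=> vt; apply: span_subset vt; apply: finset.subD1set.
  apply: rpredD; first exact: sub.
  by apply: rpredZ; apply: rpredB; [exact: gen_span|exact: sub].
move=> j jsig; rewrite ipDl ipZl; have [->|ji] := eqVneq j i.
  by rewrite uu divfK ?gt_eqF // addrC subrK.
have jt : j \in sigma :\ i by rewrite !inE ji.
by rewrite u0 // mulr0 addr0 wE.
Qed.

Lemma vertexP sigma z : indep sigma -> cub_vertex ip sigma z \in cone_span sigma /\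
  forall i, i \in sigma -> ip (cub_vertex ip sigma z) (gen i) = z ord0 i.
Proof.
move=> iS; have [v vS vE] := vertex_exists iS (z ord0).
by rewrite /cub_vertex; case: xgetP => [w _ [wS wE]|/(_ v)[]].
Qed.

Lemma vertex_span sigma z : indep sigma -> cub_vertex ip sigma z \in cone_span sigma.
Proof. by move=> /(vertexP z)[]. Qed.

Lemma vertex_ip sigma z i : indep sigma -> i \in sigma ->
  ip (cub_vertex ip sigma z) (gen i) = z ord0 i.
Proof. by move=> /(vertexP z)[_ +]; apply. Qed.

Lemma vertex_unique sigma z v : indep sigma -> v \in cone_span sigma ->
  (forall i, i \in sigma -> ip v (gen i) = z ord0 i) -> cub_vertex ip sigma z = v.
Proof.
move=> iS vS vE; apply/eqP; rewrite -subr_eq0; apply/eqP.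
apply: (@span_ip_eq0 sigma); first by rewrite rpredB // vertex_span.
by move=> i iS'; rewrite ipBl vertex_ip // vE // subrr.
Qed.

Lemma vertexD sigma z z' : indep sigma ->
  cub_vertex ip sigma (z + z') = cub_vertex ip sigma z + cub_vertex ip sigma z'.
Proof.
move=> iS; apply: vertex_unique; rewrite ?rpredD ?vertex_span // => i it.
by rewrite ipDl !vertex_ip // mxE.
Qed.

Lemma vertexZ sigma (a : R) z : indep sigma ->
  cub_vertex ip sigma (a *: z) = a *: cub_vertex ip sigma z.
Proof.
move=> iS; apply: vertex_unique; rewrite ?rpredZ ?vertex_span // => i it.
by rewrite ipZl !vertex_ip // mxE.
Qed.


Lemma dual_ip sigma i j : indep sigma -> i \in sigma -> j \in sigma ->
  ip (gen j) (dual_gen ip sigma i) = (i == j)%:R.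
Proof. by move=> iS _ jS; rewrite ipC vertex_ip // mxE eqxx eq_sym. Qed.

Lemma dual_sum sigma a i : indep sigma -> i \in sigma ->
  ip (\sum_(j in sigma) a j *: gen j) (dual_gen ip sigma i) = a i.
Proof.
move=> iS isig; rewrite ip_suml (bigD1 i) //= ipZl dual_ip // eqxx mulr1 big1 ?addr0 //.
by move=> j /andP[jS ji]; rewrite ipZl dual_ip // eq_sym (negPf ji) mulr0.
Qed.

Lemma span_dual sigma v : indep sigma -> v \in cone_span sigma ->
  v = \sum_(i in sigma) ip v (dual_gen ip sigma i) *: gen i.
Proof.
move=> iS /spanP[a ->]; apply: eq_bigr => i isig.
by rewrite dual_sum.
Qed.

Lemma vertex_dual sigma z : indep sigma ->
  cub_vertex ip sigma z = \sum_(i in sigma) z ord0 i *: dual_gen ip sigma i.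
Proof.
move=> iS; apply: vertex_unique => //.
  by apply: rpred_sum => i _; rewrite rpredZ // vertex_span.
move=> j jS; rewrite ip_suml (bigD1 j) //= ipZl ipC dual_ip // eqxx mulr1 big1 ?addr0 //.
by move=> i /andP[iS' ij]; rewrite ipZl ipC dual_ip // (negPf ij) mulr0.
Qed.

Lemma coneP sigma v : indep sigma -> cone sigma v <->
  v \in cone_span sigma /\ forall i, i \in sigma -> 0 <= ip v (dual_gen ip sigma i).
Proof.
move=> iS; split.
  by move=> [a a0 ->]; split; [exact: span_sum|move=> i isig; rewrite dual_sum].
move=> [vS v0]; exists (fun i => if i \in sigma then ip v (dual_gen ip sigma i) else 0).
  by move=> i; case: ifP => // /v0.
by rewrite {1}(span_dual iS vS); apply: eq_bigr => i ->.
Qed.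

(* [L tau i z] is the support number, in the star of [tau], of the facet
   normal to the projection of [gen i]. *)
Definition L tau i z : R := z ord0 i - ip (cub_vertex ip tau z) (gen i).

(** The vertex of the row of inner products with [gen i] is the orthogonal projection of [gen i] to
    the span of [tau], so this is the marking of the ray in the star. *)
Definition perp tau (i : 'I_(nrays Sigma)) : 'rV[R]_n :=
  gen i - cub_vertex ip tau (\row_(j < nrays Sigma) ip (gen i) (gen j)).

Definition gram tau (i j : 'I_(nrays Sigma)) : R := ip (perp tau i) (perp tau j).

Lemma perp_ip0 tau i v : indep tau -> v \in cone_span tau -> ip (perp tau i) v = 0.
Proof.
move=> it /spanP[a ->]; rewrite ip_sumr big1 // => j jt.
by rewrite ipZr ipBl vertex_ip // mxE subrr mulr0.
Qed.

Lemma gramE tau i j : indep tau -> gram tau i j = ip (perp tau i) (gen j).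
Proof.
move=> it; rewrite /gram [perp tau j]/perp ipBr [X in _ - X]perp_ip0 ?subr0 //.
exact: vertex_span.
Qed.


Lemma gram_gt0 tau i : indep (i |: tau) -> i \notin tau -> 0 < gram tau i i.
Proof.
move=> iS it; apply: ip_gt0; rewrite subr_eq0.
have itau : indep tau by apply: indepS iS; exact: finset.subsetUr.
apply/eqP => E; have := indep_gen iS (finset.setU11 i tau); rewrite finset.setU1K // E.
by rewrite vertex_span.
Qed.

(** The vertex may only move along [perp tau i], which keeps the equations of [tau]; the equation at
    [i] determines how far. *)
Lemma vertexS tau i z : indep (i |: tau) -> i \notin tau ->
  cub_vertex ip (i |: tau) z =
  cub_vertex ip tau z + (L tau i z / gram tau i i) *: perp tau i.
Proof.
move=> iS it; have itau : indep tau by apply: indepS iS; exact: finset.subsetUr.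
have sub v : v \in cone_span tau -> v \in cone_span (i |: tau).
  by move=> vt; apply: span_subset vt; apply: finset.subsetUr.
apply: vertex_unique => //.
  apply: rpredD; first by apply: sub; exact: vertex_span.
  apply: rpredZ; apply: rpredB; first by apply: gen_span; exact: finset.setU11.
  by apply: sub; exact: vertex_span.
move=> j; rewrite in_setU1 ipDl ipZl => /predU1P[->|jt].
  by rewrite -gramE // divfK ?gt_eqF ?gram_gt0 // /L addrC subrK.
by rewrite vertex_ip // perp_ip0 ?gen_span // mulr0 addr0.
Qed.

(** Up to the lengths of the normals, this is the formula [(h_j - h_i cos) / sin] for the support
    numbers of a facet of a polytope. *)
Lemma LS tau i j z : indep (i |: tau) -> i \notin tau ->
  L (i |: tau) j z = L tau j z - gram tau i j / gram tau i i * L tau i z.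
Proof.
move=> iS it; have itau : indep tau by apply: indepS iS; exact: finset.subsetUr.
by rewrite {1}/L vertexS // ipDl ipZl -gramE // /L; ring.
Qed.

(** The dual vector of [i] kills the span of the other generators, so it sees only the last term of
    [vertexS]. This translates between the two views of [Cub]: positive coefficients of vertices and
    positive support numbers. *)
Lemma L_coef sigma i z : indep sigma -> i \in sigma ->
  L (sigma :\ i) i z =
  gram (sigma :\ i) i i * ip (cub_vertex ip sigma z) (dual_gen ip sigma i).
Proof.
move=> iS isig; have isE : i |: (sigma :\ i) = sigma by rewrite finset.setD1K.
have it : indep (sigma :\ i) by apply: indepS iS; exact: finset.subD1set.
have in_ : i \notin sigma :\ i by rewrite !inE eqxx.
have d0 v : v \in cone_span (sigma :\ i) -> ip v (dual_gen ip sigma i) = 0.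
  move=> /spanP[a ->]; rewrite ip_suml big1 // => j; rewrite !inE => /andP[ji jS].
  by rewrite ipZl dual_ip // eq_sym (negPf ji) mulr0.
rewrite -[X in cub_vertex ip X z]isE vertexS ?isE // ipDl ipZl.
rewrite d0 ?vertex_span // add0r /perp ipBl [X in _ - X]d0 ?vertex_span // subr0.
rewrite dual_ip // eqxx mulr1 mulrC divfK // gt_eqF // gram_gt0 ?isE //.
Qed.

Lemma L_set0 i z : L finset.set0 i z = z ord0 i.
Proof.
have i0 : indep finset.set0 by move=> a _ i'; rewrite inE.
have := vertex_span z i0; rewrite /cone_span enum_set0 /= span_nil memv0 => /eqP v0.
by rewrite /L v0 ip0l subr0.
Qed.

Lemma LD tau i z z' : indep tau -> L tau i (z + z') = L tau i z + L tau i z'.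
Proof. by move=> it; rewrite /L vertexD // ipDl mxE; ring. Qed.

Lemma LZ tau i (a : R) z : indep tau -> L tau i (a *: z) = a * L tau i z.
Proof. by move=> it; rewrite /L vertexZ // ipZl mxE; ring. Qed.

End Generators.

(** * The polynomials W and their mixed derivatives *)

Section DirectionalDerivative.
Variables (R : realType) (m : nat).
Implicit Types (f g : mpoly m R) (v : 'rV[R]_m) (s : seq 'rV[R]_m).

Lemma dirderiv_is_linear v : linear (@dirderiv R m v).
Proof.
move=> a f g; rewrite /dirderiv scaler_sumr -big_split; apply: eq_bigr => i _ /=.
by rewrite mderivD mderivZ scalerDr !scalerA mulrC.
Qed.
HB.instance Definition _ v := GRing.isLinear.Build R (mpoly m R) (mpoly m R) _
  (@dirderiv R m v) (dirderiv_is_linear v).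

Lemma dirderivM v f g : dirderiv v (f * g) = dirderiv v f * g + f * dirderiv v g.
Proof.
rewrite /dirderiv mulr_suml mulr_sumr -big_split; apply: eq_bigr => i _ /=.
by rewrite mderivM scalerDr scalerAl scalerAr.
Qed.

Lemma dirderivC v c : dirderiv v (mpolyC m c) = 0.
Proof. by rewrite /dirderiv big1 // => i _; rewrite mderivC scaler0. Qed.

Lemma dirderiv_comm v v' f : dirderiv v (dirderiv v' f) = dirderiv v' (dirderiv v f).
Proof.
rewrite /dirderiv; under eq_bigr => i _ do rewrite (raddf_sum (mderiv i)) scaler_sumr.
under [RHS]eq_bigr => i _ do rewrite (raddf_sum (mderiv i)) scaler_sumr.
rewrite exchange_big; apply: eq_bigr => i _; apply: eq_bigr => j _ /=.
by rewrite !mderivZ mderiv_comm !scalerA mulrC.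
Qed.

Lemma dirderivs_dirderiv v s f : dirderiv v (dirderivs s f) = dirderivs s (dirderiv v f).
Proof. by elim: s => //= v' s <-; rewrite dirderiv_comm. Qed.

Lemma dirderivs_is_linear s : linear (@dirderivs R m s).
Proof.
elim: s => // v s IH a f g.
by rewrite -[LHS]/(dirderiv v (dirderivs s (a *: f + g))) IH linearP.
Qed.
HB.instance Definition _ s := GRing.isLinear.Build R (mpoly m R) (mpoly m R) _
  (@dirderivs R m s) (dirderivs_is_linear s).

Lemma dirderiv_delta i f : dirderiv (delta_mx ord0 i) f = mderiv i f.
Proof.
rewrite /dirderiv (bigD1 i) //= mxE !eqxx scale1r big1 ?addr0 // => j ji.
by rewrite mxE (negPf ji) andbF scale0r.
Qed.

Definition linpoly (c : 'I_m -> R) : mpoly m R := \sum_j c j *: mpolyX R (mnm1 j).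

Lemma dirderiv_linpoly v c : dirderiv v (linpoly c) = mpolyC m (\sum_j v ord0 j * c j).
Proof.
rewrite /dirderiv (raddf_sum (@mpolyC m R)); apply: eq_bigr => i _.
rewrite /linpoly (raddf_sum (mderiv i)) (bigD1 i) //= mderivZ mderivX mnm1E eqxx.
have -> : mnm_sub (mnm1 i) (mnm1 i) = mnm0 by apply/mnmP => k; rewrite !mnmE subnn.
rewrite big1 ?addr0 => [|j ji]; last by rewrite mderivZ mderivX mnm1E (negPf ji) !scale0r scaler0.
by rewrite scale1r mpolyX0 scalerA -mul_mpolyC mulr1.
Qed.

Lemma meval_linpoly (z : 'I_m -> R) c : meval z (linpoly c) = \sum_j z j * c j.
Proof.
rewrite /linpoly raddf_sum; apply: eq_bigr => j _.
by rewrite /= mevalZ mevalXU mulrC.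
Qed.

Lemma linpoly_homog c : linpoly c \is ishomog1 1 mdeg.
Proof.
apply: rpred_sum => j _; apply: rpredZ.
by rewrite dhomogX /= mdeg1.
Qed.

End DirectionalDerivative.

Section VolumePolynomial.
Variables (R : realType) (n : nat) (Sigma : fan_data R n).
Variable ip : {dot 'rV[R]_n for idfun}.
Local Notation m := (nrays Sigma).
Implicit Types (sigma tau : {set 'I_m}) (v z : 'rV[R]_m) (s : seq 'rV[R]_m).

Lemma L_sum tau i z : indep tau ->
  L ip tau i z = \sum_j z ord0 j * L ip tau i (delta_mx ord0 j).
Proof.
move=> it; pose Li : 'rV[R]_m -> R := L ip tau i.
have Llin : scalar Li by move=> a x y; rewrite /Li LD // LZ.
pose LL : {scalar 'rV[R]_m} := HB.pack Li (GRing.isLinear.Build R _ _ _ Li Llin).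
rewrite -[LHS]/(LL z) {1}(row_sum_delta z) linear_sum; apply: eq_bigr => j _.
by rewrite linearZ.
Qed.

Definition Lpoly tau i : mpoly m R := linpoly (fun j => L ip tau i (delta_mx ord0 j)).

Lemma dirderiv_Lpoly v tau i : indep tau -> dirderiv v (Lpoly tau i) = mpolyC m (L ip tau i v).
Proof. by move=> it; rewrite dirderiv_linpoly [in RHS]L_sum. Qed.

Lemma meval_Lpoly z tau i : indep tau -> meval (z ord0) (Lpoly tau i) = L ip tau i z.
Proof. by move=> it; rewrite meval_linpoly [in RHS]L_sum. Qed.

Lemma LpolyS tau i j : indep (i |: tau) -> i \notin tau ->
  Lpoly (i |: tau) j = Lpoly tau j - (gram ip tau i j / gram ip tau i i) *: Lpoly tau i.
Proof.
move=> iS it; rewrite /Lpoly /linpoly scaler_sumr -sumrB; apply: eq_bigr => k _.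
by rewrite LS // scalerBl scalerA.
Qed.

Variable w : {set 'I_m} -> R.
Hypothesis w_indep : forall sigma, w sigma != 0 -> indep sigma.

(* For [w] the indicator of one cone [sigma], this is the decomposition of the
   polytope of [sigma] into pyramids over its facets. *)
Fixpoint Wpoly k tau : mpoly m R :=
  if k is k'.+1 then \sum_(i | i \notin tau) Lpoly tau i * Wpoly k' (i |: tau)
  else mpolyC m (w tau).

Lemma WpolyS k tau :
  Wpoly k.+1 tau = \sum_(i | i \notin tau) Lpoly tau i * Wpoly k (i |: tau).
Proof. by []. Qed.

(** The recursion makes positivity visible and hides the symmetry in [s], which [mixed_swap]
    recovers from [mixedE] and the commutation of derivatives. *)
Fixpoint mixed tau s : R :=
  if s is v :: s' then
    (size s)%:R * \sum_(i | i \notin tau) L ip tau i v * mixed (i |: tau) s'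
  else w tau.

Lemma Wpoly_homog k tau : Wpoly k tau \is ishomog1 k mdeg.
Proof.
elim: k tau => [|k IH] tau /=.
  by rewrite -[mpolyC m _]mulr1 mul_mpolyC rpredZ // dhomog1.
apply: rpred_sum => i _; rewrite -add1n; apply: dhomogM => //.
exact: linpoly_homog.
Qed.

Lemma Wpoly_neq0 k tau : Wpoly k tau != 0 ->
  exists2 sigma : {set 'I_m}, tau \subset sigma & w sigma != 0.
Proof.
elim: k tau => [|k IH] tau /=.
  by rewrite mpolyC_eq0 => w0; exists tau.
move=> H; have [i it Wi] : exists2 i, i \notin tau & Wpoly k (i |: tau) != 0.
  apply/exists_inP; apply: contraNT H => /exists_inPn W0.
  by rewrite big1 // => i it; move/negPn/eqP: (W0 i it) => ->; rewrite mulr0.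
have [sigma sub ws] := IH _ Wi; exists sigma => //.
exact: fintype.subset_trans (finset.subsetUr _ _) sub.
Qed.

Lemma Wpoly_indep k tau : Wpoly k tau != 0 -> indep tau.
Proof. by move=> /Wpoly_neq0[sigma sub /w_indep]; exact: indepS. Qed.

(* By [LS], the terms [L_i(v) L_(tau+i),j - L_(tau+i),j(v) L_i] produced by the
   induction are antisymmetric in [i] and [j], so they cancel in the sum. *)
Lemma dirderiv_Wpoly v k tau : dirderiv v (Wpoly k.+1 tau) =
  k.+1%:R *: \sum_(i | i \notin tau) L ip tau i v *: Wpoly k (i |: tau).
Proof.
elim: k tau => [|k IH] tau.
  rewrite [in LHS]WpolyS [LHS]linear_sum scale1r; apply: eq_bigr => i it /=.
  rewrite dirderivM dirderivC mulr0 addr0.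
  have [->|wi] := eqVneq (mpolyC m (w (i |: tau))) 0; first by rewrite mulr0 scaler0.
  have ii := @Wpoly_indep 0 _ wi.
  rewrite dirderiv_Lpoly ?mul_mpolyC //.
  by apply: indepS ii; exact: finset.subsetUr.
pose W2 i j := Wpoly k (j |: (i |: tau)).
have W2C i j : W2 i j = W2 j i by rewrite /W2 finset.setUCA.
pose P i j := [&& i \notin tau, j \notin tau & i != j].
pose S1 := \sum_i \sum_(j | P i j) (L ip tau i v *: Lpoly tau j) * W2 i j.
pose S2 := \sum_i \sum_(j | P i j) (L ip tau j v *: Lpoly tau i) * W2 i j.
have S12 : S1 = S2.
  rewrite /S1 (exchange_big_dep xpredT) //=; apply: eq_bigr => i _.
  rewrite (eq_bigl (P i)) => [|j]; last first.
    by rewrite /P andbCA eq_sym.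
  by apply: eq_bigr => j _; rewrite W2C.
(* [LS] and [LpolyS] produce this same correction, so [E1] and [E2] below can differ only through
   [S1] and [S2]. *)
pose T i j := (gram ip tau i j / gram ip tau i i * L ip tau i v) *: Lpoly tau i.
pose S3 := \sum_i \sum_(j | P i j) T i j * W2 i j.
have pairE (G : 'I_m -> 'I_m -> mpoly m R) :
    \sum_(i | i \notin tau) \sum_(j | j \notin i |: tau) G i j =
    \sum_i \sum_(j | P i j) G i j.
  rewrite [LHS]big_mkcond; apply: eq_bigr => i _; rewrite /P.
  case: ifP => it /=; last by rewrite big_pred0.
  by apply: eq_bigl => j; rewrite in_setU1 negb_or andbC eq_sym.
have Wind i j : W2 i j != 0 -> indep (i |: tau) /\ indep tau.
  move=> /Wpoly_indep; move=> ind; split; apply: indepS ind.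
    exact: finset.subsetUr.
  by apply: fintype.subset_trans (finset.subsetUr _ _); exact: finset.subsetUr.
have E1 : \sum_(i | i \notin tau) Lpoly tau i *
    (\sum_(j | j \notin i |: tau) L ip (i |: tau) j v *: W2 i j) = S2 - S3.
  under eq_bigr do rewrite mulr_sumr.
  rewrite pairE /S2 /S3 -sumrB; apply: eq_bigr => i _.
  rewrite -sumrB; apply: eq_bigr => j /and3P[it jt ij].
  have [->|/Wind[iit _]] := eqVneq (W2 i j) 0; first by rewrite scaler0 !mulr0 subrr.
  by rewrite LS // /T -[RHS]mulrBl -scalerBl -[LHS]scalerAr; exact: scalerAl.
have E2 : \sum_(i | i \notin tau) L ip tau i v *: Wpoly k.+1 (i |: tau) = S1 - S3.
  under eq_bigr do rewrite WpolyS scaler_sumr.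
  rewrite pairE /S1 /S3 -sumrB; apply: eq_bigr => i _.
  rewrite -sumrB; apply: eq_bigr => j /and3P[it jt ij].
  rewrite -/(W2 i j).
  have [->|/Wind[iit _]] := eqVneq (W2 i j) 0; first by rewrite !mulr0 scaler0 subrr.
  rewrite LpolyS // /T -mulrBl scalerAl scalerBr scalerA.
  by congr ((_ - _ *: _) * _); rewrite mulrC.
rewrite WpolyS (_ : dirderiv v _ =
  \sum_(i | i \notin tau) dirderiv v (Lpoly tau i * Wpoly k.+1 (i |: tau))); last exact: linear_sum.
under eq_bigr do rewrite dirderivM.
rewrite big_split /=.
have -> : \sum_(i | i \notin tau) dirderiv v (Lpoly tau i) * Wpoly k.+1 (i |: tau) =
    \sum_(i | i \notin tau) L ip tau i v *: Wpoly k.+1 (i |: tau).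
  apply: eq_bigr => i it.
  have [->|/Wpoly_indep ii] := eqVneq (Wpoly k.+1 (i |: tau)) 0.
    by rewrite mulr0 scaler0.
  rewrite dirderiv_Lpoly ?mul_mpolyC //.
  by apply: indepS ii; exact: finset.subsetUr.
under [X in _ + X]eq_bigr do rewrite IH -scalerAr.
rewrite -scaler_sumr E1 E2 S12 -[X in X + _]scale1r -scalerDl.
by rewrite nat1r.
Qed.

Lemma mixedE s tau : dirderivs s (Wpoly (size s) tau) = mpolyC m (mixed tau s).
Proof.
elim: s tau => [//|v s IH] tau.
rewrite [LHS]dirderivs_dirderiv [size _]/= dirderiv_Wpoly linearZ /= linear_sum.
rewrite mpolyCM mul_mpolyC; congr (_ *: _); rewrite (raddf_sum (@mpolyC m R)).
by apply: eq_bigr => i _; rewrite linearZ /= IH -mul_mpolyC -mpolyCM.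
Qed.

Lemma mixed_swap tau v v' s : mixed tau [:: v, v' & s] = mixed tau [:: v', v & s].
Proof.
have E : mpolyC m (mixed tau [:: v, v' & s]) = mpolyC m (mixed tau [:: v', v & s]).
  rewrite -2!mixedE.
  exact: (dirderiv_comm v v' (dirderivs s (Wpoly (size s).+2 tau))).
by move/(congr1 (meval (fun=> 0))): E; rewrite !mevalC.
Qed.

Lemma mixed_swap2 tau v v' v'' s :
  mixed tau [:: v, v', v'' & s] = mixed tau [:: v, v'', v' & s].
Proof.
rewrite [LHS]/= [RHS]/=; congr (_ * _); apply: eq_bigr => i _; congr (_ * _).
exact: mixed_swap.
Qed.

Lemma mixed_eq0 tau s : (forall sigma : {set 'I_m}, tau \subset sigma -> w sigma = 0) ->
  mixed tau s = 0.
Proof.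
elim: s tau => [|v s IH] tau w0 /=; first exact: w0.
rewrite big1 ?mulr0 // => i it; rewrite IH ?mulr0 // => sigma sub.
by apply: w0; apply: fintype.subset_trans sub; exact: finset.subsetUr.
Qed.

Lemma mixed_linear tau s : indep tau -> scalar (fun v => mixed tau (v :: s)).
Proof.
move=> it a x y /=; rewrite [X in _ = X + _]mulrCA -mulrDr; congr (_ * _).
rewrite mulr_sumr -big_split.
by apply: eq_bigr => i _ /=; rewrite LD // LZ // mulrDl mulrA.
Qed.

Lemma meval_Wpoly k tau z : indep tau -> meval (z ord0) (Wpoly k.+1 tau) =
  \sum_(i | i \notin tau) L ip tau i z * meval (z ord0) (Wpoly k (i |: tau)).
Proof.
move=> it; rewrite /= raddf_sum; apply: eq_bigr => i _.
by rewrite /= mevalM meval_Lpoly.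
Qed.

End VolumePolynomial.

(** * Cubical polytopes and their slices *)

Section RowContinuity.
Variables (R : realType) (m : nat).

Lemma scalar_row_continuous (f : {scalar 'rV[R]_m}) : continuous f.
Proof.
have -> : f = (fun z : 'rV[R]_m => \sum_j z ord0 j * f (delta_mx ord0 j)) :> (_ -> _).
  apply/funext => z; rewrite {1}(row_sum_delta z) linear_sum.
  by apply: eq_bigr => j _; rewrite linearZ.
apply: continuous_big => [|j _ z]; first exact: add_continuous.
have cj := @coord_continuous R 1 m ord0 j z.
exact: (cvgM cj (cvg_cst _)).
Qed.

Lemma row_ball (z : 'rV[R]_m) (e : R) (z' : 'rV[R]_m) :
  0 < e -> (forall j, `|z ord0 j - z' ord0 j| < e) -> ball z e z'.
Proof.
move=> e0 zz'; split=> // i j.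
by rewrite (ord1 i) -ball_normE /=; exact: zz'.
Qed.

Lemma measurable_sumr d (T : measurableType d) I (r : seq I) (P : pred I) (F : I -> T -> R) :
  (forall i, measurable_fun [set: T] (F i)) ->
  measurable_fun [set: T] (fun t => \sum_(i <- r | P i) F i t).
Proof.
move=> mF; elim: r => [|i r IH].
  by under eq_fun do rewrite big_nil; exact: measurable_cst.
under eq_fun do rewrite big_cons; case: (P i) => //.
exact: measurable_realfun.measurable_funD.
Qed.

End RowContinuity.

Section CubicalRegion.
Variables (R : realType) (n : nat) (Sigma : fan_data R n).
Variable ip : {dot 'rV[R]_n for idfun}.
Local Notation m := (nrays Sigma).
Implicit Types (sigma tau rho pi : {set 'I_m}) (z f g : 'rV[R]_m) (v : 'rV[R]_n).
Local Notation vert := (cub_vertex ip).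
Local Notation dual := (dual_gen ip).
Local Notation L := (L ip).

(** The conditions of [cub] that concern a single cone and its faces, since volumes are computed
    cone by cone. *)
Definition cubc sigma : set 'rV[R]_m := [set z | forall pi, pi \subset sigma ->
  forall i, i \in pi -> 0 < ip (vert pi z) (dual pi i)].

Lemma L_gt0 sigma tau i z : indep sigma -> cubc sigma z ->
  i |: tau \subset sigma -> i \notin tau -> 0 < L tau i z.
Proof.
move=> iS zc sub it; have iti : indep (i |: tau) by exact: indepS iS.
have := L_coef ip z iti (finset.setU11 i tau); rewrite finset.setU1K // => ->.
by rewrite mulr_gt0 ?zc ?finset.setU11 // gram_gt0.
Qed.

Lemma cubc_gt0 sigma z i : indep sigma -> cubc sigma z -> i \in sigma -> 0 < z ord0 i.
Proof.
move=> iS zc isig; rewrite -(L_set0 ip); apply: (L_gt0 iS zc); rewrite ?inE //.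
by rewrite finset.setU0 finset.sub1set.
Qed.

Lemma coef_scalar pi i : indep pi -> scalar (fun z => ip (vert pi z) (dual pi i)).
Proof. by move=> ind a x y; rewrite vertexD // vertexZ // ipDl ipZl. Qed.

Lemma open_cubc sigma : indep sigma -> open (cubc sigma).
Proof.
move=> iS.
have coef_open pi i : pi \subset sigma -> open [set z | 0 < ip (vert pi z) (dual pi i)].
  move=> ps.
  pose f := HB.pack_for {scalar 'rV[R]_m} (fun z => ip (vert pi z) (dual pi i))
    (GRing.isLinear.Build R _ _ _ _ (coef_scalar i (indepS ps iS))).
  have : continuous f by exact: scalar_row_continuous.
  by move/continuousP => /(_ _ (@open_gt R 0)).
rewrite openE => z zc; rewrite /interior.
have FF : Filter (nbhs z) by exact: nbhs_filter.
suff : \forall y \near z, forall pi i, pi \subset sigma -> i \in pi ->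
    0 < ip (vert pi y) (dual pi i).
  by apply: filterS => y H pi ps i; exact: H.
apply: (@filter_forall _ _ (fun pi y => forall i, pi \subset sigma -> i \in pi ->
    0 < ip (vert pi y) (dual pi i)) (nbhs z) FF) => pi.
apply: (@filter_forall _ _ (fun i y => pi \subset sigma -> i \in pi ->
    0 < ip (vert pi y) (dual pi i)) (nbhs z) FF) => i.
have [ps|ps] := boolP (pi \subset sigma); last by apply: filterE => y //.
have [ipi|ipi] := boolP (i \in pi); last by apply: filterE => y //.
apply: filterS (open_nbhs_nbhs (conj (coef_open pi i ps) (zc pi ps i ipi))).
by move=> y.
Qed.

Lemma coef_subset sigma rho v j : indep sigma -> rho \subset sigma ->
  v \in cone_span rho -> j \in sigma ->
  ip v (dual sigma j) = if j \in rho then ip v (dual rho j) else 0.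
Proof.
move=> iS rs vr jS; have ir : indep rho by exact: indepS iS.
rewrite {1}(span_dual ip ir vr).
pose a k := if k \in rho then ip v (dual rho k) else 0.
rewrite (_ : \sum_(k in rho) _ = \sum_(k in sigma) a k *: gen k) ?dual_sum //.
rewrite [RHS](big_setID rho) /= (finset.setIidPr rs) [X in _ = _ + X]big1 ?addr0.
  by apply: eq_bigr => k; rewrite /a => ->.
by move=> k; rewrite inE /a => /andP[/negPf -> _]; rewrite scale0r.
Qed.

Lemma coef_span sigma rho v : indep sigma -> rho \subset sigma -> v \in cone_span sigma ->
  (forall j, j \in sigma -> j \notin rho -> ip v (dual sigma j) = 0) ->
  v \in cone_span rho.
Proof.
move=> iS rs vS v0; rewrite (span_dual ip iS vS).
apply: rpred_sum => j jS; have [jr|jr] := boolP (j \in rho).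
  by apply: rpredZ; exact: gen_span.
by rewrite v0 // scale0r rpred0.
Qed.

(* If the maximum of [v . u_i] were at least [z_i], follow the ray from the
   vertex [w_rho] through [v] until it leaves the polytope: it can only leave
   through a facet of the cone of [rho], which gives a smaller [rho]. *)
Lemma cub_below sigma tau rho i z v : indep sigma -> cubc sigma z ->
  tau \subset rho -> rho \subset sigma -> i \in sigma -> i \notin rho ->
  v \in cone_span rho ->
  (forall j, j \in rho -> j \notin tau ->
     0 <= ip v (dual sigma j) /\ ip v (gen j) <= z ord0 j) ->
  (forall j, j \in tau -> ip v (gen j) = z ord0 j) ->
  ip v (gen i) < z ord0 i.
Proof.
move=> iS zc; have [k] := ubnP #|rho|; elim: k rho v => // k IH rho v rk tr rs isig ir vr vj vt.
have indr : indep rho by exact: indepS iS.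
pose w := vert rho z; have wr : w \in cone_span rho by exact: vertex_span.
have wi : ip w (gen i) < z ord0 i.
  rewrite -subr_gt0; apply: (L_gt0 iS zc) => //.
  by rewrite finset.subUset finset.sub1set isig.
pose b j := ip w (dual sigma j); pose c j := ip v (dual sigma j).
have b_gt0 j : j \in rho -> 0 < b j.
  by move=> jr; rewrite /b (coef_subset iS rs wr) ?jr ?(fintype.subsetP rs) // zc.
have wz j : j \in rho -> ip w (gen j) = z ord0 j by move=> jr; rewrite vertex_ip.
have coefE u j : u \in cone_span rho -> j \in rho -> ip u (dual rho j) = ip u (dual sigma j).
  by move=> ur jr; rewrite (coef_subset iS rs ur) ?jr // (fintype.subsetP rs).
pose P j := [&& j \in rho, j \notin tau & c j < b j].
case: (pickP P) => [j0 Pj0|nP]; last first.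
  (* No coefficient of [v] outside [tau] is below that of [w]. The squared norm of [v - w] is then a
     sum of products of a nonnegative coefficient and a nonpositive slack, plus zero terms from
     [tau]. *)
  suff -> : v = w by [].
  apply/eqP; rewrite -subr_eq0; apply/eqP/(ip_eq0 (ip := ip))/eqP.
  rewrite eq_le ip_ge0 andbT.
  have dr : v - w \in cone_span rho by rewrite rpredB.
  rewrite [X in ip _ X](span_dual ip indr dr) ip_sumr; apply: sumr_le0 => j jr.
  rewrite ipZr coefE // [ip (v - w) (gen j)]ipBl [ip _ (dual _ _)]ipBl wz //.
  have [jt|jt] := boolP (j \in tau); first by rewrite vt // subrr mulr0.
  have [_ le] := vj j jr jt; have := nP j; rewrite /P jr jt /= => /negbT.
  rewrite -leNgt => ?; by rewrite mulr_ge0_le0 ?subr_ge0 ?subr_le0.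
rewrite ltNge; apply/negP => vi.
(* The time at which the ray leaving [w] at time 0 and passing [v] at time 1 loses its coefficient
   on [gen j]; it is at least 1 since [c j] is nonnegative. *)
pose t j := b j / (b j - c j).
have [j /and3P[jr jt cb] tmin] := @arg_minP _ _ _ j0 P t Pj0.
have d_gt0 : 0 < b j - c j by rewrite subr_gt0.
have tj1 : 1 <= t j.
  rewrite /t ler_pdivlMr // mul1r lerBlDr lerDl.
  by have [] := vj j jr jt.
pose u := w + t j *: (v - w).
have ur : u \in cone_span rho by rewrite rpredD // rpredZ // rpredB.
have cu l : ip u (dual sigma l) = b l + t j * (c l - b l).
  by rewrite ipDl ipZl ipBl.
have ug l : ip u (gen l) = ip w (gen l) + t j * (ip v (gen l) - ip w (gen l)).
  by rewrite ipDl ipZl ipBl.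
have uj0 : ip u (dual sigma j) = 0.
  by rewrite cu /t; field; rewrite gt_eqF.
have rj : rho :\ j \subset rho by exact: finset.subD1set.
have : ip u (gen i) < z ord0 i.
  apply: (IH (rho :\ j)) => //.
  - by move: rk; rewrite (cardsD1 j) jr.
  - by rewrite finset.subsetD1 tr.
  - exact: fintype.subset_trans rs.
  - by rewrite !inE negb_and ir orbT.
  - apply: (coef_span indr rj ur) => l lr.
    rewrite !inE lr andbT negbK => /eqP ->.
    by rewrite coefE.
  - move=> l; rewrite !inE => /andP[lj lr] lt.
    have [c0 le] := vj l lr lt; split; last first.
      rewrite ug wz // gerDl mulr_ge0_le0 ?subr_le0 //.
      exact: le_trans tj1.
    rewrite cu; have [cbl|blc] := ltP (c l) (b l).
      have := tmin l; rewrite /P lr lt cbl /= => /(_ isT).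
      rewrite [X in _ <= X]/t ler_pdivlMr ?subr_gt0 // => H.
      by rewrite -opprB mulrN subr_ge0.
    apply: addr_ge0; first by rewrite ltW // b_gt0.
    by apply: mulr_ge0; rewrite ?subr_ge0 //; exact: le_trans tj1.
  - move=> l lt; have lr := fintype.subsetP tr l lt.
    by rewrite ug wz // vt // subrr mulr0 addr0.
rewrite ug; apply/negP; rewrite -leNgt.
(* The product with [gen i] is below [z_i] at [w] and not at [v], so it increases along the ray, and
   [u] lies at or beyond [v]. *)
have : 0 <= (t j - 1) * (ip v (gen i) - ip w (gen i)).
  by rewrite mulr_ge0 ?subr_ge0 //; apply: le_trans vi; exact: ltW.
rewrite mulrBl mul1r; move: vi; set A := ip v _; set B := ip w _; set T := t j * _.
by lra.
Qed.

(* The slice [x_i = z_i] is thus a polytope of the star of [u_i].  A negative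
   coefficient of [u_i] would vanish on the way to the vertex [w_sigma], at a
   point excluded by [cub_below]. *)
Lemma cub_facet sigma tau i z v : indep sigma -> cubc sigma z ->
  tau \subset sigma -> i \in sigma -> i \notin tau -> v \in cone_span sigma ->
  (forall j, j \in sigma -> j \notin i |: tau ->
     0 <= ip v (dual sigma j) /\ ip v (gen j) <= z ord0 j) ->
  (forall j, j \in i |: tau -> ip v (gen j) = z ord0 j) ->
  0 <= ip v (dual sigma i).
Proof.
move=> iS zc ts isig it vS vj vt; rewrite leNgt; apply/negP => ci.
pose w := vert sigma z; have wS : w \in cone_span sigma by exact: vertex_span.
have wz j : j \in sigma -> ip w (gen j) = z ord0 j by move=> jr; rewrite vertex_ip.
have bi j : j \in sigma -> 0 < ip w (dual sigma j) by move=> jS; exact: zc.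
pose c := ip v (dual sigma i); pose b := ip w (dual sigma i).
have bc : 0 < b - c by rewrite subr_gt0 (lt_trans ci) // bi.
pose t := - c / (b - c).
have t0 : 0 <= t by rewrite divr_ge0 ?ltW // oppr_gt0.
have t1 : t <= 1.
  by rewrite /t ler_pdivrMr // mul1r addrC lerDl ltW // bi.
pose u := v + t *: (w - v).
have uE x : ip u x = (1 - t) * ip v x + t * ip w x by rewrite ipDl ipZl ipBl; ring.
have ui : ip u (dual sigma i) = 0.
  by rewrite uE -/b -/c /t; field; rewrite gt_eqF.
have : ip u (gen i) < z ord0 i.
  have sub : sigma :\ i \subset sigma by exact: finset.subD1set.
  apply: (@cub_below sigma tau (sigma :\ i)) => //.
  - by rewrite finset.subsetD1 ts.
  - by rewrite !inE eqxx.
  - apply: (coef_span iS sub) => [|j jS]; first by rewrite rpredD // rpredZ // rpredB.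
    by rewrite !inE jS andbT negbK => /eqP ->.
  - move=> j; rewrite !inE => /andP[ji jS] jt.
    have jit : j \notin i |: tau by rewrite in_setU1 negb_or ji.
    have [c0 le] := vj j jS jit; rewrite !uE; split.
      by rewrite addr_ge0 // mulr_ge0 ?subr_ge0 // ltW // bi.
    rewrite wz // -[X in _ <= X]mul1r -[X in _ <= X * _](subrK t) [X in _ <= X]mulrDl lerD2r.
    by rewrite ler_wpM2l // subr_ge0.
  - move=> j jt; rewrite uE vt ?in_setU1 ?jt ?orbT // wz ?(fintype.subsetP ts) //.
    by ring.
rewrite uE vt ?finset.setU11 // wz //.
by rewrite -mulrDl subrK mul1r ltxx.
Qed.

(* The slice at height [z] in the directions of [tau] of the polytope of
   [sigma], in the coordinates [f_i = v . u_i]. *)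
Definition region sigma tau z : set 'rV[R]_m :=
  [set f | forall j, j \in sigma -> j \notin tau ->
     0 <= ip (vert sigma f) (dual sigma j) /\ f ord0 j <= z ord0 j].

Local Open Scope ereal_scope.
Definition indreg sigma tau z f : \bar R := (\1_(region sigma tau z) f)%:E.

Lemma indreg_ge0 sigma tau z f : 0 <= indreg sigma tau z f.
Proof. by rewrite lee_fin indicE. Qed.

Lemma eq_indreg sigma tau z sigma' tau' z' f f' :
  (region sigma tau z f <-> region sigma' tau' z' f') ->
  indreg sigma tau z f = indreg sigma' tau' z' f'.
Proof.
move=> E; have E' : (f \in region sigma tau z) = (f' \in region sigma' tau' z').
  by apply/idP/idP; rewrite !inE => /E.
by rewrite /indreg !indicE E'.
Qed.

Lemma indreg_rowmeas sigma tau z : indep sigma -> rowmeas (indreg sigma tau z).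
Proof.
move=> iS d T h mh.
suff mI : measurable (h @^-1` region sigma tau z).
  have : measurable_fun [set: T] (\1_(h @^-1` region sigma tau z) : T -> R).
    exact: measurable_indic.
  move=> /measurable_EFinP; apply: eq_measurable_fun => t _.
  have E : (t \in h @^-1` region sigma tau z) = (h t \in region sigma tau z).
    by apply/idP/idP; rewrite !inE.
  by rewrite /indreg /= !indicE E.
have -> : h @^-1` region sigma tau z = \bigcap_(j in [set j | (j \in sigma) && (j \notin tau)])
    ([set t | (0 <= ip (vert sigma (h t)) (dual sigma j))%R] `&`
     [set t | (h t ord0 j <= z ord0 j)%R]).
  apply/seteqP; split=> t /= H j; first by move=> /andP[jS jt]; exact: H.
  by move=> jS jt; apply: H; rewrite /= jS.
apply: fin_bigcap_measurable => [|j _]; first exact: finite_finset.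
apply: measurableI.
  have mg : measurable_fun [set: T] (fun t => ip (vert sigma (h t)) (dual sigma j) : R).
    apply: (eq_measurable_fun (fun t =>
      (\sum_(k in sigma) h t ord0 k * ip (dual sigma k) (dual sigma j))%R)).
      move=> t _; rewrite vertex_dual // ip_suml; apply: eq_bigr => k _.
      by rewrite ipZl.
    by apply: measurable_sumr => k; apply: measurable_funM.
  have := mg measurableT `[0%R, +oo[%classic (measurable_itv _).
  rewrite setTI; congr (measurable _); apply/seteqP; split=> t /=; by rewrite in_itv /= andbT.
have := mh j measurableT `]-oo, (z ord0 j)]%classic (measurable_itv _).
by rewrite setTI; congr (measurable _); apply/seteqP; split=> t /=; rewrite in_itv.
Qed.

(** Starting the iterated integral at [z] freezes the coordinates in [tau] at their facet values. *)
Definition slicevol sigma tau z : \bar R :=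
  iterint (enum (sigma :\: tau)) (indreg sigma tau z) z.

(** The region is bounded by pairing a point [v] with the vertex [w]: expanding [v] gives the sum of
    its coefficients times the [z_j], and expanding [w] bounds the same number by [M]. As all [z_j]
    are positive, each coefficient is at most [M / z_j]. *)
Lemma slicevol_fin sigma tau z : indep sigma -> tau \subset sigma -> cubc sigma z ->
  slicevol sigma tau z \is a fin_num.
Proof.
move=> iS ts zc.
pose w := vert sigma z.
pose M : R := (\sum_(j in sigma) ip w (dual sigma j) * z ord0 j)%R.
have wj j : j \in sigma -> (0 < ip w (dual sigma j))%R by move=> jS; exact: zc.
have z_gt0 j : j \in sigma -> (0 < z ord0 j)%R by exact: cubc_gt0 zc.
have M0 : (0 <= M)%R.
  by apply: sumr_ge0 => j jS; rewrite mulr_ge0 ?ltW ?wj ?z_gt0.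
pose Bk (k : 'I_m) : R := (\sum_(j in sigma) M / z ord0 j * `|ip (gen j) (gen k)|)%R.
pose B : R := (\sum_k Bk k)%R.
have Bk0 k : (0 <= Bk k)%R.
  by apply: sumr_ge0 => j jS; rewrite mulr_ge0 // divr_ge0 // ltW // z_gt0.
have B0 : (0 <= B)%R by exact: sumr_ge0.
rewrite fin_numElt; apply/andP; split.
  by rewrite (lt_le_trans ltNy0) // iterint_ge0 //; exact: indreg_ge0.
apply: (@le_lt_trans _ _ ((2 * B) ^+ size (enum (sigma :\: tau)))%:E); last exact: ltry.
apply: iterint_bounded => //.
- by move=> g; rewrite indreg_ge0 /indreg indicE lee_fin /=; case: (_ \in _).
- exact: indreg_rowmeas.
- exact: enum_uniq.
move=> g k; rewrite mem_enum inE => /andP[kt kS] gE gB.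
rewrite /indreg indicE memNset // => greg.
move: gB; apply/negP; rewrite -leNgt.
pose v := vert sigma g; have vS : v \in cone_span sigma by exact: vertex_span.
have vg j : j \in sigma -> ip v (gen j) = g ord0 j by move=> jS; exact: vertex_ip.
have gt j : j \in tau -> g ord0 j = z ord0 j.
  by move=> jt; rewrite gE // mem_enum inE jt.
(* [region] does not constrain the coefficients on [tau]; [cub_facet] supplies their sign. *)
have c_ge0 j : j \in sigma -> (0 <= ip v (dual sigma j))%R.
  move=> jS; have [jt|jt] := boolP (j \in tau); last by have [] := greg j jS jt.
  have sub : tau :\ j \subset sigma by exact: fintype.subset_trans (finset.subD1set _ _) ts.
  apply: (cub_facet iS zc sub) => //; first by rewrite !inE eqxx.
    move=> l lS; rewrite finset.setD1K // => lt.
    by have [] := greg l lS lt; rewrite vg.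
  by move=> l; rewrite finset.setD1K // => lt; rewrite vg ?gt // (fintype.subsetP ts).
have gz j : j \in sigma -> (g ord0 j <= z ord0 j)%R.
  move=> jS; have [jt|jt] := boolP (j \in tau); first by rewrite gt.
  by have [] := greg j jS jt.
have sumM : (\sum_(j in sigma) ip v (dual sigma j) * z ord0 j <= M)%R.
  have -> : (\sum_(j in sigma) ip v (dual sigma j) * z ord0 j)%R = ip v w.
    rewrite [in RHS](span_dual ip iS vS) ip_suml; apply: eq_bigr => j jS.
    by rewrite ipZl [ip (gen j) w]ipC vertex_ip.
  rewrite [X in ip _ X](span_dual ip iS (vertex_span ip z iS)) ip_sumr.
  apply: ler_sum => j jS; rewrite ipZr vg // ler_wpM2l ?gz // ltW //.
  exact: wj.
have cM j : j \in sigma -> (ip v (dual sigma j) <= M / z ord0 j)%R.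
  move=> jS; rewrite ler_pdivlMr ?z_gt0 //; apply: le_trans sumM.
  rewrite (bigD1 j) //= lerDl; apply: sumr_ge0 => l /andP[lS _].
  by rewrite mulr_ge0 ?c_ge0 // ltW // z_gt0.
apply: (@le_trans _ _ (Bk k)); last first.
  by rewrite /B (bigD1 k) //= lerDl; apply: sumr_ge0 => l _; exact: Bk0.
rewrite -vg // [in X in (X <= _)%R](span_dual ip iS vS) ip_suml.
apply: le_trans (ler_norm_sum _ _ _) _; apply: ler_sum => j jS.
by rewrite ipZl normrM ler_wpM2r // ger0_norm ?c_ge0 // cM.
Qed.

End CubicalRegion.

(** * Polynomials along a coordinate line *)

Section CoordinateDerivative.
Variables (R : realType) (m : nat) (z : 'rV[R]_m) (i : 'I_m).
Implicit Types p q : mpoly m R.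
Local Notation ev p := (fun y : R => meval (upd z i y ord0) p).

Let D p := forall x, is_derive x (1 : R) (ev p) (meval (upd z i x ord0) (mderiv i p)).

Let DC c : D (mpolyC m c).
Proof.
move=> x; rewrite mderivC meval0 (_ : ev (mpolyC m c) = cst c); first exact: is_derive_cst.
by apply/funext => y; rewrite mevalC.
Qed.

Let DX j : D (mpolyX R (mnm1 j)).
Proof.
move=> x; rewrite mderivX mnm1E mevalZ; have [->|ji] := eqVneq j i.
  have -> : mnm_sub (mnm1 i) (mnm1 i) = mnm0 by apply/mnmP => k; rewrite !mnmE subnn.
  rewrite mpolyX0 meval1 mulr1 (_ : ev _ = id); first exact: is_derive_id.
  by apply/funext => y; rewrite mevalXU updE eqxx.
rewrite mul0r (_ : ev _ = cst (z ord0 j)); first exact: is_derive_cst.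
by apply/funext => y; rewrite mevalXU updE (negPf ji).
Qed.

Let DD p q : D p -> D q -> D (p + q).
Proof.
move=> Dp Dq x; rewrite mderivD mevalD.
rewrite (_ : ev (p + q) = ev p + ev q); first exact: is_deriveD.
by apply/funext => y; rewrite mevalD.
Qed.

Let DM p q : D p -> D q -> D (p * q).
Proof.
move=> Dp Dq x; rewrite mderivM mevalD !mevalM.
rewrite (_ : ev (p * q) = ev p * ev q); last by apply/funext => y; rewrite mevalM.
apply: is_derive_eq; first exact: is_deriveM.
by rewrite addrC mulrC.
Qed.

Lemma is_derive_meval p x :
  is_derive x (1 : R) (ev p) (meval (upd z i x ord0) (mderiv i p)).
Proof.
suff : D p by [].
rewrite (mpolyE p); apply: (big_ind D) => //; first exact: (DC 0).
move=> mm _; rewrite -mul_mpolyC; apply: DM => //; rewrite mpolyXE_id.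
apply: (big_ind D) => // [|j _]; first exact: (DC 1).
elim: (mm j) => [|k IH]; first exact: (DC 1).
by rewrite exprS; apply: DM.
Qed.

Lemma meval_upd_continuous p : continuous (ev p).
Proof.
move=> x; apply: differentiable_continuous; apply/derivable1_diffP.
by have [] := is_derive_meval p x.
Qed.

Lemma meval_FTC p (a b : R) : a < b ->
  (\int[@lebesgue_measure R]_(x in `[a, b]) (meval (upd z i x ord0) (mderiv i p))%:E =
   (meval (upd z i b ord0) p)%:E - (meval (upd z i a ord0) p)%:E)%E.
Proof.
move=> ab.
apply: (@continuous_FTC2 R (ev (mderiv i p)) (ev p)) => //.
- by apply: continuous_subspaceT; exact: meval_upd_continuous.
- split.
  + by move=> x _; have [] := is_derive_meval p x.
  + by apply: cvg_at_right_filter; exact: meval_upd_continuous.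
  + by apply: cvg_at_left_filter; exact: meval_upd_continuous.
- by move=> x _; rewrite derive1E; have [_ ->] := is_derive_meval p x.
Qed.

End CoordinateDerivative.

Lemma enum_setD1 (T : finType) (A : {set T}) (i : T) (s1 s2 : seq T) :
  enum A = s1 ++ i :: s2 -> i \notin s1 /\ s1 ++ s2 = enum (A :\ i).
Proof.
move=> eA; have uA : uniq (s1 ++ i :: s2) by rewrite -eA enum_uniq.
move: (uA); rewrite cat_uniq /= negb_or => /and3P[_ /andP[is1 _] /andP[is2 _]].
split=> //.
have -> : enum (A :\ i) = seq.filter (predC1 i) (enum A).
  rewrite /enum_mem -filter_predI; apply: eq_filter => j /=.
  by rewrite !inE.
have nf s : i \notin s -> seq.filter (predC1 i) s = s.
  by move=> iS; apply/all_filterP/allP => j jS /=; apply: contraNneq iS => <-.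
by rewrite eA filter_cat /= eqxx /= !nf.
Qed.

(** * Volumes of slices by integration over one facet direction *)

Section SliceVolume.
Variables (R : realType) (n : nat) (Sigma : fan_data R n).
Variable ip : {dot 'rV[R]_n for idfun}.
Local Notation m := (nrays Sigma).
Local Notation mu := (@lebesgue_measure R).
Implicit Types (tau rho pi : {set 'I_m}) (z f g : 'rV[R]_m) (v : 'rV[R]_n).
Local Notation vert := (cub_vertex ip).
Local Notation dual := (dual_gen ip).
Local Notation L := (L ip).
Variable sigma : {set 'I_m}.
Hypothesis iS : indep sigma.

Definition single pi : R := (pi == sigma)%:R.

Lemma single_indep pi : single pi != 0 -> indep pi.
Proof. by rewrite /single; have [->|] := eqVneq pi sigma; rewrite ?eqxx. Qed.

Local Notation W := (Wpoly ip single).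
Local Notation ev z k tau := (meval (z ord0) (W k tau)).

Lemma L_delta tau i j : indep tau -> i \notin tau -> L tau j (delta_mx ord0 i) = (j == i)%:R.
Proof.
move=> it intau; rewrite /L (_ : vert tau _ = 0).
  by rewrite ip0l subr0 mxE eqxx.
apply: vertex_unique => //; first exact: rpred0.
move=> k kt; rewrite ip0l mxE eqxx /=; case: eqVneq kt => // ->.
by rewrite (negPf intau).
Qed.

Lemma mderiv_Wpoly k tau i : indep tau -> i \notin tau ->
  mderiv i (W k.+1 tau) = k.+1%:R *: W k (i |: tau).
Proof.
move=> it intau; rewrite -dirderiv_delta (dirderiv_Wpoly ip single_indep); congr (_ *: _).
rewrite (bigD1 i) //= L_delta // eqxx scale1r big1 ?addr0 // => j /andP[jt ji].
by rewrite L_delta // (negPf ji) scale0r.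
Qed.

Local Open Scope ereal_scope.

(** Raising the bound [z_i] to [y] adds the slices at heights between them. By [cub_facet] these are
    the regions of [i |: tau], whose volume is by [mderiv_Wpoly] the derivative of the polynomial of
    [tau]; the fundamental theorem of calculus adds them up. *)
Lemma slicevol_step tau i z (y : R) k : tau \subset sigma -> i \in sigma -> i \notin tau ->
  (z ord0 i < y)%R ->
  (forall t, (z ord0 i <= t <= y)%R -> cubc ip sigma (upd z i t)) ->
  (forall z', cubc ip sigma z' ->
     slicevol ip sigma (i |: tau) z' = (k`!%:R^-1 * ev z' k (i |: tau))%:E) ->
  slicevol ip sigma tau (upd z i y) = slicevol ip sigma tau z +
    (k.+1`!%:R^-1 * (ev (upd z i y) k.+1 tau - ev z k.+1 tau))%:E.
Proof.
move=> ts isig itau zy zt IH; have it : indep tau by exact: indepS iS.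
have [s1 [s2 eS]] : exists s1 s2, enum (sigma :\: tau) = s1 ++ i :: s2.
  have : i \in enum (sigma :\: tau) by rewrite mem_enum inE itau.
  by move=> /splitPr[s1 s2]; exists s1, s2.
have [is1] := enum_setD1 eS.
have -> : (sigma :\: tau) :\ i = sigma :\: (i |: tau).
  by apply/setP => j; rewrite !inE negb_or andbA.
set s := s1 ++ s2 => eS'.
have is_ j : j \in i |: tau -> j \notin s by move=> jt; rewrite eS' mem_enum finset.in_setD jt.
pose h Y x := iterint s (indreg ip sigma tau (upd z i Y)) (upd z i x).
have hE Y : slicevol ip sigma tau (upd z i Y) = \int[mu]_x h Y x.
  rewrite /slicevol eS iterint_move //; last 2 first.
  - exact: indreg_ge0.
  - exact: indreg_rowmeas.
  by rewrite iterint_cons; apply: eq_integral => x _; rewrite upd_upd.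
have h0 Y x : 0 <= h Y x by apply: iterint_ge0; exact: indreg_ge0.
have mh Y : measurable_fun [set: R] (h Y).
  have RM := iterint_rowmeas s (indreg_ge0 ip sigma tau (upd z i Y))
    (indreg_rowmeas ip tau (upd z i Y) iS).
  apply: (RM _ _ (fun x : R => upd z i x)).
  by apply: measurable_upd => [j|]; [exact: measurable_cst|exact: measurable_id].
have gi x g : (forall j, j \notin s -> g ord0 j = upd z i x ord0 j) -> g ord0 i = x.
  by move=> ->; rewrite ?updE ?eqxx // is_ // finset.setU11.
have h_le x : (x <= z ord0 i)%R -> h y x = h (z ord0 i) x.
  move=> xz; apply: eq_iterint => g gE; apply: eq_indreg; split=> H j jS jt.
    have [c0] := H j jS jt; split=> //; move: b; rewrite !updE.
    by case: eqVneq => // ->; rewrite (gi x).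
  have [c0] := H j jS jt; split=> //; move: b; rewrite !updE.
  case: eqVneq => // ->; rewrite (gi x) // => _.
  by rewrite (le_trans xz) // ltW.
have h_gt Y x : (Y < x)%R -> h Y x = 0.
  move=> zx; rewrite /h (eq_iterint (G := fun=> 0)) ?iterint0 // => g gE.
  rewrite /indreg indicE memNset // => H.
  have [_] := H i isig itau; rewrite updE eqxx (gi x) //.
  by rewrite leNgt zx.
pose P x : R := (k`!%:R^-1 * ev (upd z i x) k (i |: tau))%R.
have h_mid x : (z ord0 i <= x <= y)%R -> h y x = (P x)%:E.
  move=> zxy; have zc := zt x zxy; case/andP: zxy => zx xy.
  rewrite /P -IH // /slicevol /h eS'; apply: eq_iterint => g gE.
  rewrite -eS' in gE; apply: eq_indreg; split=> H j jS.
    rewrite in_setU1 negb_or => /andP[ji jt].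
    by have [c0] := H j jS jt; split=> //; move: b; rewrite !updE (negPf ji).
  move=> jt; have [->|ji] := eqVneq j i; last first.
    have jit : j \notin i |: tau by rewrite in_setU1 negb_or ji.
    by have [c0] := H j jS jit; split=> //; move: b; rewrite !updE (negPf ji).
  split; last by rewrite updE eqxx (gi x).
  (* The sign of the coefficient on [gen i] is required by the region of [tau] and absent from that
     of [i |: tau]. *)
  apply: (cub_facet iS zc ts) => //; first exact: vertex_span.
    by move=> l lS lit; rewrite vertex_ip //; exact: H.
  move=> l lit; have lS : l \in sigma.
    by move: lit => /setU1P[->//|]; exact: fintype.subsetP.
  by rewrite vertex_ip // gE // is_.
pose g x : \bar R := (\1_(`]z ord0 i, y]) x * P x)%:E.
have hg x : h y x = h (z ord0 i) x + g x.
  rewrite /g indicE; have [xz|zx] := leP x (z ord0 i).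
    rewrite memNset ?mul0r ?adde0 ?h_le //= in_itv /=.
    by rewrite ltNge xz.
  rewrite (h_gt _ x zx) add0e; have [xy|yx] := leP x y.
    by rewrite mem_set ?mul1r /= ?in_itv /= ?zx ?xy // h_mid // ltW.
  by rewrite memNset ?mul0r ?h_gt //= in_itv /= zx leNgt yx.
have P0 x : x \in `]z ord0 i, y] -> (0 <= P x)%R.
  by rewrite in_itv /= => /andP[zx xy]; rewrite -lee_fin -h_mid ?h0 // xy ltW.
have mP : measurable_fun [set: R] P.
  apply: measurable_funM => //; apply: continuous_measurable_fun.
  exact: meval_upd_continuous.
have -> : slicevol ip sigma tau z = \int[mu]_x h (z ord0 i) x by rewrite -hE upd_id.
rewrite hE; transitivity (\int[mu]_x (h (z ord0 i) x + g x)).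
  by apply: eq_integral => x _; exact: hg.
rewrite ge0_integralD //; last 2 first.
- move=> x _; rewrite /g indicE lee_fin; case: (boolP (x \in _)) => xI; last by rewrite mul0r.
  by rewrite mul1r P0 //; rewrite inE in xI.
- apply/measurable_EFinP; apply: measurable_funM => //; exact: measurable_indic.
congr (_ + _).
pose p := (k.+1`!%:R^-1 *: W k.+1 tau)%R.
have PE x : P x = meval (upd z i x ord0) (mderiv i p).
  rewrite /p mderivZ mderiv_Wpoly // !mevalZ /P factS natrM.
  by rewrite invfM mulrACA mulVf ?mul1r // pnatr_eq0.
transitivity (\int[mu]_(x in `]z ord0 i, y]) (P x)%:E).
  rewrite [RHS]integral_mkcond; apply: eq_integral => x _.
  by rewrite patchE /g indicE; case: (x \in _); rewrite ?mul1r ?mul0r.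
rewrite integral_itv_obnd_cbnd; last first.
  by apply/measurable_EFinP; exact: measurable_funS mP.
under eq_integral do rewrite PE.
by rewrite meval_FTC // -EFinB upd_id /p !mevalZ mulrBr.
exact: mh.
Qed.

Local Close Scope ereal_scope.

Lemma ev_neq0 k tau : W k tau != 0 -> tau \subset sigma.
Proof.
move=> /Wpoly_neq0[pi sub]; rewrite /single; have [<-//|] := eqVneq pi sigma.
by rewrite eqxx.
Qed.

(** [W] is built from the support numbers alone, and these are linear and vanish at [p]. *)
Lemma ev_affine k tau (a : R) z p :
  (forall pi i, tau \subset pi -> i |: pi \subset sigma -> i \notin pi -> L pi i p = 0) ->
  ev (a *: z + (1 - a) *: p) k tau = a ^+ k * ev z k tau.
Proof.
elim: k tau => [|k IH] tau p0; first by rewrite !mevalC mul1r.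
have [->|/ev_neq0 ts] := eqVneq (W k.+1 tau) 0; first by rewrite !meval0 mulr0.
have it : indep tau by exact: indepS iS.
rewrite !meval_Wpoly // mulr_sumr; apply: eq_bigr => i itau.
have [->|/ev_neq0 its] := eqVneq (W k (i |: tau)) 0; first by rewrite !meval0 !mulr0.
rewrite IH; last first.
  move=> pi j sub; apply: p0; apply: fintype.subset_trans sub; exact: finset.subsetUr.
by rewrite LD // !LZ // (p0 tau) // mulr0 addr0 exprS; ring.
Qed.

(* By [slicevol_step], the difference of the two sides is unchanged when the
   coordinates outside [tau] move, in particular by the homothety of ratio
   [a] centered at the point [p] of the vertex of [tau], which multiplies it by
   [a ^+ k]. *)
Lemma slicevol_Wpoly k tau z : tau \subset sigma -> #|sigma :\: tau| = k ->
  cubc ip sigma z -> slicevol ip sigma tau z = (k`!%:R^-1 * ev z k tau)%:E.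
Proof.
elim: k tau z => [|k IH] tau z ts sk zc.
  have st0 : sigma :\: tau = finset.set0 by apply/eqP; rewrite -finset.cards_eq0 sk.
  have st : tau = sigma by apply/eqP; rewrite finset.eqEsubset ts -finset.setD_eq0 st0 eqxx.
  rewrite /slicevol st0 enum_set0 /= mevalC /single st eqxx /indreg indicE mem_set.
    by rewrite invr1 mulr1.
  by move=> j ->.
have it : indep tau by exact: indepS iS.
pose w := vert tau z.
(* Outside [sigma] the center agrees with [z], as it does on [tau], so the homothety moves only the
   coordinates in [sigma :\: tau]. *)
pose p : 'rV[R]_m := \row_j (if j \in sigma then ip w (gen j) else z ord0 j).
have pE j : j \in sigma -> p ord0 j = ip w (gen j) by rewrite mxE => ->.
have vp pi : tau \subset pi -> pi \subset sigma -> vert pi p = w.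
  move=> tp ps; apply: vertex_unique; first exact: indepS iS.
    by apply: span_subset tp _; exact: vertex_span.
  by move=> i ipi; rewrite pE // (fintype.subsetP ps).
have Lp pi i : tau \subset pi -> i |: pi \subset sigma -> i \notin pi -> L pi i p = 0.
  move=> tp; rewrite finset.subUset finset.sub1set => /andP[isig ps] _.
  by rewrite /L vp // pE // subrr.
have pL j : j \in sigma -> z ord0 j - p ord0 j = L tau j z by move=> jS; rewrite pE.
have pj j : j \notin sigma :\: tau -> z ord0 j = p ord0 j.
  rewrite inE negb_and negbK => /orP[jt|jS]; last by rewrite mxE (negPf jS).
  by rewrite pE ?(fintype.subsetP ts) // vertex_ip.
have p_lt j : j \in sigma :\: tau -> p ord0 j < z ord0 j.
  rewrite inE => /andP[jt jS]; rewrite -subr_gt0 pL //; apply: (L_gt0 iS zc) => //.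
  by rewrite finset.subUset finset.sub1set jS.
have /open_nbhs_nbhs/nbhs_ballP[e /= e0 be] : open_nbhs z (cubc ip sigma).
  by split; [exact: open_cubc|].
(* [K] exceeds every coordinate of [z - p], so the ratio [1 + e / K] moves each coordinate of [z] by
   less than [e]. *)
pose K : R := 1 + \sum_j `|z ord0 j - p ord0 j|.
have K0 : 0 < K by rewrite ltr_pwDl // sumr_ge0.
have lK j : `|z ord0 j - p ord0 j| < K.
  by rewrite /K (bigD1 j) //= addrCA ltrDl ltr_pwDl // sumr_ge0.
pose a := 1 + e / K.
have a1 : 1 < a by rewrite ltrDl divr_gt0.
pose za := a *: z + (1 - a) *: p.
have zaE j : za ord0 j = z ord0 j + (a - 1) * (z ord0 j - p ord0 j).
  by rewrite !mxE; ring.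
have a1E : a - 1 = e / K by rewrite /a addrAC subrr add0r.
have z_lt j : j \in sigma :\: tau -> z ord0 j < za ord0 j.
  by move=> jS; rewrite zaE ltrDl mulr_gt0 ?subr_gt0 // p_lt.
have box f : (forall j, `|z ord0 j - f ord0 j| <= `|z ord0 j - za ord0 j|) -> cubc ip sigma f.
  move=> fz; apply: be; apply: row_ball => // j; apply: le_lt_trans (fz j) _.
  rewrite zaE opprD addrA subrr add0r normrN normrM a1E ger0_norm ?divr_ge0 ?ltW //.
  by rewrite mulrAC ltr_pdivrMr // ltr_pM2l.
pose mixz (s : seq 'I_m) : 'rV[R]_m := \row_j (if j \in s then za ord0 j else z ord0 j).
(* The coordinates are moved to those of [za] one at a time; [box] keeps every intermediate point in
   [cubc]. *)
have path s : uniq s -> {subset s <= sigma :\: tau} ->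
    slicevol ip sigma tau (mixz s) = (slicevol ip sigma tau z +
      (k.+1`!%:R^-1 * (ev (mixz s) k.+1 tau - ev z k.+1 tau))%:E)%E.
  elim: s => [_ _|i s IHs /= /andP[iS' us] sub].
    have -> : mixz [::] = z by apply/rowP => j; rewrite mxE.
    by rewrite subrr mulr0 adde0.
  have -> : mixz (i :: s) = upd (mixz s) i (za ord0 i).
    by apply/rowP => j; rewrite !mxE inE; case: eqVneq => [->|].
  have iSt : i \in sigma :\: tau by apply: sub; rewrite mem_head.
  have mi : mixz s ord0 i = z ord0 i by rewrite mxE (negPf iS').
  move: (iSt); rewrite inE => /andP[itau isig].
  rewrite (@slicevol_step tau i (mixz s) _ k) //.
  - rewrite IHs //; last by move=> j js; apply: sub; rewrite inE js orbT.
    by rewrite -addeA -EFinD -mulrDr; congr (_ + (_ * _)%:E)%E; ring.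
  - by rewrite mi z_lt.
  - move=> t; rewrite mi => /andP[t1 t2]; apply: box => j; rewrite updE.
    case: eqVneq => [->|ji].
      by rewrite !ler0_norm ?subr_le0 ?(le_trans t1) // !opprB lerD2r.
    by rewrite mxE; case: ifP => // _; rewrite subrr normr0.
  - move=> z' zc'; apply: IH => //; first by rewrite finset.subUset finset.sub1set isig.
    have -> : sigma :\: (i |: tau) = (sigma :\: tau) :\ i.
      by apply/setP => j; rewrite !inE negb_or andbA.
    by have := cardsD1 i (sigma :\: tau); rewrite iSt sk => -[].
have sub_enum : {subset enum (sigma :\: tau) <= sigma :\: tau} by move=> j; rewrite mem_enum.
have uniq_enum : uniq (enum (sigma :\: tau)) by exact: enum_uniq.
have E1 := path _ uniq_enum sub_enum.
have mixE : mixz (enum (sigma :\: tau)) = za.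
  apply/rowP => j; rewrite mxE mem_enum; case: (boolP (_ \in _)) => // /pj zp.
  by rewrite zaE zp subrr mulr0 addr0.
have E2 : slicevol ip sigma tau za = ((a ^+ k.+1)%:E * slicevol ip sigma tau z)%E.
  rewrite /slicevol iterint_affine ?(lt_trans _ a1) //; last 2 first.
  - exact: indreg_ge0.
  - exact: indreg_rowmeas.
  rewrite -cardE sk; congr (_ * _)%E; apply: eq_iterint => g _.
  have a0 : 0 < a by exact: lt_trans a1.
  (* The vertex of [p] lies in the span of [tau], so it does not contribute to the coefficients
     outside [tau]. *)
  have cE j : j \in sigma -> j \notin tau ->
      ip (vert sigma (a *: g + (1 - a) *: p)) (dual sigma j) =
      a * ip (vert sigma g) (dual sigma j).
    move=> jS jt; rewrite vertexD // !vertexZ // ipDl !ipZl vp //.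
    by rewrite (coef_subset ip iS ts (vertex_span ip z it)) // (negPf jt) mulr0 addr0.
  have bE j : ((a *: g + (1 - a) *: p) ord0 j <= za ord0 j) = (g ord0 j <= z ord0 j).
    by rewrite !mxE lerD2r ler_pM2l.
  apply: eq_indreg; split=> H j jS jt; have [c0 c1] := H j jS jt.
    by rewrite bE in c1; rewrite cE // pmulr_rge0 // in c0.
  by rewrite bE cE // pmulr_rge0.
have E3 : ev za k.+1 tau = a ^+ k.+1 * ev z k.+1 tau by apply: ev_affine.
have /fineK F := slicevol_fin iS ts zc.
pose S := fine (slicevol ip sigma tau z); pose A := a ^+ k.+1.
pose V := ev z k.+1 tau; pose c : R := k.+1`!%:R^-1.
have H : A * S = S + c * (A * V - V).
  by move: E1; rewrite mixE E2 E3 -F -EFinM -EFinD => -[].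
have A1 : A - 1 != 0 by rewrite gt_eqF // subr_gt0 exprn_egt1.
rewrite -F; congr (_%:E); rewrite -/S -/V -/c.
apply: (mulfI A1); apply/eqP; rewrite -subr_eq0; apply/eqP.
rewrite (_ : _ - _ = A * S - (S + c * (A * V - V))); last by ring.
by rewrite H subrr.
Qed.

End SliceVolume.

Lemma mderiv_homog (R : realType) m (p : mpoly m R) k i :
  p \is ishomog1 k.+1 mdeg -> mderiv i p \is ishomog1 k mdeg.
Proof.
move=> /dhomogP hp; apply/dhomogP => mm.
rewrite mcoeff_msupp mcoeff_mderiv => H.
have : mnm_add mm (mnm1 i) \in msupp p.
  by rewrite mcoeff_msupp; apply: contraNneq H => ->; rewrite mul0rn.
by move/hp; rewrite /= mdegD mdeg1 addn1 => -[].
Qed.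

(** Induction on the degree: a coordinate segment around each point stays in [U], so the partial
    derivatives vanish on [U] too, and in characteristic zero they determine all coefficients of
    positive degree. This makes the choice in [volpoly] unique. *)
Lemma homog_eq0_open (R : realType) m (U : set 'rV[R]_m) z k (p : mpoly m R) :
  open U -> U z -> p \is ishomog1 k mdeg ->
  (forall y, U y -> meval (y ord0) p = 0) -> p = 0.
Proof.
move=> oU Uz; elim: k p => [|k IH] p hp p0.
  apply/mpolyP => mm; rewrite mcoeff0; have [//|mp] := eqVneq (mcoeff mm p) 0.
  have pC : p = mpolyC m (mcoeff mnm0 p).
    apply/mpolyP => m'; rewrite mcoeffC; have [->|m'0] := eqVneq m' mnm0.
      by rewrite mulr1.
    rewrite mulr0; apply: (dhomog_nemf_coeff hp).
    by rewrite /= mdeg_eq0.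
  have := p0 z Uz; rewrite pC mevalC => c0.
  by move: mp; rewrite pC c0 mpolyC0 mcoeff0 eqxx.
have dp0 i : mderiv i p = 0.
  apply: IH; first exact: mderiv_homog.
  move=> y Uy; have := is_derive_meval y i p (y ord0 i).
  rewrite upd_id => -[_ <-].
  have nb : \forall t \near (y ord0 i), U (upd y i t).
    have /nbhs_ballP[e /= e0 be] := open_nbhs_nbhs (conj oU Uy).
    apply/nbhs_ballP; exists e => // t; rewrite -ball_normE /= => te.
    apply: be; apply: row_ball => // j; rewrite updE.
    by case: eqVneq => [->|_] //; rewrite subrr normr0.
  rewrite (@near_eq_derive _ _ _ _ (cst 0)) ?derive_cst //.
  by apply: filterS nb => t /p0.
apply/mpolyP => mm; rewrite mcoeff0.
have [//|mp] := eqVneq (mcoeff mm p) 0.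
have dm : mdeg mm = k.+1.
  by move/dhomogP: hp => hp; apply: (hp mm); rewrite mcoeff_msupp.
have [i mi] : exists i, mm i != 0%N.
  apply/existsP; apply: contraT => /existsPn m0.
  suff /eqP : mdeg mm = 0%N by rewrite dm.
  by rewrite mdegE big1 // => i _; apply/eqP; move: (m0 i); rewrite negbK.
have mE : mm = mnm_add (mnm_sub mm (mnm1 i)) (mnm1 i).
  by rewrite submK // lep1mP.
have := mcoeff_mderiv i p (mnm_sub mm (mnm1 i)).
rewrite dp0 mcoeff0 -mE => /esym/eqP; rewrite mulrn_eq0 /= => /eqP E.
by rewrite E eqxx in mp.
Qed.

(** * The volume polynomial of a fan *)

Section VolPoly.
Variables (R : realType) (n : nat) (Sigma : fan_data R n).
Variable ip : {dot 'rV[R]_n for idfun}.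
Local Notation m := (nrays Sigma).
Implicit Types (sigma tau rho pi : {set 'I_m}) (z f g : 'rV[R]_m) (v : 'rV[R]_n).
Local Notation vert := (cub_vertex ip).
Local Notation dual := (dual_gen ip).

Lemma ip_scalar v : scalar (fun y => ip y v).
Proof. by move=> a x y; rewrite ipDl ipZl. Qed.

(** If the coefficient on [gen i] is zero, subtracting a small multiple of [gen i] leaves the cone
    but not its span; conversely, finitely many strict linear inequalities persist nearby. *)
Lemma relintP sigma v : indep sigma -> v \in cone_span sigma ->
  relint sigma v <-> forall i, i \in sigma -> 0 < ip v (dual sigma i).
Proof.
move=> iS vS; split=> [[vc nv] i isig|v_gt0].
  have [_ v_ge0] := (coneP ip v iS).1 vc.
  rewrite lt_def v_ge0 // andbT; apply/eqP => vi0.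
  have /nbhs_ballP[e /= e0 be] := nv.
  pose K : R := 1 + \sum_j `|(gen i : 'rV[R]_n) ord0 j|.
  have K0 : 0 < K by rewrite ltr_pwDl // sumr_ge0.
  pose t := e / K; have t0 : 0 < t by rewrite divr_gt0.
  have : cone sigma (v - t *: gen i).
    apply: be; last by rewrite /= rpredB // rpredZ // gen_span.
    apply: row_ball => // j; rewrite !mxE opprB addrC subrK normrM ger0_norm ?ltW //.
    rewrite /t mulrAC ltr_pdivrMr // ltr_pM2l // /K (bigD1 j) //= addrCA ltrDl.
    by rewrite ltr_pwDl // sumr_ge0.
  move=> /(coneP ip _ iS)[_ /(_ i isig)].
  rewrite ipBl ipZl vi0 dual_ip // eqxx mulr1 sub0r oppr_ge0.
  by rewrite leNgt t0.
split; first by apply/(coneP ip v iS); split=> // i iS'; exact/ltW/v_gt0.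
have FF : Filter (nbhs v) by exact: nbhs_filter.
suff : \forall y \near v, forall i, i \in sigma -> 0 < ip y (dual sigma i).
  apply: filterS => y H yS; apply/(coneP ip y iS); split=> // i isig.
  by apply/ltW/H.
apply: (@filter_forall _ _ (fun i y => i \in sigma -> 0 < ip y (dual sigma i)) (nbhs v) FF) => i.
have [isig|isig] := boolP (i \in sigma); last by apply: filterE => y //.
pose l := HB.pack_for {scalar 'rV[R]_n} (fun y => ip y (dual sigma i))
  (GRing.isLinear.Build R _ _ _ _ (ip_scalar (dual sigma i))).
have /continuousP /(_ _ (@open_gt R 0)) oP := @scalar_row_continuous R n l.
apply: filterS (open_nbhs_nbhs (conj oP (v_gt0 i isig))).
by move=> y.
Qed.

(** The coordinates in the lattice basis are the products with the generators, that is, the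
    coordinates of [region]; the normalizing factorial of [vol_cone] cancels the one of
    [slicevol_Wpoly]. *)
Lemma vol_cone_Wpoly sigma z : indep sigma -> cubc ip sigma z ->
  vol_cone ip sigma (cub_polytope ip sigma z) =
  meval (z ord0) (Wpoly ip (single sigma) #|sigma| finset.set0).
Proof.
move=> iS zc; rewrite /vol_cone (@lebesgue_tuple_iterint R m _ (enum_tuple sigma) _ z); last first.
  exact: enum_uniq.
have := slicevol_Wpoly iS (finset.sub0set sigma) _ zc.
rewrite finset.setD0 => /(_ _ erefl); rewrite /slicevol finset.setD0 => E.
rewrite (eq_iterint (G := indreg ip sigma finset.set0 z)).
  by rewrite E /= mulrA divff ?mul1r // pnatr_eq0 -lt0n fact_gt0.
move=> g _; rewrite /indreg diracE indicE; congr (_%:R%:E); congr (nat_of_bool _).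
have gE : \sum_(k < #|sigma|) tnth (map_tuple (fun j => g ord0 j) (enum_tuple sigma)) k *:
    dual sigma (enum_val k) = vert sigma g.
  rewrite vertex_dual // [RHS]big_enum_val; apply: eq_bigr => k _.
  by rewrite tnth_map (tnth_nth (enum_val k)) -enum_val_nth.
apply/idP/idP; rewrite !inE /= gE.
  move=> [/(coneP ip _ iS)[_ c0] cz] j jS _; split; first exact: c0.
  by rewrite -(vertex_ip ip g iS jS); exact: cz.
move=> H; split.
  apply/(coneP ip _ iS); split; first exact: vertex_span.
  by move=> i isig; have [] := H i isig; rewrite ?inE.
by move=> i isig; rewrite vertex_ip //; have [] := H i isig; rewrite ?inE.
Qed.

Lemma Wpoly_sum (I : finType) (P : pred I) (c : I -> R) (w : I -> {set 'I_m} -> R) k tau :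
  Wpoly ip (fun pi => \sum_(l | P l) c l * w l pi) k tau =
  \sum_(l | P l) c l *: Wpoly ip (w l) k tau.
Proof.
elim: k tau => [|k IH] tau /=.
  rewrite (raddf_sum (@mpolyC m R)); apply: eq_bigr => l _.
  by rewrite /= mpolyCM mul_mpolyC.
under [RHS]eq_bigr do rewrite scaler_sumr; rewrite [RHS]exchange_big.
apply: eq_bigr => i _; rewrite IH mulr_sumr; apply: eq_bigr => l _ /=.
by rewrite scalerAr.
Qed.

(** Together with [indepcones], this replaces [is_fan] in the volume computation, so that it applies
    to stars, which are never shown to satisfy [is_fan]. *)
Definition downclosed := forall sigma pi, sigma \in cones Sigma -> pi \subset sigma ->
  pi \in cones Sigma.
Definition indepcones := forall sigma, sigma \in cones Sigma -> indep sigma.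

Hypothesis dc : downclosed.
Hypothesis ic : indepcones.

Lemma cubP z : cub Sigma ip z <-> forall sigma, sigma \in cones Sigma ->
  forall i, i \in sigma -> 0 < ip (vert sigma z) (dual sigma i).
Proof.
split=> H sigma sS; last by apply/relintP; [exact: ic|exact/vertex_span/ic|exact: H].
by apply/(relintP (ic sS)); [exact/vertex_span/ic|exact: H].
Qed.

Lemma cub_cubc z sigma : cub Sigma ip z -> sigma \in cones Sigma -> cubc ip sigma z.
Proof. by move=> /cubP zc sS pi ps; apply: zc; exact: dc ps. Qed.

Lemma cub_setI : cub Sigma ip = \bigcap_(sigma in [set` cones Sigma]) cubc ip sigma.
Proof.
apply/seteqP; split=> z zc; first by move=> sigma /= sS; exact: cub_cubc.
by apply/cubP => sigma sS; apply: (zc sigma).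
Qed.

Lemma open_cub : open (cub Sigma ip).
Proof.
rewrite openE => z zc; rewrite /interior.
have FF : Filter (nbhs z) by exact: nbhs_filter.
suff : \forall y \near z, forall sigma, sigma \in cones Sigma -> cubc ip sigma y.
  by apply: filterS => y H; rewrite cub_setI => sigma /= sS; exact: H.
apply: (@filter_forall _ _ (fun sigma y => sigma \in cones Sigma -> cubc ip sigma y)
  (nbhs z) FF) => sigma.
have [sS|sS] := boolP (sigma \in cones Sigma); last by apply: filterE => y //.
apply: filterS (open_nbhs_nbhs (conj (open_cubc (ic sS)) (cub_cubc zc sS))).
by move=> y.
Qed.

Variables (omega : {set 'I_m} -> R) (d : nat).

Definition weight sigma : R := if sigma \in kcones Sigma d then omega sigma else 0.

Lemma weight_indep sigma : weight sigma != 0 -> indep sigma.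
Proof.
rewrite /weight; case: ifP; last by rewrite eqxx.
by rewrite inE => /andP[sS _] _; exact: ic.
Qed.

Lemma kconesE sigma : (sigma \in kcones Sigma d) = (sigma \in cones Sigma) && (#|sigma| == d).
Proof.
rewrite inE; have [sS|//] := boolP (sigma \in cones Sigma).
by rewrite (indepP _).2 //; exact: ic.
Qed.

Lemma vol_Wpoly z : cub Sigma ip z ->
  vol ip omega d z = meval (z ord0) (Wpoly ip weight d finset.set0).
Proof.
move=> zc.
have -> : weight = fun pi => \sum_(sigma in kcones Sigma d) omega sigma * single sigma pi.
  apply/funext => pi; rewrite /weight /single; case: ifP => pk.
    rewrite (bigD1 pi) //= eqxx mulr1 big1 ?addr0 // => s /andP[_ /negPf sp].
    by rewrite eq_sym sp mulr0.
  rewrite big1 // => s sk; case: eqVneq sk => [<-|_ _]; last by rewrite mulr0.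
  by rewrite pk.
rewrite Wpoly_sum raddf_sum; apply: eq_bigr => s.
rewrite kconesE => /andP[sS /eqP sd]; rewrite /= mevalZ -sd vol_cone_Wpoly //.
  exact: ic.
exact: cub_cubc.
Qed.

Lemma volpolyE : cub Sigma ip !=set0 ->
  volpoly ip omega d = Wpoly ip weight d finset.set0.
Proof.
move=> [z zc]; rewrite /volpoly.
case: xgetP => [p _ [hp pE]|/(_ (Wpoly ip weight d finset.set0))]; last first.
  by case; split; [exact: Wpoly_homog|move=> y yc; rewrite vol_Wpoly].
apply/eqP; rewrite -subr_eq0; apply/eqP.
apply: (homog_eq0_open open_cub zc (k := d)); first by rewrite rpredB // Wpoly_homog.
by move=> y yc; rewrite mevalB pE // vol_Wpoly // subrr.
Qed.

End VolPoly.

(** * Faces of simplicial fans *)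

Section FanCombinatorics.
Variables (R : realType) (n : nat) (Sigma : fan_data R n).
Variable ip : {dot 'rV[R]_n for idfun}.
Local Notation m := (nrays Sigma).
Implicit Types (sigma tau rho pi : {set 'I_m}) (v : 'rV[R]_n).
Local Notation dual := (dual_gen ip).

Lemma cone_subP sigma pi v : indep sigma -> pi \subset sigma ->
  cone pi v <-> cone sigma v /\
    forall i, i \in sigma -> i \notin pi -> ip v (dual sigma i) = 0.
Proof.
move=> iS ps; have ipi : indep pi by exact: indepS iS.
split.
  move=> /(coneP ip v ipi)[vp v0]; have vS := span_subset ps vp; split.
    apply/(coneP ip v iS); split=> // i isig; rewrite (coef_subset ip iS ps) //.
    by case: ifP => // /v0.
  by move=> i isig /negPf inp; rewrite (coef_subset ip iS ps) // inp.
move=> [/(coneP ip v iS)[vS v0] vz]; have vp := coef_span iS ps vS vz.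
apply/(coneP ip v ipi); split=> // i ipi'.
have isig := fintype.subsetP ps i ipi'.
by have := v0 i isig; rewrite (coef_subset ip iS ps) // ipi'.
Qed.

(** The sum of the dual vectors outside [pi] is nonnegative on the cone and vanishes exactly where
    all those coefficients do. *)
Lemma subset_is_face sigma pi : indep sigma -> pi \subset sigma ->
  is_face (cone pi) (cone sigma).
Proof.
move=> iS ps; pose u := \sum_(i in sigma :\: pi) dual sigma i.
pose l := HB.pack_for {scalar 'rV[R]_n} (fun y => ip y u)
  (GRing.isLinear.Build R _ _ _ _ (ip_scalar ip u)).
have uE v : ip v u = \sum_(i in sigma :\: pi) ip v (dual sigma i).
  by rewrite /u ip_sumr.
exists l; split.
  move=> v /(coneP ip v iS)[_ v0]; rewrite /= uE; apply: sumr_ge0 => i.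
  by rewrite inE => /andP[_ /v0].
apply/seteqP; split=> v /=.
  move=> /(cone_subP v iS ps)[vc vz]; split=> //.
  by rewrite uE big1 // => i; rewrite inE => /andP[ip' isig]; exact: vz.
rewrite uE => -[vc vz]; apply/(cone_subP v iS ps); split=> // i isig ipi.
have [_ v0] := (coneP ip v iS).1 vc.
apply: (psumr_eq0P _ vz); last by rewrite inE ipi.
by move=> j; rewrite inE => /andP[_ /v0].
Qed.

Lemma is_face_subset sigma F : indep sigma -> is_face F (cone sigma) ->
  exists2 pi : {set 'I_m}, pi \subset sigma & F = cone pi.
Proof.
move=> iS [l [l0 ->]]; pose pi := [set i in sigma | l (gen i) == 0]%SET.
have ps : pi \subset sigma by apply/fintype.subsetP => i; rewrite inE => /andP[].
have gc i : i \in sigma -> cone sigma (gen i).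
  move=> isig; apply/(coneP ip _ iS); split; first exact: gen_span.
  by move=> j jS; rewrite dual_ip.
have lE v : v \in cone_span sigma ->
    l v = \sum_(i in sigma) ip v (dual sigma i) * l (gen i).
  move=> vS; rewrite {1}(span_dual ip iS vS) linear_sum; apply: eq_bigr => i _.
  by rewrite linearZ.
exists pi => //; apply/seteqP; split=> v /=.
  move=> [vc lv]; apply/(cone_subP v iS ps); split=> // i isig inpi.
  have [vS v0] := (coneP ip v iS).1 vc.
  rewrite lE // in lv; have := psumr_eq0P _ lv => /(_ _ i isig) H.
  have /eqP : ip v (dual sigma i) * l (gen i) = 0.
    by apply: H => j jS; rewrite mulr_ge0 ?v0 ?l0 //; exact: gc.
  rewrite mulf_eq0 => /orP[/eqP//|li]; move: inpi.
  by rewrite inE isig li.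
move=> /(cone_subP v iS ps)[vc vz]; split=> //.
have [vS _] := (coneP ip v iS).1 vc.
rewrite lE // big1 // => i isig; have [ipi|ipi] := boolP (i \in pi).
  by move: ipi; rewrite inE isig => /eqP ->; rewrite mulr0.
by rewrite vz // mul0r.
Qed.

Hypothesis fan : is_fan Sigma.
Hypothesis ic : indepcones Sigma.

Let gen_neq0 i : gen (f := Sigma) i != 0. Proof. by case: fan. Qed.

(** The fan axioms only give a [tau] in the fan with the same cone as [pi], and injectivity of
    [cone] cannot be applied to [pi] yet. So rays are compared: a ray [i] of [tau] is a face of the
    cone of [pi], hence the cone of some subset of [pi]; any [k] in that subset generates the same
    ray, and [k = i]. *)
Lemma fan_downclosed : downclosed Sigma.
Proof.
case: fan => _ ray cinj crays [cface _] sigma pi sS ps.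
have iS := ic sS; have ipi : indep pi by exact: indepS iS.
have [tau tS ctau] := cface _ sS _ (subset_is_face iS ps).
suff -> : pi = tau by [].
apply/setP => i; rewrite (crays _ tS); apply/idP/asboolP; rewrite -ctau.
  by move=> ipi'; apply: subset_is_face => //; rewrite finset.sub1set.
move=> /(is_face_subset ipi)[rho rp cE].
have irho : indep rho by exact: indepS ipi.
have gi : cone [set i]%SET (gen i).
  by exists (fun=> 1) => //; rewrite big_set1 scale1r.
have [r0|[k kr]] := set_0Vmem rho.
  move: gi; rewrite cE r0 => -[a _]; rewrite big_set0 => g0.
  by have := gen_neq0 i; rewrite g0 eqxx.
have : cone rho (gen k).
  exists (fun j => (j == k)%:R) => [j|]; first exact: ler0n.
  rewrite (bigD1 k) //= eqxx scale1r big1 ?addr0 // => j /andP[_ /negPf ->].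
  by rewrite scale0r.
rewrite -cE => -[a a0]; rewrite big_set1 => gk.
have ai : 0 < a i.
  rewrite lt_def a0 andbT; apply: contraTneq (gen_neq0 k) => ai.
  by rewrite gk ai scale0r eqxx.
have : cone [set k]%SET = cone [set i]%SET.
  apply/seteqP; split=> v -[b b0]; rewrite big_set1 => ->.
    exists (fun=> b k * a i); first by move=> _; exact: mulr_ge0.
    by rewrite big_set1 gk scalerA.
  exists (fun=> b i / a i); first by move=> _; rewrite divr_ge0 // ltW.
  by rewrite big_set1 gk scalerA divfK // gt_eqF.
move=> /(cinj _ _ (ray k) (ray i)) /finset.set1_inj <-.
exact: fintype.subsetP kr.
Qed.

Lemma faceE tau sigma : tau \in cones Sigma -> sigma \in cones Sigma ->
  face tau sigma = (tau \subset sigma).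
Proof.
case: (fan) => _ _ cinj _ _ tS sS; apply/asboolP/idP.
  move=> /(is_face_subset (ic sS))[rho rs cE].
  by rewrite (cinj _ _ tS (fan_downclosed sS rs) cE).
exact: subset_is_face (ic sS).
Qed.

Lemma cone_inter sigma tau v : sigma \in cones Sigma -> tau \in cones Sigma ->
  cone sigma v -> cone tau v -> cone (sigma :&: tau)%SET v.
Proof.
case: (fan) => _ _ cinj _ [_ cI] sS tS vs vt.
have [/(is_face_subset (ic sS))[rho rs E] /(is_face_subset (ic tS))[rho' rt E']] := cI _ _ sS tS.
have rE : rho = rho'.
  apply: cinj; [exact: fan_downclosed sS rs|exact: fan_downclosed tS rt|].
  by rewrite -E -E'.
have rst : rho \subset (sigma :&: tau)%SET by rewrite finset.subsetI rs rE rt.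
have ist : indep (sigma :&: tau)%SET by apply: indepS (ic sS); exact: finset.subsetIl.
have : cone rho v by rewrite -E; split.
by move=> /(cone_subP v ist rst)[].
Qed.

Lemma fan_pure d tau : is_pure Sigma d -> tau \in cones Sigma ->
  exists sigma, [/\ sigma \in cones Sigma, tau \subset sigma & #|sigma| = d].
Proof.
move=> [_ pure] tS.
pose P sigma := (sigma \in cones Sigma) && (tau \subset sigma).
have Pt : P tau by rewrite /P tS subxx.
have [sigma /andP[sS ts] smax] := arg_maxnP (fun s : {set 'I_m} => #|s|) Pt.
exists sigma; split=> //; rewrite -(pure sigma sS) ?(indepP _).2 //; first exact: ic.
move=> rho rS; rewrite faceE // => sr; apply/esym/eqP; rewrite finset.eqEcard sr /=.
by apply: smax; rewrite /P rS; exact: fintype.subset_trans sr.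
Qed.

Lemma set0_cone d : is_pure Sigma d -> finset.set0 \in cones Sigma.
Proof.
move=> [/set0Pn[sigma sS] _]; apply: fan_downclosed sS _; exact: finset.sub0set.
Qed.

End FanCombinatorics.

(** * Stars *)

Section Star.
Variables (R : realType) (n : nat) (Sigma : fan_data R n).
Variable ip : {dot 'rV[R]_n for idfun}.
Local Notation m := (nrays Sigma).
Implicit Types (sigma pi : {set 'I_m}) (z x : 'rV[R]_m) (v : 'rV[R]_n).
Local Notation vert := (cub_vertex ip).
Local Notation dual := (dual_gen ip).
Hypothesis dc : downclosed Sigma.
Hypothesis ic : indepcones Sigma.
Hypothesis fc : forall pi sigma, pi \in cones Sigma -> sigma \in cones Sigma ->
  face pi sigma = (pi \subset sigma).
Variable tau : {set 'I_m}.
Hypothesis tS : tau \in cones Sigma.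

Let it : indep tau := ic tS.
Let St := star ip tau.
Local Notation e := (@enum_val _ (mem (star_rays tau))).
Implicit Types (s : {set 'I_(nrays St)}).

(** On index sets, the inverse of the bijection from the cones containing [tau] to those of the
    star. *)
Definition starlift s : {set 'I_m} := ([set e j | j in s] :|: tau)%SET.

Lemma star_raysP i : (i \in star_rays tau) = (i \notin tau) && (i |: tau \in cones Sigma)%SET.
Proof.
rewrite inE; congr (_ && _); apply/exists_inP/idP.
  move=> [sigma sS /andP[]]; rewrite fc // => ts isig.
  by apply: dc sS _; rewrite finset.subUset finset.sub1set isig.
by move=> iS; exists (i |: tau)%SET; rewrite ?fc // finset.subsetUr finset.setU11.
Qed.

Lemma e_notin (j : 'I_(nrays St)) : e j \notin tau.
Proof. by have := enum_valP j; rewrite star_raysP => /andP[]. Qed.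

Lemma starliftU s j : starlift (j |: s) = (e j |: starlift s)%SET.
Proof. by rewrite /starlift finset.imsetU1 finset.setUA. Qed.

Lemma starlift0 : starlift finset.set0 = tau.
Proof. by rewrite /starlift finset.imset0 finset.set0U. Qed.

Lemma mem_starlift s (j : 'I_(nrays St)) : (e j \in starlift s) = (j \in s).
Proof.
by rewrite finset.in_setU (negPf (e_notin j)) orbF mem_imset //; exact: enum_val_inj.
Qed.

Lemma sub_starlift s : tau \subset starlift s.
Proof. exact: finset.subsetUr. Qed.

Lemma star_conesE s : (s \in cones St) = (starlift s \in cones Sigma).
Proof.
apply/imsetP/idP.
  move=> [pi]; rewrite inE => /andP[piS /exists_inP[sigma sS]].
  rewrite !fc // => /andP[ts ps] ->; apply: dc sS _.
  rewrite finset.subUset ts andbT; apply/fintype.subsetP => i /imsetP[j].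
  by rewrite inE => jp ->; exact: fintype.subsetP jp.
move=> sS; have iS : [set e j | j in s]%SET \in cones Sigma.
  by apply: dc sS _; exact: finset.subsetUl.
exists [set e j | j in s]%SET.
  rewrite inE iS; apply/exists_inP; exists (starlift s) => //.
  by rewrite !fc // sub_starlift finset.subsetUl.
by apply/setP => j; rewrite inE mem_imset //; exact: enum_val_inj.
Qed.

Lemma starliftS s s' : s' \subset s -> starlift s' \subset starlift s.
Proof. by move=> ss; apply: finset.setSU; exact: imsetS. Qed.

Lemma star_downclosed : downclosed St.
Proof.
by move=> s s'; rewrite !star_conesE => sS ss; apply: dc sS _; exact: starliftS.
Qed.

Lemma star_genE (j : 'I_(nrays St)) : gen j = perp ip tau (e j).
Proof.
set U := orthov ip (cone_span tau); set V := cone_span tau.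
have UV : (U :&: V = 0)%VS.
  apply/eqP; rewrite -subv0; apply/subvP => v; rewrite memv_cap memv0 => /andP[/mem_orthovP vU vV].
  by apply/eqP; apply: (ip_eq0 (ip := ip)); exact: vU.
have VU : (V :&: U = 0)%VS by rewrite capvC.
set w := vert tau (\row_k ip (gen (e j)) (gen k)).
have wV : w \in V by exact: vertex_span.
have pU : perp ip tau (e j) \in U.
  by apply/mem_orthovP => v vV; exact: perp_ip0.
have gE : gen (e j) = perp ip tau (e j) + w by rewrite /perp subrK.
rewrite /= /star_proj gE linearD /= -/U -/V daddv_pi_id //.
have := daddv_pi_add UV (subvP (addvSr U V) _ wV).
rewrite [X in _ + X](daddv_pi_id VU) // => /(canRL (addrK _)) ->.
by rewrite subrr addr0.
Qed.

Lemma star_projE (j : 'I_(nrays St)) : star_proj ip tau (gen (e j)) = perp ip tau (e j).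
Proof. exact: star_genE. Qed.

Lemma perp_dual s j k : starlift s \in cones Sigma -> j \in s -> k \in s ->
  ip (perp ip tau (e k)) (dual (starlift s) (e j)) = (k == j)%:R.
Proof.
move=> sS js ks; have iS := ic sS.
rewrite ipBl dual_ip // ?mem_starlift // (coef_subset ip iS (sub_starlift s)) ?vertex_span //.
  by rewrite (negPf (e_notin j)) subr0 (inj_eq enum_val_inj) eq_sym.
by rewrite mem_starlift.
Qed.

Lemma star_indepcones : indepcones St.
Proof.
move=> s; rewrite star_conesE => sS a a0 j js.
set D := dual (starlift s) (e j).
have /(congr1 (fun v => ip v D)) : \sum_(k in s) a k *: gen k = 0 by exact: a0.
rewrite ip_suml ip0l (bigD1 j) //= big1 ?addr0.
  by rewrite ipZl star_projE perp_dual // eqxx mulr1.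
by move=> k /andP[ks kj]; rewrite ipZl star_projE perp_dual // (negPf kj) mulr0.
Qed.

(** The linear change of variables that turns the volume polynomial of the star into [W_tau]. *)
Definition starrow z : 'rV[R]_(nrays St) := \row_j L ip tau (e j) z.

Lemma star_vertex s z : starlift s \in cones Sigma ->
  vert s (starrow z) = vert (starlift s) z - vert tau z.
Proof.
move=> sS; have iS := ic sS.
have is' : indep s by apply: star_indepcones; rewrite star_conesE.
set v := vert (starlift s) z - vert tau z.
have v0 i : i \in tau -> ip v (gen i) = 0.
  by move=> iT; rewrite ipBl !vertex_ip ?subrr // (fintype.subsetP (sub_starlift s)).
have v0' w : w \in cone_span tau -> ip v w = 0.
  move=> /spanP[a ->]; rewrite ip_sumr big1 // => i iT.
  by rewrite ipZr v0 // mulr0.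
apply: vertex_unique => //.
  have vS : v \in cone_span (starlift s).
    by rewrite rpredB ?vertex_span // (span_subset (sub_starlift s)) // vertex_span.
  have [a vE] := spanP vS.
  (* The candidate expansion uses the projected generators; the error lies in the span of [tau] and
     is orthogonal to it. *)
  pose t := v - \sum_(j in s) a (e j) *: gen j.
  suff t0 : t = 0.
    move/eqP: t0; rewrite subr_eq0 => /eqP ->.
    by apply: rpred_sum => j js; apply: rpredZ; exact: gen_span.
  apply: (span_ip_eq0 (ip := ip) (sigma := tau)).
    have -> : t = \sum_(i in tau) a i *: gen i +
        \sum_(j in s) a (e j) *: (gen (e j) - gen j).
      rewrite /t vE /starlift (big_setID tau) /=.
      have -> : (([set e j | j in s] :|: tau) :&: tau)%SET = tau.
        by apply/finset.setIidPr; exact: finset.subsetUr.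
      have -> : (([set e j | j in s] :|: tau) :\: tau)%SET = [set e j | j in s]%SET.
        apply/setP => i; rewrite !inE; have [iT|//] := boolP (i \in tau).
          by apply/esym/negP => /imsetP[j _ iE]; move: (e_notin j); rewrite -iE iT.
        by rewrite orbF.
      rewrite big_imset /=; last by move=> ? ? _ _; exact: enum_val_inj.
      rewrite -addrA -sumrB; congr (_ + _); apply: eq_bigr => j _.
      by rewrite -scalerBr.
    rewrite rpredD ?span_sum //; apply: rpred_sum => j js; apply: rpredZ.
    by rewrite star_genE /perp opprB addrCA subrr addr0 vertex_span.
  move=> i iT; rewrite ipBl v0 // ip_suml big1 ?subrr // => j js.
  by rewrite ipZl star_genE perp_ip0 ?mulr0 // gen_span.
move=> j js; rewrite star_genE /perp ipBr [X in _ - X]v0' ?vertex_span // subr0 mxE.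
by rewrite ipBl vertex_ip // mem_starlift.
Qed.

Lemma star_L s j z : starlift s \in cones Sigma ->
  L ip s j (starrow z) = L ip (starlift s) (e j) z.
Proof.
move=> sS; rewrite /L star_vertex // mxE star_genE /perp ipBr.
rewrite [X in _ - (_ - X)](_ : _ = 0); last first.
  have [a ->] := spanP (vertex_span ip (\row_k ip (gen (e j)) (gen k)) it).
  rewrite ip_sumr big1 // => i iT; rewrite ipZr ipBl !vertex_ip ?subrr ?mulr0 //.
    exact: ic.
  exact: fintype.subsetP (sub_starlift s) _ iT.
by rewrite subr0 ipBl /L; ring.
Qed.

Lemma star_cub z : cub Sigma ip z -> cub St ip (starrow z).
Proof.
move=> zc; apply/(cubP ip star_indepcones) => s sS j js.
have is' : indep s by exact: star_indepcones.
have sj : starlift (s :\ j) \in cones Sigma.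
  rewrite -star_conesE; apply: star_downclosed sS _; exact: finset.subD1set.
have sS' : starlift s \in cones Sigma by rewrite -star_conesE.
have := L_coef ip (starrow z) is' js; rewrite star_L // => E.
have : 0 < L ip (starlift (s :\ j)) (e j) z.
  apply: (L_gt0 (ic sS')); first exact: cub_cubc.
    by rewrite -starliftU finset.setD1K.
  by rewrite mem_starlift !inE eqxx.
rewrite E pmulr_rgt0 // gram_gt0 ?finset.setD1K // !inE eqxx //.
Qed.

Variables (omega : {set 'I_m} -> R) (d : nat).
Hypothesis td : (#|tau| <= d)%N.
Local Notation w := (weight omega d).
Local Notation ws := (weight (star_weight ip tau omega) (d - #|tau|)%N).

Lemma weight_star s : ws s = w (starlift s).
Proof.
rewrite /weight (kconesE star_indepcones) (kconesE ic) star_conesE.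
have -> : (#|s| == (d - #|tau|)%N) = (#|starlift s| == d).
  rewrite /starlift cardsU card_imset; last exact: enum_val_inj.
  have -> : ([set e j | j in s] :&: tau)%SET = finset.set0.
    apply/setP => i; rewrite !inE; apply/negP => /andP[/imsetP[j _ ->]].
    by rewrite (negPf (e_notin j)).
  by rewrite cards0 subn0 eq_sym -(eqn_add2r #|tau|) subnK // eq_sym.
by case: ifP => // _; rewrite /star_weight finset.setUC.
Qed.

(** The two recursions match by [star_L], and rays outside the star contribute nothing because
    adding them to [tau] does not give a cone. Hypothesis (ii) becomes a statement about [mixed] in
    this way. *)
Lemma mixed_star s l : mixed ip ws s (map starrow l) = mixed ip w (starlift s) l.
Proof.
elim: l s => [|x l IH] s /=; first exact: weight_star.
rewrite size_map; congr (_ * _).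
have w0 pi : tau \subset pi -> pi \notin cones Sigma -> mixed ip w pi l = 0.
  move=> tp pS; apply: mixed_eq0 => sigma ps; rewrite /weight kconesE //.
  by case: ifP => // /andP[sS _]; rewrite (dc sS ps) in pS.
rewrite [RHS](bigID (mem (star_rays tau))) /= [X in _ = _ + X]big1 ?addr0; last first.
  move=> i /andP[iS ir]; rewrite w0 ?mulr0 //.
    by apply: fintype.subset_trans (sub_starlift s) _; exact: finset.subsetUr.
  apply: contra ir => iS'; rewrite star_raysP; apply/andP; split.
    by apply: contra iS => iT; rewrite (fintype.subsetP (sub_starlift s)).
  by apply: dc iS' _; apply: finset.setUS; exact: sub_starlift.
rewrite (eq_bigl (fun i => (i \in star_rays tau) && (i \notin starlift s))); last first.
  by move=> i; rewrite andbC.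
rewrite [RHS]big_enum_val_cond; apply: eq_big => [j|j js]; first by rewrite mem_starlift.
rewrite IH starliftU; have [jS|jS] := boolP ((e j |: starlift s)%SET \in cones Sigma).
  rewrite star_L //; apply: dc jS _; exact: finset.subsetUr.
rewrite w0 ?mulr0 //.
by apply: fintype.subset_trans (sub_starlift s) _; exact: finset.subsetUr.
Qed.

End Star.

(** * Hessian forms as mixed derivatives *)

Section MixedHessian.
Variables (R : realType) (n : nat) (Sigma : fan_data R n).
Variable ip : {dot 'rV[R]_n for idfun}.
Local Notation m := (nrays Sigma).
Variable w : {set 'I_m} -> R.
Hypothesis w_indep : forall sigma, w sigma != 0 -> indep sigma.
Variable tau : {set 'I_m}.
Hypothesis it : indep tau.
Implicit Types (l : seq 'rV[R]_m) (x y : 'rV[R]_m).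
Local Notation mixed := (mixed ip w).

Let mixed_scalar l : {scalar 'rV[R]_m} := HB.pack_for {scalar 'rV[R]_m}
  (fun v => mixed tau (v :: l)) (GRing.isLinear.Build R _ _ _ _ (mixed_linear ip w l it)).

Lemma mixed_sum x l : mixed tau (x :: l) = \sum_i x ord0 i * mixed tau (delta_mx ord0 i :: l).
Proof.
rewrite -[LHS]/(mixed_scalar l x) {1}(row_sum_delta x) linear_sum; apply: eq_bigr => i _.
by rewrite linearZ.
Qed.

Lemma hessian_Wpoly l : hessian (dirderivs l (Wpoly ip w (size l).+2 tau)) =
  \matrix_(i, j) mixed tau [:: delta_mx ord0 i, delta_mx ord0 j & l].
Proof.
apply/matrixP => i j; rewrite !mxE -2!dirderiv_delta.
rewrite -[dirderiv _ (dirderiv _ _)]/(dirderivs [:: delta_mx ord0 i, delta_mx ord0 j & l] _).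
by rewrite (mixedE ip w_indep [:: delta_mx ord0 i, delta_mx ord0 j & l]) mevalC.
Qed.

Lemma qform_hessian l x y :
  qform (hessian (dirderivs l (Wpoly ip w (size l).+2 tau))) x y = mixed tau [:: x, y & l].
Proof.
rewrite hessian_Wpoly /qform mixed_swap // (mixed_sum y) mxE; apply: eq_bigr => j _.
rewrite mulrC [y^T _ _]mxE; congr (_ * _).
rewrite mixed_swap // (mixed_sum x) mxE; apply: eq_bigr => i _.
by rewrite mxE.
Qed.

Lemma tr_hessian l : (hessian (dirderivs l (Wpoly ip w (size l).+2 tau)))^T =
  hessian (dirderivs l (Wpoly ip w (size l).+2 tau)).
Proof.
by rewrite hessian_Wpoly; apply/matrixP => i j; rewrite !mxE mixed_swap.
Qed.

End MixedHessian.

(** * Connectedness of links *)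

Section Connectedness.
Variables (R : realType) (n : nat) (F : fan_data R n).
Variable ip : {dot 'rV[R]_n for idfun}.
Hypothesis dc : downclosed F.
Hypothesis ic : indepcones F.
Hypothesis rays : forall i, [set i]%SET \in cones F.
Hypothesis inter : forall s s' v, s \in cones F -> s' \in cones F ->
  cone s v -> cone s' v -> cone (s :&: s')%SET v.
Implicit Types (s : {set 'I_(nrays F)}) (v : 'rV[R]_n).

Lemma closed_cone s : indep s -> closed (cone s).
Proof.
move=> iS.
pose r v : 'rV[R]_n := v - \sum_(i in s) ip v (dual_gen ip s i) *: gen i.
have rlin j : scalar (fun v => r v ord0 j).
  move=> a x y; rewrite /r !mxE !summxE.
  under eq_bigr do rewrite !mxE ipDl ipZl mulrDl -mulrA.
  rewrite big_split -mulr_sumr /=.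
  under [in RHS]eq_bigr do rewrite mxE.
  under [X in _ = _ + (_ - X)]eq_bigr do rewrite mxE.
  by ring.
have -> : cone s = (\bigcap_j [set v | r v ord0 j = 0]) `&`
    (\bigcap_(i in [set i | i \in s]) [set v | 0 <= ip v (dual_gen ip s i)]).
  apply/seteqP; split=> v.
    move=> /(coneP ip v iS)[vS v0]; split=> [j _ /=|i /= iS']; last exact: v0.
    by rewrite /r -(span_dual ip iS vS) subrr mxE.
  move=> [/= r0 v0]; apply/(coneP ip v iS); split; last by move=> i iS'; exact: v0.
  suff rv0 : r v = 0.
    by move/eqP: rv0; rewrite subr_eq0 => /eqP ->; exact: span_sum.
  by apply/rowP => j; rewrite [RHS]mxE; apply: r0.
apply: closedI; apply: closed_bigI => i _.
  pose l := HB.pack_for {scalar 'rV[R]_n} (fun v => r v ord0 i)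
    (GRing.isLinear.Build R _ _ _ _ (rlin i)).
  by apply: (closed_comp (f := l)) (@closed_eq R 0) => v _; exact: scalar_row_continuous.
pose l := HB.pack_for {scalar 'rV[R]_n} (fun y => ip y (dual_gen ip s i))
  (GRing.isLinear.Build R _ _ _ _ (ip_scalar ip (dual_gen ip s i))).
by apply: (closed_comp (f := l)) (@closed_ge R 0) => v _; exact: scalar_row_continuous.
Qed.

Lemma closed_cone_union (P : pred {set 'I_(nrays F)}) :
  closed [set v | exists2 s, (s \in cones F) && P s & cone s v].
Proof.
rewrite -[X in closed X]setCK; apply: open_closedC.
have -> : ~` [set v | exists2 s, (s \in cones F) && P s & cone s v] =
    [set v | forall s, (s \in cones F) && P s -> ~ cone s v].
  by apply/seteqP; split=> v H => [s sP cv|[s sP cv]]; [apply: H; exists s|exact: H cv].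
rewrite openE => v H; rewrite /interior.
have FF : Filter (nbhs v) by exact: nbhs_filter.
apply: (@filter_forall _ _ (fun s y => (s \in cones F) && P s -> ~ cone s y) (nbhs v) FF) => s.
have [sP|sP] := boolP ((s \in cones F) && P s); last by apply: filterE => y //.
have sS : s \in cones F by case/andP: sP.
apply: filterS (open_nbhs_nbhs (conj (closed_openC (closed_cone (ic sS))) (H s sP))).
by move=> y.
Qed.

Lemma gen_neq0 i : gen (f := F) i != 0.
Proof.
apply/eqP => g0; have /(_ (fun=> 1)) := ic (rays i).
rewrite big_set1 g0 scaler0 => /(_ erefl i (finset.set11 i)) /eqP.
by rewrite oner_eq0.
Qed.

Lemma ray_gen (i : 'I_(nrays F)) : cone [set i]%SET (gen i).
Proof. by exists (fun=> 1) => [_|]; [exact: ler01|rewrite big_set1 scale1r]. Qed.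

(** Without such a pair, every cone has its rays all in [S] or all outside. The two kinds of cones
    would give closed sets that cover the support, meet only at the origin and both contain a
    generator. *)
Lemma fan_graph_connected (S : {set 'I_(nrays F)}) :
  connected (fan_support F `\ 0) -> S != finset.set0 -> S != finset.setT ->
  exists i j, [/\ i \in S, j \notin S & [set i; j]%SET \in cones F].
Proof.
move=> conn S0 ST; apply: contrapT => nex.
have split_cone s : s \in cones F -> (s \subset S) || [disjoint s & S].
  move=> sS; apply: contraT; rewrite negb_or => /andP[/subsetPn[j js jS]].
  rewrite disjoint_sym => /pred0Pn[i /andP[/= iS is_]].
  exfalso; apply: nex; exists i, j; split=> //.
  by apply: dc sS _; rewrite finset.subUset !finset.sub1set is_ js.
pose A := [set v | exists2 s, (s \in cones F) && (s \subset S) & cone s v].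
pose B := [set v | exists2 s, (s \in cones F) && [disjoint s & S] & cone s v].
have AB v : A v -> B v -> v = 0.
  move=> [s /andP[sS sub] cs] [s' /andP[s'S dis] cs'].
  have := inter sS s'S cs cs'.
  have -> : (s :&: s')%SET = finset.set0.
    apply/eqP; rewrite finset.setI_eq0 disjoint_sym; exact: disjointWr sub dis.
  by move=> [a _]; rewrite big_set0.
have suppAB v : fan_support F v -> A v \/ B v.
  move=> [s /= sS cs]; have /orP[sub|dis] := split_cone s sS.
    by left; exists s => //; rewrite sS.
  by right; exists s => //; rewrite sS.
have gen_supp (i : 'I_(nrays F)) : (fan_support F `\ 0) (gen i).
  split; last by move=> /eqP; rewrite (negPf (gen_neq0 i)).
  by exists [set i]%SET; [exact: rays|exact: ray_gen].
have [i iS] := set0Pn _ S0.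
have Ai (j : 'I_(nrays F)) : j \in S -> A (gen j).
  by move=> jS; exists [set j]%SET; rewrite ?rays ?finset.sub1set //; exact: ray_gen.
have Bj (j : 'I_(nrays F)) : j \notin S -> B (gen j).
  move=> jS; exists [set j]%SET; last exact: ray_gen.
  by rewrite rays disjoints1.
have E : (fan_support F `\ 0) `&` A = fan_support F `\ 0.
  apply: conn.
  - by exists (gen i); split; [exact: gen_supp|exact: Ai].
  - exists (~` B); first by apply: closed_openC; exact: closed_cone_union.
    apply/seteqP; split=> v [[vF v0] vA]; split=> //.
      by move=> vB; apply: v0; exact: AB.
    by have [//|vB] := suppAB v vF; case: vA.
  - by exists A; first exact: closed_cone_union.
have [j jS] : exists j, j \notin S.
  apply/existsP; apply: contraNT ST => /existsPn H.
  by apply/eqP/setP => j; rewrite inE; move: (H j); rewrite negbK => ->.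
have [_ Aj] : ((fan_support F `\ 0) `&` A) (gen j) by rewrite E.
by have := gen_neq0 j; rewrite (AB _ Aj (Bj j jS)) eqxx.
Qed.

End Connectedness.

(** * The Lorentzian property *)

Section StarFan.
Variables (R : realType) (n : nat) (Sigma : fan_data R n).
Variable ip : {dot 'rV[R]_n for idfun}.
Local Notation m := (nrays Sigma).
Hypothesis dc : downclosed Sigma.
Hypothesis ic : indepcones Sigma.
Hypothesis fc : forall pi sigma, pi \in cones Sigma -> sigma \in cones Sigma ->
  face pi sigma = (pi \subset sigma).
Hypothesis inter : forall s s' v, s \in cones Sigma -> s' \in cones Sigma ->
  cone s v -> cone s' v -> cone (s :&: s')%SET v.
Variable tau : {set 'I_m}.
Hypothesis tS : tau \in cones Sigma.
Local Notation St := (star ip tau).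
Local Notation e := (@enum_val _ (mem (star_rays tau))).
Local Notation lift := (starlift (ip := ip)).

Lemma star_ray_cone (j : 'I_(nrays St)) : [set j]%SET \in cones St.
Proof.
rewrite (star_conesE dc fc tS) /starlift finset.imset_set1.
by have := enum_valP j; rewrite star_raysP // => /andP[].
Qed.

(* Adding a large element of the cone of [tau] lifts a common point of two
   cones of the star to a common point of two cones of the fan. *)
Lemma star_cone_inter (s s' : {set 'I_(nrays St)}) v :
  s \in cones St -> s' \in cones St -> cone s v -> cone s' v -> cone (s :&: s')%SET v.
Proof.
rewrite !(star_conesE dc fc tS) => sS s'S [a a0 va] [b b0 vb].
have it := ic tS.
have en (j : 'I_(nrays St)) : e j \notin tau by exact: (e_notin dc fc tS j).
pose sum1 (t : {set 'I_(nrays St)}) (c : 'I_(nrays St) -> R) : 'rV[R]_n :=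
  \sum_(j in t) c j *: gen (e j).
have projE (t : {set 'I_(nrays St)}) c : exists2 q, q \in cone_span tau &
    \sum_(j in t) c j *: gen j = sum1 t c - q.
  exists (sum1 t c - \sum_(j in t) c j *: gen j); last by rewrite opprB addrC subrK.
  rewrite -sumrB; apply: rpred_sum => j _; rewrite -scalerBr; apply: rpredZ.
  by rewrite (star_genE ic tS) /perp opprB addrCA subrr addr0 vertex_span.
have [qa qaT Ea] := projE s a; have [qb qbT Eb] := projE s' b.
have [c cE] := spanP (rpredB qaT qbT).
have ab : sum1 s a = sum1 s' b + \sum_(i in tau) c i *: gen i.
  move: va; rewrite Ea {1}vb Eb -cE => /eqP; rewrite eq_sym subr_eq => /eqP ->.
  by rewrite addrAC -addrA [qa - qb]addrC addrA.
(* Over [tau], the coefficients of [q] are [|c i|] when read from [s] and [c i + |c i|] when read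
   from [s'], both nonnegative. *)
pose q := sum1 s a + \sum_(i in tau) `|c i| *: gen i.
have liftE (t : {set 'I_(nrays St)}) (x : 'I_(nrays St) -> R) (y : 'I_m -> R) :
    sum1 t x + \sum_(i in tau) y i *: gen i =
    \sum_(i in lift t) (\sum_(j | e j == i) x j + (if i \in tau then y i else 0)) *: gen i.
  have fE j : \sum_(k | e k == e j) x k = x j.
    by rewrite (eq_bigl (pred1 j)) ?big_pred1_eq // => k /=; rewrite (inj_eq enum_val_inj).
  have nE i : i \in tau -> \sum_(k | e k == i) x k = 0.
    move=> iT; rewrite big_pred0 // => k; apply/negbTE; apply: contraTneq iT => <-.
    exact: en.
  rewrite addrC /starlift [RHS](big_setID tau) /=; congr (_ + _).
    have -> : (([set e j | j in t] :|: tau) :&: tau)%SET = tau.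
      by apply/finset.setIidPr; exact: finset.subsetUr.
    by apply: eq_bigr => i iT; rewrite nE // iT add0r.
  have -> : (([set e j | j in t] :|: tau) :\: tau)%SET = [set e j | j in t]%SET.
    apply/setP => i; rewrite !inE; have [iT|//] := boolP (i \in tau).
      by apply/esym/negP => /imsetP[j _ iE]; move: (en j); rewrite -iE iT.
    by rewrite orbF.
  rewrite big_imset /=; last by move=> ? ? _ _; exact: enum_val_inj.
  by apply: eq_bigr => j _; rewrite fE (negPf (en j)) addr0.
have cone_lift t x y : (forall j, 0 <= x j) -> (forall i, 0 <= y i) ->
    cone (lift t) (sum1 t x + \sum_(i in tau) y i *: gen i).
  move=> x0 y0; rewrite liftE; eexists; last by reflexivity.
  by move=> i; rewrite addr_ge0 ?sumr_ge0 //; case: ifP.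
have qs : cone (lift s) q by apply: cone_lift.
have qs' : cone (lift s') q.
  rewrite /q ab -addrA -big_split /=; under eq_bigr do rewrite -scalerDl.
  apply: cone_lift => // i; have := ler_norm (- c i); rewrite normrN => ?.
  by rewrite -[0](subrr (c i)) lerD2l.
have sub : (lift s :&: lift s')%SET \subset lift s by exact: finset.subsetIl.
have := (cone_subP ip q (ic sS) sub).1 (inter sS s'S qs qs') => -[_ qz].
have az j : j \in s -> j \notin s' -> a j = 0.
  move=> js js'; rewrite -[RHS](qz (e j)) ?(mem_starlift dc fc tS) //; last first.
    by rewrite finset.in_setI !(mem_starlift dc fc tS) js (negPf js').
  rewrite /q liftE dual_sum ?(mem_starlift dc fc tS) //; last exact: ic.
  rewrite (negPf (en j)) addr0 (eq_bigl (pred1 j)) ?big_pred1_eq // => k /=.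
  by rewrite (inj_eq enum_val_inj).
exists a => //; rewrite va (big_setID s') /= [X in _ + X]big1 ?addr0 //.
by move=> j; rewrite inE => /andP[js' js]; rewrite az // scale0r.
Qed.

End StarFan.

(** * Positivity of mixed derivatives and the induction for the Hessian *)

Section Main.
Variables (R : realType) (n d : nat) (Sigma : fan_data R n).
Local Notation m := (nrays Sigma).
Variable omega : {set 'I_m} -> R.
Variable ip : {dot 'rV[R]_n for idfun}.
Hypothesis fan : is_fan Sigma.
Hypothesis pure : is_pure Sigma d.
Hypothesis simplicial : is_simplicial Sigma.
Hypothesis omega_gt0 : forall sigma, sigma \in kcones Sigma d -> 0 < omega sigma.
Hypothesis cub_neq0 : cub Sigma ip !=set0.
Hypothesis conn : forall (k : nat) tau, (k + 3 <= d)%N -> tau \in kcones Sigma k ->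
  connected (fan_support (star ip tau) `\ 0).
Hypothesis codim2 : forall tau, tau \in kcones Sigma (d - 2) ->
  one_pos_eigenvalue (hessian
    (volpoly ip (star_weight ip tau omega) (d - \dim (cone_span tau)))).
Implicit Types (sigma tau rho : {set 'I_m}) (x y v : 'rV[R]_m) (l : seq 'rV[R]_m).

Let ic : indepcones Sigma. Proof. by move=> s /simplicial /indepP. Qed.
Let dc : downclosed Sigma. Proof. exact: (fan_downclosed ip). Qed.
Let fc pi sigma : pi \in cones Sigma -> sigma \in cones Sigma ->
  face pi sigma = (pi \subset sigma).
Proof. exact: (faceE ip). Qed.

Local Notation w := (weight omega d).
Local Notation mixed := (mixed ip w).
Let wi sigma : w sigma != 0 -> indep sigma. Proof. exact: weight_indep. Qed.

Lemma mixed_notin tau l : tau \notin cones Sigma -> mixed tau l = 0.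
Proof.
move=> tS; apply: mixed_eq0 => sigma ps; rewrite /weight kconesE //.
by case: ifP => // /andP[sS _]; rewrite (dc sS ps) in tS.
Qed.

(** All terms of the recursion are nonnegative, and purity provides a ray extending [tau], whose
    term is positive. *)
Lemma mixed_gt0 l tau : tau \in cones Sigma -> (#|tau| + size l)%N = d ->
  (forall v, v \in l -> cub Sigma ip v) -> 0 < mixed tau l.
Proof.
elim: l tau => [|v l IH] tau tS td lc.
  rewrite addn0 in td; have tk : tau \in kcones Sigma d by rewrite kconesE // tS td /=.
  by rewrite /= /weight tk omega_gt0.
have pos i : i \notin tau -> (i |: tau)%SET \in cones Sigma ->
    0 < L ip tau i v * mixed (i |: tau)%SET l.
  move=> it iS; apply: mulr_gt0.
    by apply: (L_gt0 (ic iS)) => //; apply: cub_cubc => //; apply: lc; rewrite mem_head.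
  apply: IH => //; first by rewrite cardsU1 it -td /= add1n addSnnS.
  by move=> u ul; apply: lc; rewrite inE ul orbT.
rewrite /= pmulr_rgt0 ?ltr0n //.
have [sigma [sS ts sd]] := fan_pure ip fan ic pure tS.
have : tau != sigma.
  apply/eqP => ts'; move/eqP: td.
  by rewrite ts' sd -[X in _ == X]addn0 eqn_add2l.
rewrite finset.eqEsubset ts /= => /subsetPn[i isig it].
have iS : (i |: tau)%SET \in cones Sigma.
  by apply: dc sS _; rewrite finset.subUset finset.sub1set isig.
rewrite (bigD1 i) //=; apply: ltr_pwDl; first exact: pos.
apply: sumr_ge0 => j /andP[jt _].
have [jS|jS] := boolP ((j |: tau)%SET \in cones Sigma); first exact/ltW/pos.
by rewrite mixed_notin // mulr0.
Qed.

(** [hyper_step] treats only the orthogonal of the direction [e] that also occurs in the list; this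
    passes to any [v]. The combination [a x - b v] is orthogonal to [e], and its value is [a^2]
    times that of [x] plus a nonnegative term. *)
Lemma hyper_transfer tau l e v x : tau \in cones Sigma ->
  (forall y, mixed tau [:: y, e & l] = 0 -> mixed tau [:: y, y & l] <= 0) ->
  0 < mixed tau [:: v, e & l] -> 0 < mixed tau [:: v, v & l] ->
  mixed tau [:: x, v & l] = 0 -> mixed tau [:: x, x & l] <= 0.
Proof.
move=> tS He ve vv xv.
pose a := mixed tau [:: v, e & l]; pose b := mixed tau [:: x, e & l].
have vx : mixed tau [:: v, x & l] = 0 by rewrite (mixed_swap ip wi).
have sc (p q : R) y z u : mixed tau [:: p *: y + q *: z, u & l] =
    p * mixed tau [:: y, u & l] + q * mixed tau [:: z, u & l].
  rewrite (mixed_sum ip w (ic tS) (p *: y + q *: z)) (mixed_sum ip w (ic tS) y).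
  rewrite (mixed_sum ip w (ic tS) z) !mulr_sumr -big_split; apply: eq_bigr => i _ /=.
  by rewrite !mxE; ring.
have sc2 (p q : R) y z u : mixed tau [:: u, p *: y + q *: z & l] =
    p * mixed tau [:: u, y & l] + q * mixed tau [:: u, z & l].
  by rewrite !(mixed_swap ip wi _ u) sc.
pose y := a *: x + (- b) *: v.
have ye : mixed tau [:: y, e & l] = 0 by rewrite /y sc -/a -/b; ring.
have := He y ye; rewrite /y sc !sc2 vx xv => yy.
have a0 : 0 < a ^+ 2 by rewrite exprn_gt0.
rewrite -(pmulr_rle0 _ a0).
have b0 : 0 <= b ^+ 2 * mixed tau [:: v, v & l] by rewrite mulr_ge0 ?sqr_ge0 // ltW.
move: yy b0; set A := mixed tau [:: x, x & l]; set B := mixed tau [:: v, v & l] => yy b0.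
have E : a ^+ 2 * A = a * (a * A + - b * 0) + - b * (a * 0 + - b * B) - b ^+ 2 * B by ring.
by rewrite E subr_le0 (le_trans yy).
Qed.

Lemma mixed_link tau rho x l : tau \in cones Sigma -> tau \subset rho ->
  mixed rho (x :: l) = (size l).+1%:R *
    \sum_(j < #|star_rays tau| | enum_val j \notin rho)
      L ip rho (enum_val j) x * mixed (enum_val j |: rho)%SET l.
Proof.
move=> tS tr; rewrite [LHS]/=; congr (_ * _).
rewrite (bigID (mem (star_rays tau))) /= [X in _ + X]big1 ?addr0; last first.
  move=> i /andP[ir it]; rewrite mixed_notin ?mulr0 //.
  apply: contra it => iS; rewrite (star_raysP dc fc tS); apply/andP; split.
    by apply: contra ir; exact: fintype.subsetP.
  by apply: dc iS _; exact: finset.setUS.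
rewrite (eq_bigl (fun i => (i \in star_rays tau) && (i \notin rho))); last first.
  by move=> i; rewrite andbC.
by rewrite big_enum_val_cond.
Qed.

Lemma enum_ray tau (j : 'I_#|star_rays tau|) : tau \in cones Sigma ->
  enum_val j \notin tau /\ (enum_val j |: tau)%SET \in cones Sigma.
Proof. by move=> tS; have := enum_valP j; rewrite (star_raysP dc fc tS) => /andP. Qed.

Lemma link_connected tau (S : {set 'I_#|star_rays tau|}) : tau \in cones Sigma ->
  (#|tau| + 3 <= d)%N -> S != finset.set0 -> S != finset.setT ->
  exists i j, [/\ i \in S, j \notin S &
    (enum_val i |: (enum_val j |: tau))%SET \in cones Sigma].
Proof.
move=> tS td S0 ST.
have ct : connected (fan_support (star ip tau) `\ 0).
  have dimt : \dim (cone_span tau) = #|tau| by apply/indepP; exact: ic.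
  by apply: (conn td); rewrite inE tS dimt /=.
have dcS : downclosed (star ip tau) := star_downclosed (ip := ip) dc fc tS.
have icS : indepcones (star ip tau) := star_indepcones (ip := ip) dc ic fc tS.
have cI s s' u := @star_cone_inter _ _ _ ip dc ic fc (@cone_inter _ _ _ ip fan ic) tau tS s s' u.
have [i [j [iS jS ij]]] := fan_graph_connected ip dcS icS
  (@star_ray_cone _ _ _ ip dc fc tau tS) cI ct S0 ST.
exists i, j; split=> //.
by move: ij; rewrite (star_conesE dc fc tS) starliftU /starlift finset.imset_set1.
Qed.

Lemma hyper_base tau v x : tau \in cones Sigma -> (#|tau| + 2)%N = d -> cub Sigma ip v ->
  mixed tau [:: x; v] = 0 -> mixed tau [:: x; x] <= 0.
Proof.
move=> tS td vc; have it := ic tS.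
have dimt : \dim (cone_span tau) = #|tau| by rewrite (indepP _).2.
have tk : tau \in kcones Sigma (d - 2) by rewrite inE tS dimt -td addnK /=.
have := codim2 tk; rewrite dimt.
have td' : (#|tau| <= d)%N by rewrite -td leq_addr.
have dcS : downclosed (star ip tau) := star_downclosed (ip := ip) dc fc tS.
have icS : indepcones (star ip tau) := star_indepcones (ip := ip) dc ic fc tS.
have cS : cub (star ip tau) ip !=set0.
  by exists (starrow ip tau v); exact: star_cub.
rewrite volpolyE //.
have wS := @weight_indep _ _ _ icS (star_weight ip tau omega) (d - #|tau|)%N.
have i0 : indep (finset.set0 : {set 'I_(nrays (star ip tau))}) by move=> a _ i; rewrite inE.
have d2 : (d - #|tau|)%N = 2%N by rewrite -td addKn.
set W := Wpoly _ _ _ _; have WE : W = Wpoly ip (weight (star_weight ip tau omega)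
    (d - #|tau|)%N) 2 finset.set0 by rewrite /W; congr (Wpoly _ _ _ _).
have qE a b : qform (hessian W) (starrow ip tau a) (starrow ip tau b) = mixed tau [:: a; b].
  rewrite WE (qform_hessian ip wS i0 [::]).
  by rewrite (mixed_star dc ic fc tS omega td' finset.set0 [:: a; b]) starlift0.
have sym : (hessian W)^T = hessian W.
  by rewrite WE; exact: (tr_hessian ip wS finset.set0 [::]).
move=> op; rewrite -!qE; apply: (one_pos_eigenvalue_le0 (v := starrow ip tau v)) => //.
rewrite qE; apply: mixed_gt0 => //.
by move=> u; rewrite !inE => /orP[]/eqP->.
Qed.

(* [MIH] is the reverse Cauchy-Schwarz inequality in the stars of the rays; it
   gives the hypothesis [bochner] of [bochner_perron]. *)
Lemma hyper_step tau e l x : tau \in cones Sigma -> (#|tau| + size l + 3)%N = d ->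
  cub Sigma ip e -> (forall u, u \in l -> cub Sigma ip u) ->
  (forall i, i \notin tau -> (i |: tau)%SET \in cones Sigma -> forall y,
     mixed (i |: tau)%SET [:: y, e & l] = 0 -> mixed (i |: tau)%SET [:: y, y & l] <= 0) ->
  mixed tau [:: x, e, e & l] = 0 -> mixed tau [:: x, x, e & l] <= 0.
Proof.
move=> tS td ec lc IH xe; have it := ic tS.
pose E (i : 'I_#|star_rays tau|) := enum_val i.
have Et i : E i \notin tau by have [] := enum_ray i tS.
have ES i : (E i |: tau)%SET \in cones Sigma by have [] := enum_ray i tS.
have Einj i j : (E i == E j) = (i == j) by rewrite (inj_eq enum_val_inj).
pose M i y z := mixed (E i |: tau)%SET [:: y, z & l].
(* The degree factors of [mixed] at [E i |: tau] and, for [c1], at [tau]. *)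
pose c0 : R := (size l).+2%:R; have c0_gt0 : 0 < c0 by rewrite ltr0n.
pose c1 : R := (size l).+3%:R; have c1_gt0 : 0 < c1 by rewrite ltr0n.
pose q i j := c0 * mixed (E j |: (E i |: tau))%SET (e :: l).
pose y_ (y : 'rV[R]_m) i := L ip tau (E i) y.
(* Expanding [M i y e], the corrections of [LS] all multiply [y_ y i]; [r i] collects them. *)
pose r i := \sum_(j | j != i) q i j * (gram ip tau (E i) (E j) / gram ip tau (E i) (E i)).
have qC i j : q i j = q j i by rewrite /q finset.setUCA.
have cardE2 i j : j != i -> (#|E j |: (E i |: tau)|%SET + (size l).+1)%N = d.
  move=> ji; rewrite cardsU1 finset.in_setU1 Einj (negPf ji) (negPf (Et j)) /=.
  by rewrite cardsU1 Et -td; lia.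
have elc u : u \in e :: l -> cub Sigma ip u by rewrite inE => /predU1P[->|/lc].
have q_gt0 i j : j != i -> (E j |: (E i |: tau))%SET \in cones Sigma -> 0 < q i j.
  by move=> ji ij; rewrite mulr_gt0 // mixed_gt0 // cardE2.
have q_ge0 i j : i != j -> 0 <= q i j.
  rewrite eq_sym => ji; have [ij|ij] := boolP ((E j |: (E i |: tau))%SET \in cones Sigma).
    exact/ltW/q_gt0.
  by rewrite /q mixed_notin // mulr0.
have ME i y : M i y e = \sum_(j | j != i) q i j * y_ y j - r i * y_ y i.
  rewrite /M (mixed_link _ _ tS); last exact: finset.subsetUr.
  rewrite mulr_sumr /r mulr_suml -sumrB; apply: eq_big => j.
    by rewrite finset.in_setU1 -/(E j) Einj negb_or Et andbT.
  by move=> _; rewrite LS ?Et //; [rewrite /q /y_ -/(E j) /c0 /=; ring|exact: ic].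
have e_gt0 i : 0 < y_ e i.
  by apply: (L_gt0 (ic (ES i))) => //; exact: cub_cubc.
have Mee i : 0 < M i e e.
  apply: mixed_gt0 => //; first by rewrite cardsU1 Et -td /=; lia.
  by move=> u; rewrite inE => /predU1P[->//|]; exact: elc.
(* The form at [tau] is expanded along its argument here and, by symmetry, along [e] in [Q2];
   comparing the two is Bochner's identity. *)
have Q1 y z : mixed tau [:: y, z, e & l] = c1 * \sum_i y_ y i * M i z e.
  rewrite (mixed_link _ _ tS) // /c1; congr (_ * _); apply: eq_bigl => i.
  exact: Et.
have Q2 y : mixed tau [:: y, y, e & l] = c1 * \sum_i y_ e i * M i y y.
  rewrite (mixed_swap2 ip wi) (mixed_swap ip wi) (mixed_link _ _ tS) // /c1.
  by congr (_ * _); apply: eq_bigl => i; exact: Et.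
(* The induction hypothesis is applied to [y + p e], the component of [y] orthogonal to [e] for
   [M i]. *)
have MIH i y : M i y y <= (M i y e) ^+ 2 / M i e e.
  have sc (p : R) a b u : M i (a + p *: b) u = M i a u + p * M i b u.
    rewrite /M (mixed_sum ip w (ic (ES i)) (a + p *: b)) (mixed_sum ip w (ic (ES i)) a).
    rewrite (mixed_sum ip w (ic (ES i)) b) !mulr_sumr -big_split; apply: eq_bigr => k _ /=.
    by rewrite !mxE; ring.
  have MC a b : M i a b = M i b a by rewrite /M (mixed_swap ip wi).
  pose p := - (M i y e / M i e e).
  have M0 : M i e e != 0 by rewrite gt_eqF.
  have ze : M i (y + p *: e) e = 0 by rewrite sc /p mulNr divfK // subrr.
  have := IH _ (Et i) (ES i) _ ze; rewrite -/(M i _ _) sc (MC y) (MC e) !sc (MC e y) => le.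
  rewrite -subr_ge0 -oppr_le0; apply: le_trans le; rewrite le_eqVlt; apply/orP; left.
  by apply/eqP; rewrite /p; field.
pose beta (y : 'I_#|star_rays tau| -> R) i : R :=
  \sum_(j | j != i) q i j * y j - r i * y i.
have betaE y i : beta (y_ y) i = M i y e by rewrite ME.
have qconn (S : {set 'I_#|star_rays tau|}) : S != finset.set0 -> S != finset.setT ->
    exists i j, [/\ i \in S, j \notin S & 0 < q i j].
  move=> S0 ST; have td3 : (#|tau| + 3 <= d)%N by rewrite -td; lia.
  have [i [j [iS jS ij]]] := link_connected tS td3 S0 ST.
  exists i, j; split=> //; apply: q_gt0; first by apply: contraNneq jS => ->.
  by rewrite finset.setUCA.
(* [bochner_perron] quantifies over all functions on the rays of the star. A row vanishing on [tau]
   has vertex zero there, so its support numbers are its own coordinates. *)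
have real_y (y : 'I_#|star_rays tau| -> R) : exists z, y_ z =1 y.
  pose z : 'rV[R]_m := \row_k \sum_(j | E j == k) y j.
  have zE j : z ord0 (E j) = y j.
    by rewrite mxE (eq_bigl (pred1 j)) ?big_pred1_eq // => k /=; rewrite Einj.
  exists z => j; rewrite /y_ /L (_ : cub_vertex ip tau z = 0) ?ip0l ?subr0 ?zE //.
  apply: vertex_unique => //; first exact: rpred0.
  move=> k kt; rewrite ip0l mxE big_pred0 // => i; apply/negbTE.
  by apply: contraTneq kt => <-; exact: Et.
have bochner (y : 'I_#|star_rays tau| -> R) :
    \sum_i y i * beta y i <= \sum_i y_ e i * (beta y i) ^+ 2 / M i e e.
  have [z zy] := real_y y.
  have bz i : beta y i = M i z e.
    rewrite -betaE /beta zy; congr (_ - _); apply: eq_bigr => j _; by rewrite zy.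
  have := Q2 z; rewrite (Q1 z z) => /(mulfI (lt0r_neq0 c1_gt0)) EQ.
  under eq_bigr => i _ do rewrite bz -zy.
  rewrite EQ; apply: ler_sum => i _; rewrite bz -mulrA ler_wpM2l //.
  exact: ltW.
have := bochner_perron qC q_ge0 e_gt0 Mee qconn (fun i => betaE e i) bochner (x := y_ x).
have -> : \sum_i y_ x i * M i e e = 0.
  have := Q1 x e; rewrite xe => /esym/eqP; rewrite mulf_eq0 gt_eqF //=.
  by move/eqP.
move=> /(_ erefl) le; rewrite Q1 pmulr_rle0 //.
by under eq_bigr do rewrite -betaE.
Qed.

(** The head [e] of the list serves as the direction of expansion in [hyper_step], which needs the
    statement for the tail at every [i |: tau]; [hyper_transfer] then replaces [e] by [v]. *)
Lemma hyper l tau v x : tau \in cones Sigma -> (#|tau| + size l + 2)%N = d ->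
  (forall u, u \in l -> cub Sigma ip u) -> cub Sigma ip v ->
  mixed tau [:: x, v & l] = 0 -> mixed tau [:: x, x & l] <= 0.
Proof.
elim: l tau v x => [|e l IH] tau v x tS td lc vc.
  by apply: hyper_base => //; rewrite -td addn0.
have ec : cub Sigma ip e by apply: lc; rewrite mem_head.
have lc' u : u \in l -> cub Sigma ip u by move=> ul; apply: lc; rewrite inE ul orbT.
have card2 : (#|tau| + (size l).+3)%N = d by rewrite -td /=; lia.
apply: (hyper_transfer (e := e)) => //.
- move=> y; apply: hyper_step => //; first by rewrite -td /=; lia.
  move=> i itau iS y'; apply: IH => //.
  by rewrite cardsU1 itau -td /=; lia.
- by apply: mixed_gt0 => // u; rewrite !inE => /or4P[/eqP->|/eqP->|/eqP->|/lc'].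
- by apply: mixed_gt0 => // u; rewrite !inE => /or4P[/eqP->|/eqP->|/eqP->|/lc'].
Qed.

Lemma open_positive_cub : open_positive_cone (cub Sigma ip).
Proof.
have cP := cubP ip ic; split=> //.
- exact: open_cub.
- move=> y z /cP yc /cP zc; apply/cP => s sS i iS.
  by rewrite vertexD; [rewrite ipDl; apply: addr_gt0; [exact: yc|exact: zc]|exact: ic].
- move=> a z a0 /cP zc; apply/cP => s sS i iS.
  by rewrite vertexZ; [rewrite ipZl; apply: mulr_gt0 => //; exact: zc|exact: ic].
- move=> z zc i; case: (fan) => _ rays _ _ _.
  apply: (cubc_gt0 (ic (rays i))); first exact: (cub_cubc dc ic zc (rays i)).
  exact: finset.set11.
Qed.

End Main.

Theorem theorem5p7 (R : realType) (n d : nat) (Sigma : fan_data R n)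
    (omega : {set 'I_(nrays Sigma)} -> R)
    (ip : {dot 'rV[R]_n for idfun}) :
  (2 <= d)%N ->
  is_fan Sigma -> is_pure Sigma d -> is_simplicial Sigma ->
  (forall sigma, sigma \in kcones Sigma d -> 0 < omega sigma) ->
  cub Sigma ip !=set0 ->
  (forall (k : nat) tau, (k + 3 <= d)%N -> tau \in kcones Sigma k ->
     connected (fan_support (star ip tau) `\ 0)) ->
  (forall tau, tau \in kcones Sigma (d - 2) ->
     one_pos_eigenvalue (hessian
       (volpoly ip (star_weight ip tau omega)
          (d - \dim (cone_span tau))))) ->
  lorentzian (cub Sigma ip) d (volpoly ip omega d).
Proof.
move=> d2 fan pure simp omega_gt0 cub0 conn codim2.
have ic : indepcones Sigma by move=> s /simp /indepP.
have dc : downclosed Sigma := fan_downclosed ip fan ic.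
have S0 : finset.set0 \in cones Sigma := set0_cone ip fan ic pure.
have wi := @weight_indep _ _ _ ic omega d.
rewrite volpolyE //; split.
- exact: (open_positive_cub fan simp).
- exact: Wpoly_homog.
move=> s sd sc; split.
  exists (mixed ip (weight omega d) finset.set0 s).
    by apply: (mixed_gt0 fan pure simp omega_gt0) => //; rewrite cards0.
  by rewrite -{2}sd mixedE.
have dE : d = (size (drop 2 s)).+2 by rewrite size_drop sd; lia.
have lc u : u \in drop 2 s -> cub Sigma ip u by move=> /mem_drop; exact: sc.
have [v vc] := cub0.
rewrite [X in Wpoly _ _ X]dE.
apply: (le0_one_pos_eigenvalue (e := v)).
- exact: tr_hessian.
- rewrite qform_hessian //; last exact: ic.
  apply: (mixed_gt0 fan pure simp omega_gt0) => //.
    by rewrite cards0 /= -dE.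
  by move=> u; rewrite !inE => /or3P[/eqP->|/eqP->|/lc].
- move=> x; rewrite !qform_hessian //; try exact: ic.
  apply: (hyper fan pure simp omega_gt0 conn codim2) => //.
  by rewrite cards0 add0n addn2.
Qed.
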